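(* Let $F$ and $G$ be $\varphi$-functions, and $0<p<\infty$. (i) If the lower Boyd index satisfies $p(L_{F,G})>p$, and if $G\succ H^{-1}\circ T^p$ for some $N$-function $H$ satisfying condition $(J)$, then $L_{F,G}$ is $p$-convex. (ii) If $L_{F,G}$ is $p$-convex, then $p(L_{F,G})\ge p$, and $G\succ H^{-1}\circ T^p$ for some $N$-function $H$ satisfying condition $(J)$.
   Context: A $\varphi$-function is a continuous, strictly increasing function $F:[0,\infty)\to[0,\infty)$ with $F(0)=0$ and $\lim_{t\to\infty}F(t)=\infty$. $T^p$ denotes $t\mapsto t^p$. Two $\varphi$-functions $F,G$ are equivalent if for some $c<\infty$, $F(t/c)\le G(t)\le F(ct)$ for all $t\ge0$. For $\varphi$-functions $F,G$, write $G\succ F$ (and $F\prec G$) if $G\circ F^{-1}$ is equivalent to a convex function. An $N$-function is a $\varphi$-function equivalent to a $\varphi$-function $F_0$ such that $F_0(t)/t$ is strictly increasing, $F_0(t)/t\to\infty$ as $t\to\infty$, and $F_0(t)/t\to0$ as $t\to0$. A $\varphi$-function $H^*$ is complementary to $H$ if for some $c<\infty$, $t/c\le H^{-1}(t)\,(H^* )^{-1}(t)\le ct$ for all $t\ge0$. For a $\varphi$-function $F$ put $\tilde F(t)=1/F(1/t)$ for $t>0$, $\tilde F(0)=0$. Functions live on $[0,\infty)$ with Lebesgue measure $\lambda$; $f^*(x)=\sup\{t:\lambda(|f|\ge t)\ge x\}$. Luxemburg functional: $\|f\|_G=\inf\{c>0:\int_0^\infty G(|f(x)|/c)\,dx\le1\}$.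 An $N$-function $H$ satisfies condition $(J)$ if, for a function $H^*$ complementary to $H$, the function $x\mapsto 1/(\widetilde{H^*})^{-1}(x)$ has finite Luxemburg functional $\|\cdot\|_{H^*}$. Orlicz--Lorentz functional: $\|f\|_{F,G}=\|f^*\circ\tilde F\circ\tilde G^{-1}\|_G$, space $L_{F,G}=\{f:\|f\|_{F,G}<\infty\}$. Dilation operators $d_af(x)=f(ax)$, $\|d_a\|_{X\to X}=\sup\{\|d_af\|_X/\|f\|_X:0<\|f\|_X<\infty\}$; lower Boyd index $p(X)=\sup\{p:\exists c<\infty,\ \|d_a\|_{X\to X}\le c\,a^{-1/p}\ \forall a<1\}$. $X$ is $p$-convex if there is $C<\infty$ with $\|(\sum_{i=1}^n|f_i|^p)^{1/p}\|_X\le C(\sum_{i=1}^n\|f_i\|_X^p)^{1/p}$ for all $n$ and $f_1,\dots,f_n\in X$. *)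

(* Defs.v *)
From HB Require Import structures.
From mathcomp Require Import all_boot all_order all_algebra.
From mathcomp Require Import all_classical all_reals all_analysis.
Set Implicit Arguments. Unset Strict Implicit. Unset Printing Implicit Defensive.
Import Order.TTheory GRing.Theory Num.Theory.
Import numFieldNormedType.Exports.
Local Open Scope classical_set_scope.
Local Open Scope ring_scope.

Section Defs.
Variable R : realType.
Implicit Types (F G H K : R -> R) (f : R -> R).

Definition halfline : set R := `[0%R, +oo[%classic.

Definition phi_function F : Prop :=
  [/\ {within halfline, continuous F},
      {in halfline &, forall x y, x < y -> F x < F y},
      F 0 = 0 &
      F x @[x --> +oo] --> +oo].

Definition phi_inv F (y : R) : R := sup [set x | 0 <= x /\ F x <= y].

Definition powf (p : R) : R -> R := fun t => t `^ p.

Definition phi_equiv F G : Prop :=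
  exists c : R, 0 < c /\ forall t, 0 <= t -> F (t / c) <= G t /\ G t <= F (c * t).

Definition convex_on_halfline K : Prop :=
  forall x y l, 0 <= x -> 0 <= y -> 0 <= l <= 1 ->
    K (l * x + (1 - l) * y) <= l * K x + (1 - l) * K y.

Definition succ G F : Prop :=
  exists K, phi_function K /\ convex_on_halfline K /\ phi_equiv (G \o phi_inv F) K.

Definition N_function H : Prop :=
  phi_function H /\
  exists F0, phi_function F0 /\ phi_equiv H F0 /\
    {in `]0, +oo[ &, forall x y, x < y -> F0 x / x < F0 y / y} /\
    (F0 t / t) @[t --> +oo] --> +oo /\
    (F0 t / t) @[t --> 0^'+] --> 0.

Definition complementary H Hs : Prop :=
  phi_function Hs /\
  exists c : R, 0 < c /\ forall t, 0 <= t ->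
    t / c <= phi_inv H t * phi_inv Hs t /\ phi_inv H t * phi_inv Hs t <= c * t.

Definition tilde F (t : R) : R := if t == 0 then 0 else (F t^-1)^-1.

Definition Gext G (e : \bar R) : \bar R :=
  if e is r%:E then (G r)%:E else +oo%E.

Definition luxE G (g : R -> \bar R) : \bar R :=
  ereal_inf [set c%:E | c in [set c : R | 0 < c /\
    (\int[lebesgue_measure]_(x in halfline) Gext G (g x * (c^-1)%:E) <= 1)%E]].

Definition lux G f : \bar R := luxE G (fun x => (`|f x|)%:E).

Definition drearr f (x : R) : \bar R :=
  ereal_sup [set t%:E | t in [set t : R |
    (x%:E <= lebesgue_measure [set y | (0 <= y)%R /\ (t <= `|f y|)%R])%E]].

Definition condJ H : Prop :=
  exists Hs, complementary H Hs /\
    (lux Hs (fun x => ((phi_inv (tilde Hs) x)^-1)%R) < +oo)%E.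

Definition OLnorm F G f : \bar R :=
  luxE G (drearr f \o tilde F \o phi_inv (tilde G)).

Definition inOL F G f : Prop :=
  measurable_fun halfline f /\ (OLnorm F G f < +oo)%E.

Definition dil (a : R) f : R -> R := fun x => f (a * x).

Definition dil_norm F G (a : R) : \bar R :=
  ereal_sup [set (OLnorm F G (dil a f) * ((fine (OLnorm F G f))^-1)%R%:E)%E
             | f in [set f | inOL F G f /\ (0 < OLnorm F G f)%E]].

Definition lower_boyd F G : \bar R :=
  ereal_sup [set p%:E | p in [set p : R | 0 < p /\
    exists c : R, forall a, 0 < a -> a < 1 ->
      (dil_norm F G a <= (c * a `^ (- p^-1))%R%:E)%E]].

Definition p_convex F G (p : R) : Prop :=
  exists C : R, forall (n : nat) (fs : 'I_n -> R -> R),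
    (forall i, inOL F G (fs i)) ->
    (OLnorm F G (fun x => ((\sum_(i < n) `|fs i x| `^ p) `^ p^-1)%R)
      <= (C * (\sum_(i < n) fine (OLnorm F G (fs i)) `^ p) `^ p^-1)%R%:E)%E.

End Defs.

(* Main.v *)
(** Composing [f^*] with [F~ o G~^-1] turns [L_{F,G}] into the Luxemburg functional of
    [G] on decreasing functions, and replacing [G] by [Gp t = G (t^(1/p))] reduces
    everything to [p = 1].  The link between both parts is that the Luxemburg
    functional of [Gp] is equivalent to a norm on the cone of decreasing functions if
    and only if [Gp o H] is equivalent to a convex [K] for some [H] satisfying (J).

    (i) With [L] the inverse of the complementary [Hs] one has [Gp t ~ K (t / L t)], and
    (J) says that the scales [s_n = Hs (c^n)], [n] in Z, satisfy
    [sum s_(n-1) / s_n < oo].  If [0 <= u <= t] and [Gp t = 1/x] (as for values [u] at [x]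
    of functions in the unit ball), then either [L u] is comparable with [L t] and [Gp u]
    is comparable with the convex function [K (u / L t)] of [u], or [u] is many scales
    below [t] and [Gp u] is absorbed by a function of [x] with small integral.
    A Boyd index above [p] reduces a sum of arbitrary functions to a sum of dilated
    decreasing rearrangements.

    (ii) Disjoint copies of one function bound the dilations.  Testing on sums of step
    functions shows that pairs [s < t] with [Gp s / s] much larger than [Gp t / t],
    taken in disjoint intervals, have [sum s / t] bounded.  A greedy choice of such
    pairs, upwards from 1 for [Gp] and for its [tilde], gives the scales [s_n]; then
    [L t = inf_n c^n (1 + t / s_n)] is concave and [t / L t] is the inverse of [H]. *)
Require Import Defs.
From HB Require Import structures.
From mathcomp Require Import all_boot all_order all_algebra.
From mathcomp Require Import all_classical all_reals all_analysis measurable_realfun.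
From mathcomp Require Import zify ring lra.
Set Implicit Arguments. Unset Strict Implicit. Unset Printing Implicit Defensive.
Import Order.TTheory GRing.Theory Num.Theory.
Import numFieldNormedType.Exports.
Local Open Scope classical_set_scope.
Local Open Scope ring_scope.

(** * Phi-functions and their inverses *)

(** The map from [f] to its rearrangement is not subadditive and [G] itself need not be convex, so
    no triangle inequality is available. The only convexity is that of [K] in the variable
    [t / L t], which is linear once [L t] is frozen. Comparing values of [L] that are [k] scales
    apart costs [c^k]. This is affordable because summable ratios force a product of [m] consecutive
    ones below [(2/m)^m], which beats [c^m] for one fixed [m]. In (i) the strict inequality for the
    Boyd index makes the sum over dyadic layers converge: layer [k] has weight [2^(-k)], while its
    dilation costs about [2^(k p/q)] with [p < q]. In (ii) the test inequality applies only to
    families whose weights sum to at most 1, which is what has to be bounded. The greedy pairs are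
    therefore controlled by a bootstrap that adds one pair at a time. A choice by least elements
    runs towards infinity only, so the scales near 0 need [tilde]. A bounded zone around 1 escapes
    both runs; it costs a constant, and this constant must be paid only once along a whole chain of
    zones. *)

Section PhiFunctions.
Context {R : realType}.
Implicit Types F G : R -> R.

Lemma in_halfline (x : R) : (x \in @halfline R) = (0 <= x).
Proof. by apply/idP/idP; rewrite inE /halfline /= in_itv /= andbT. Qed.

Lemma phi0 F : phi_function F -> F 0 = 0.
Proof. by case. Qed.

Lemma phi_lt F : phi_function F -> forall x y, 0 <= x -> x < y -> F x < F y.
Proof.
move=> [_ Fi _ _] x y x0 xy; apply: Fi => //; rewrite in_halfline //.
exact: le_trans (ltW xy).
Qed.

Lemma phi_le F : phi_function F -> forall x y, 0 <= x -> x <= y -> F x <= F y.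
Proof.
move=> pF x y x0; rewrite le_eqVlt => /predU1P[->//|xy].
exact/ltW/phi_lt.
Qed.

Lemma phi_gt0 F : phi_function F -> forall x, 0 < x -> 0 < F x.
Proof. by move=> pF x x0; rewrite -(phi0 pF); exact: phi_lt. Qed.

Lemma phi_ge0 F : phi_function F -> forall x, 0 <= x -> 0 <= F x.
Proof. by move=> pF x x0; rewrite -(phi0 pF); exact: phi_le. Qed.

Lemma phi_ltW F : phi_function F -> forall x y, 0 <= y -> F x < F y -> x < y.
Proof.
move=> pF x y y0 h; rewrite ltNge; apply/negP => yx.
by move: h; rewrite ltNge phi_le.
Qed.

Lemma phi_leW F : phi_function F -> forall x y, 0 <= y -> F x <= F y -> x <= y.
Proof.
move=> pF x y y0 h; rewrite leNgt; apply/negP => yx.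
by move: h; rewrite leNgt phi_lt.
Qed.

Lemma phi_large F : phi_function F -> forall A, exists2 x, 0 <= x & A <= F x.
Proof.
move=> [_ _ _ Fy] A; have /cvgryPge/(_ A) := Fy.
move=> [M [_ hM]]; exists (Num.max 0 (M + 1)); first by rewrite le_max lexx.
by apply: hM; rewrite lt_max; apply/orP; right; rewrite ltrDl.
Qed.

Lemma phi_surj F : phi_function F -> forall y, 0 <= y -> exists2 x, 0 <= x & F x = y.
Proof.
move=> pF y y0; have [b b0 yb] := phi_large pF y.
have cF : {within `[0, b], continuous F}.
  have [cF _ _ _] := pF; apply: continuous_subspaceW cF => x /=.
  by rewrite /halfline /= !in_itv /= andbT => /andP[].
have := @IVT R F 0 b y b0 cF; case.
  by rewrite phi0 // minEle maxEle phi_ge0 // y0 yb.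
by move=> x; rewrite in_itv /= => /andP[x0 _] Fx; exists x.
Qed.

Lemma phi_inv_mem F : phi_function F -> forall x, 0 <= x ->
  phi_inv F (F x) = x.
Proof.
move=> pF x x0; rewrite /phi_inv.
have ub : ubound [set z | 0 <= z /\ F z <= F x] x.
  by move=> z [z0 zx]; apply: phi_leW zx.
apply/eqP; rewrite eq_le; apply/andP; split.
  by apply: ge_sup => //; exists x; split.
by apply: ub_le_sup => //; exists x.
Qed.

Lemma phi_invK F : phi_function F -> forall y, 0 <= y -> F (phi_inv F y) = y.
Proof.
move=> pF y y0; have [x x0 <-] := phi_surj pF y0.
by rewrite phi_inv_mem.
Qed.

Lemma phi_inv_ge0 F : phi_function F -> forall y, 0 <= y -> 0 <= phi_inv F y.
Proof.
move=> pF y y0; have [x x0 <-] := phi_surj pF y0.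
by rewrite phi_inv_mem.
Qed.

Lemma within_halfline_continuous F :
  (forall x e, 0 <= x -> 0 < e -> exists2 d, 0 < d &
     forall y, 0 <= y -> `|x - y| < d -> `|F x - F y| < e) ->
  {within @halfline R, continuous F}.
Proof.
move=> h; apply/subspace_continuousP => x; rewrite /halfline /= in_itv /= andbT => x0.
apply/cvgrPdist_lt => e e0; have [d d0 hd] := h x e x0 e0.
near=> y; apply: hd.
  have : @halfline R y by near: y; exact: withinT.
  by rewrite /halfline /= in_itv /= andbT.
near: y; apply: cvg_within; apply: nbhsx_ballx => //.
Unshelve. all: by end_near. Qed.

Lemma phi_of_cont F : (forall x y, 0 <= x -> x < y -> F x < F y) -> F 0 = 0 ->
  (forall x e, 0 <= x -> 0 < e -> exists2 d, 0 < d &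
     forall y, 0 <= y -> `|x - y| < d -> `|F x - F y| < e) ->
  (forall A, exists2 x, 0 <= x & A <= F x) -> phi_function F.
Proof.
move=> Fi F0 Fc Fl; split => //.
- exact: within_halfline_continuous.
- by move=> x y; rewrite !in_halfline => x0 _; exact: Fi.
- apply/cvgryPge => A; have [x x0 Ax] := Fl A.
  exists x; split; [exact: num_real|move=> y /= xy].
  by rewrite (le_trans Ax)// ltW// Fi.
Qed.

(* A strictly increasing surjection between half-lines has no jumps. *)
Lemma phi_of_surj F : (forall x y, 0 <= x -> x < y -> F x < F y) -> F 0 = 0 ->
  (forall y, 0 <= y -> exists2 x, 0 <= x & F x = y) -> phi_function F.
Proof.
move=> Fi F0 Fs.
have Fle x y : 0 <= x -> x <= y -> F x <= F y.
  by move=> x0; rewrite le_eqVlt => /predU1P[->//|xy]; exact/ltW/Fi.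
have Fltw x y : 0 <= y -> F x < F y -> x < y.
  by move=> y0 h; rewrite ltNge; apply/negP => /(Fle _ _ y0); rewrite leNgt h.
apply: phi_of_cont => //; last first.
  move=> A; have [|x x0 Fx] := Fs (Num.max A 0); first by rewrite le_max lexx orbT.
  by exists x => //; rewrite Fx le_max lexx.
move=> x e x0 e0.
have Fx0 : 0 <= F x by rewrite -F0 Fle.
have [|b b0 Fb] := Fs (F x + e / 2); first by rewrite addr_ge0// divr_ge0// ltW.
have xb : x < b by apply: Fltw => //; rewrite Fb ltrDl divr_gt0.
have [Fxe|Fxe] := leP (F x) (e / 2).
  exists (b - x); first by rewrite subr_gt0.
  move=> y y0; rewrite distrC ltr_norml => /andP[_ yb].
  have : F y <= F b by apply: Fle => //; move: yb; lra.
  have : 0 <= F y by rewrite -F0 Fle.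
  rewrite ltr_norml Fb; lra.
have [|a a0 Fa] := Fs (F x - e / 2); first by lra.
have ax : a < x by apply: Fltw => //; rewrite Fa; lra.
exists (Num.min (b - x) (x - a)); first by rewrite lt_min !subr_gt0 ax xb.
move=> y y0; rewrite distrC lt_min !ltr_norml => /andP[/andP[_ h1] /andP[h2 _]].
have : F y <= F b by apply: Fle => //; lra.
have : F a <= F y by apply: Fle => //; lra.
by rewrite Fa Fb; lra.
Qed.

Lemma phi_phi_inv F : phi_function F -> phi_function (phi_inv F).
Proof.
move=> pF; apply: phi_of_surj.
- move=> x y x0 xy; have y0 : 0 <= y by exact: le_trans (ltW xy).
  by apply: (phi_ltW pF); rewrite ?phi_invK ?phi_inv_ge0.
- by rewrite -{1}(phi0 pF) phi_inv_mem.
- by move=> y y0; exists (F y); [exact: phi_ge0|rewrite phi_inv_mem].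
Qed.

Lemma phi_inv_phi_inv F : phi_function F -> forall x, 0 <= x ->
  phi_inv (phi_inv F) x = F x.
Proof.
move=> pF x x0; rewrite -{1}(phi_inv_mem pF x0) phi_inv_mem ?phi_ge0//.
exact: phi_phi_inv.
Qed.

Lemma phi_inv_unique F : phi_function F -> forall x y, 0 <= x -> F x = y ->
  phi_inv F y = x.
Proof. by move=> pF x y x0 <-; rewrite phi_inv_mem. Qed.

Lemma tilde_gt0E F (t : R) : 0 < t -> tilde F t = (F t^-1)^-1.
Proof. by move=> t0; rewrite /tilde gt_eqF. Qed.

Lemma phi_tilde F : phi_function F -> phi_function (tilde F).
Proof.
move=> pF; have t0 : tilde F 0 = 0 by rewrite /tilde eqxx.
have tp x : 0 < x -> 0 < tilde F x.
  by move=> x0; rewrite tilde_gt0E// invr_gt0 phi_gt0// invr_gt0.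
apply: phi_of_surj => //.
- move=> x y; rewrite le_eqVlt => /predU1P[<-|x0] xy; first by rewrite t0 tp.
  have y0 : 0 < y by exact: lt_trans xy.
  rewrite !tilde_gt0E// ltf_pV2 ?posrE ?(phi_gt0 pF)// ?invr_gt0//.
  by apply: (phi_lt pF); rewrite ?invr_ge0 ?ltf_pV2// ltW.
- move=> y; rewrite le_eqVlt => /predU1P[<-|y0]; first by exists 0.
  have p0 : 0 < phi_inv F y^-1.
    by apply: (phi_gt0 (phi_phi_inv pF)); rewrite invr_gt0.
  exists (phi_inv F y^-1)^-1; first by rewrite invr_ge0 ltW.
  by rewrite tilde_gt0E ?invr_gt0// invrK phi_invK ?invrK// invr_ge0 ltW.
Qed.

Lemma phi_inv_tilde F : phi_function F -> forall x, 0 < x ->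
  phi_inv (tilde F) x = (phi_inv F x^-1)^-1.
Proof.
move=> pF x x0.
have p0 : 0 < phi_inv F x^-1.
  by apply: (phi_gt0 (phi_phi_inv pF)); rewrite invr_gt0.
apply: phi_inv_unique; first exact: phi_tilde.
  by rewrite invr_ge0 ltW.
by rewrite tilde_gt0E ?invr_gt0// invrK phi_invK ?invrK// invr_ge0 ltW.
Qed.

Lemma phi_comp F G : phi_function F -> phi_function G -> phi_function (F \o G).
Proof.
move=> pF pG; apply: phi_of_surj => /=.
- by move=> x y x0 xy; apply: phi_lt; rewrite ?phi_ge0// phi_lt.
- by rewrite !phi0.
- move=> y y0; have [z z0 Fz] := phi_surj pF y0.
  by have [x x0 Gx] := phi_surj pG z0; exists x; rewrite ?Gx.
Qed.

Lemma phi_inv_comp F G : phi_function F -> phi_function G -> forall y, 0 <= y ->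
  phi_inv (F \o G) y = phi_inv G (phi_inv F y).
Proof.
move=> pF pG y y0; apply: phi_inv_unique; first exact: phi_comp.
  by rewrite !phi_inv_ge0// phi_inv_ge0.
by rewrite /= !phi_invK// phi_inv_ge0.
Qed.

Lemma phi_powf (p : R) : 0 < p -> phi_function (@powf R p).
Proof.
move=> p0; apply: phi_of_surj; rewrite /powf.
- by move=> x y x0 xy; apply: gt0_ltr_powR; rewrite ?nnegrE// (le_trans x0)// ltW.
- by rewrite powR0// gt_eqF.
- move=> y y0; exists (y `^ p^-1); first exact: powR_ge0.
  by rewrite -powRrM mulVf ?gt_eqF// powRr1.
Qed.

Lemma phi_inv_powf (p x : R) : 0 < p -> 0 <= x -> phi_inv (@powf R p) x = x `^ p^-1.
Proof.
move=> p0 x0; apply: phi_inv_unique; [exact: phi_powf|exact: powR_ge0|].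
by rewrite /powf -powRrM mulVf ?gt_eqF// powRr1.
Qed.

End PhiFunctions.

(** * Integrals over the half-line *)

Section HalflineIntegrals.
Context {R : realType}.
Local Open Scope ereal_scope.
Local Notation mu := (@lebesgue_measure R).
Implicit Types f g : R -> \bar R.

Lemma halflineE (x : R) : @halfline R x <-> (0 <= x)%R.
Proof. by rewrite /halfline /= in_itv /= andbT. Qed.

Lemma measurable_halfline : measurable (@halfline R).
Proof. exact: measurable_itv. Qed.

(** Superlevel sets within []0, +oo[] are intervals. The point 0 is split off because the convention
    [0^-1 = 0] spoils monotonicity there for the function in condition (J). *)
Lemma nonincreasing_measurable_halfline f :
  (forall x y, (0 < x)%R -> (x <= y)%R -> f y <= f x) ->
  measurable_fun (@halfline R) f.
Proof.
move=> fni.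
have -> : @halfline R = [set 0%R] `|` `]0%R, +oo[%classic.
  apply/seteqP; split => x /=; rewrite /halfline /= !in_itv /= !andbT.
    by rewrite le_eqVlt => /predU1P[->|]; [left|right].
  by case=> [->//|/ltW].
apply/measurable_funU => //; split; first exact: measurable_fun_set1.
move=> mD; apply: (measurability _ (ErealGenCInfty.measurableE R)) => //.
move=> /= _ [_ [r ->] <-]; apply: is_interval_measurable => s t /=.
rewrite !in_itv/= !andbT => -[s0 fs] [t0 ft] u /andP[su ut].
split; first by rewrite in_itv /= andbT (lt_le_trans s0).
by rewrite in_itv /= andbT (le_trans ft)// fni// (lt_le_trans s0).
Qed.

Lemma le_integral_halfline f g :
  measurable_fun (@halfline R) f -> measurable_fun (@halfline R) g ->
  (forall x, (0 < x)%R -> 0 <= f x) -> (forall x, (0 < x)%R -> f x <= g x) ->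
  \int[mu]_(x in @halfline R) f x <= \int[mu]_(x in @halfline R) g x.
Proof.
move=> mf mg f0 fg.
have S : `]0%R, +oo[%classic `<=` @halfline R.
  by move=> x /=; rewrite /halfline /= !in_itv /= !andbT => /ltW.
have mf' := measurable_funS measurable_halfline S mf.
have mg' := measurable_funS measurable_halfline S mg.
rewrite /halfline -!integral_itv_obnd_cbnd//.
apply: ge0_le_integral => //.
- by move=> x /=; rewrite in_itv /= andbT => /f0.
- by move=> x /=; rewrite in_itv /= andbT => /fg.
Qed.

Lemma integral_halfline_indic (v : R) (A : set R) : (0 <= v)%R -> measurable A ->
  A `<=` @halfline R ->
  \int[mu]_(y in @halfline R) (v%:E * (\1_A y)%:E) = v%:E * lebesgue_measure A.
Proof.
move=> v0 mA Ah; rewrite ge0_integralZl; first last.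
- by rewrite lee_fin.
- by move=> y _; rewrite lee_fin.
- by apply/measurable_EFinP; apply: measurable_indic; exact: mA.
- exact: measurable_halfline.
rewrite integral_indic; [|exact: measurable_halfline|exact: mA].
by rewrite (_ : A `&` @halfline R = A)//; exact/setIidPl.
Qed.

(* The half-open intervals ]x/2, x] of points separated by a factor 2 are
   pairwise disjoint. *)
Lemma sum_le_integral_dyadic (I : eqType) (r : seq I) (x v : I -> R) f :
  uniq r -> measurable_fun (@halfline R) f -> (forall y, (0 < y)%R -> 0 <= f y) ->
  (forall i, i \in r -> (0 < x i)%R) -> (forall i, i \in r -> (0 <= v i)%R) ->
  (forall i j, i \in r -> j \in r -> i != j ->
    ((2 * x i <= x j) || (2 * x j <= x i))%R) ->
  (forall i y, i \in r -> (x i / 2 < y)%R -> (y <= x i)%R -> (v i)%:E <= f y) ->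
  (\sum_(i <- r) v i * x i / 2)%:E <= \int[mu]_(y in @halfline R) f y.
Proof.
move=> ur mf f0 x0 v0 sep fv.
pose A i := `](x i / 2)%R, x i]%classic.
pose h i (y : R) := if i \in r then ((v i)%:E * (\1_(A i) y)%:E) else 0.
have mA i : measurable (A i) by exact: measurable_itv.
have mh i : measurable_fun (@halfline R) (h i).
  case ir: (i \in r); rewrite /h ir; last exact: measurable_cst.
  apply: measurable_funeM; apply/measurable_EFinP.
  exact: measurable_indic.
have h0 i y : 0 <= h i y.
  by rewrite /h; case: ifP => // ir; rewrite mule_ge0// lee_fin ?v0// indicE.
have ih i : i \in r -> \int[mu]_(y in @halfline R) h i y = (v i * x i / 2)%:E.
  move=> ir; rewrite /h ir integral_halfline_indic ?v0//; last first.
    move=> y; rewrite /A /= in_itv /= => /andP[h1 _].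
    apply/halflineE; apply: le_trans (ltW h1); rewrite divr_ge0//.
    exact/ltW/x0.
  rewrite /A lebesgue_measure_itv /= lte_fin ifT; last first.
    by have := x0 _ ir; lra.
  by rewrite EFinN -EFinB -EFinM; congr EFin; lra.
apply: (@le_trans _ _ (\int[mu]_(y in @halfline R) (\sum_(i <- r) h i y))); last first.
  apply: le_integral_halfline => //; first exact: emeasurable_sum.
    by move=> y y0; exact: sume_ge0.
  move=> y y0.
  have [/hasP[i ir yi]|/hasPn hn] := boolP (has (fun i => y \in A i) r).
    rewrite (bigD1_seq i)//= big1_seq ?adde0.
      move: (yi); rewrite /h ir inE /A /= in_itv /= => /andP[y1 y2].
      by rewrite indicE yi mule1 fv.
    move=> j /andP[ji jr]; rewrite /h jr indicE.
    rewrite (_ : (y \in A j) = false) ?mule0//.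
    apply/negbTE/negP => yj; move: yi yj; rewrite !inE /A /= !in_itv /=.
    move=> /andP[y1 y2] /andP[y3 y4].
    have ij : i != j by rewrite eq_sym.
    by have /orP[] := sep _ _ ir jr ij => ?; lra.
  rewrite big1_seq ?f0// => i /andP[_ ir].
  by rewrite /h ir indicE (negbTE (hn _ ir)) mule0.
rewrite ge0_integral_sum//; last exact: measurable_halfline.
rewrite -sumEFin [leRHS]big_seq [leLHS]big_seq.
by apply: lee_sum => i ir; rewrite ih.
Qed.

(** A bijective coding of the integers, odd codes for the negative ones; it turns families over the
    integers into series. *)
Definition int_of_code (j : nat) : int :=
  if odd j then Negz j./2 else Posz j./2.

Lemma int_of_code_inj : injective int_of_code.
Proof.
move=> i j; rewrite /int_of_code.
case: ifP => oi; case: ifP => oj // [] h.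
  by rewrite -(odd_double_half i) -(odd_double_half j) oi oj h.
by rewrite -(odd_double_half i) -(odd_double_half j) oi oj h.
Qed.

Lemma int_of_code_surj n : exists j, int_of_code j = n.
Proof.
case: n => n.
  by exists n.*2; rewrite /int_of_code odd_double doubleK.
by exists n.*2.+1; rewrite /int_of_code /= odd_double /= uphalf_double.
Qed.

(** Bounded finite subsums instead of a sum over the integers: no order of summation is chosen, and
    lower bounds of integrals deliver exactly such subsums. *)
Definition int_summable (v : int -> R) (S : R) : Prop :=
  forall l : seq int, uniq l -> (\sum_(n <- l) v n <= S)%R.

(** [W] is the sum of the steps of height [u n] on [[0, x n]]. Its integral is the sum of all
    [u n * x n], and each single step lies below it. *)
Lemma step_majorant (u x : int -> R) (S : R) :
  (forall n, 0 <= u n)%R -> (forall n, 0 < x n)%R ->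
  int_summable (fun n => u n * x n)%R S ->
  exists W : R -> \bar R, [/\ measurable_fun (@halfline R) W,
    forall y, 0 <= W y,
    \int[mu]_(y in @halfline R) W y <= S%:E &
    forall n y, (0 < y)%R -> (y <= x n)%R -> (u n)%:E <= W y].
Proof.
move=> u0 x0 uS.
pose A j := `[0%R, x (int_of_code j)]%classic.
pose h j (y : R) := (u (int_of_code j))%:E * (\1_(A j) y)%:E.
have mh j : measurable_fun (@halfline R) (h j).
  apply: measurable_funeM; apply/measurable_EFinP.
  by apply: measurable_indic; exact: measurable_itv.
have h0 j y : 0 <= h j y by rewrite /h mule_ge0 ?lee_fin.
exists (fun y => \sum_(j <oo) h j y); split.
- by apply: ge0_emeasurable_sum => *; [exact: h0|exact: mh].
- by move=> y; apply: nneseries_ge0 => *; exact: h0.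
- rewrite integral_nneseries//; last exact: measurable_halfline.
  have ih j : \int[mu]_(y in @halfline R) h j y =
      (u (int_of_code j) * x (int_of_code j))%:E.
    rewrite integral_halfline_indic ?u0//; last 2 first.
      exact: measurable_itv.
      by move=> y; rewrite /A /= in_itv /= => /andP[h1 _]; exact/halflineE.
    by rewrite /A lebesgue_measure_itv /= lte_fin x0 oppr0 adde0 -EFinM.
  under eq_eseriesr do rewrite ih.
  apply: lime_le; first by apply: is_cvg_nneseries => *; rewrite lee_fin mulr_ge0// ltW.
  near=> n; rewrite sumEFin lee_fin.
  rewrite -(big_map int_of_code xpredT (fun m => u m * x m)%R).
  by apply: uS; rewrite map_inj_uniq ?iota_uniq//; exact: int_of_code_inj.
- move=> n y y0 yx; have [j jn] := int_of_code_surj n.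
  apply: (@le_trans _ _ (\sum_(0 <= i < j.+1) h i y)); last first.
    by apply: nneseries_lim_ge => *; exact: h0.
  rewrite big_nat_recr//=; apply: (@le_trans _ _ (h j y)); last first.
    by rewrite leeDr// sume_ge0.
  rewrite /h indicE mem_set ?mule1 ?jn// /A /= in_itv /=; rewrite jn yx ltW//.
Unshelve. all: by end_near. Qed.

(** By uniqueness of Lebesgue measure: the pushforward rescaled by [a] has the right value on
    half-open intervals. *)
Lemma lebesgue_measure_affine (a b : R) (A : set R) : (0 < a)%R -> measurable A ->
  mu ((fun y => a * y + b)%R @^-1` A) = (a^-1)%:E * mu A.
Proof.
move=> a0 mA.
have mf : measurable_fun [set: R] (fun y => a * y + b : measurableTypeR R)%R.
  by apply: measurable_funD => //; exact: mulrl_measurable.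
have a0' : (0 <= a)%R by exact: ltW.
pose ann := NngNum a0'.
pose m1 := measure_function_pushforward__canonical__measure_function_Measure mu mf.
pose m2 : {measure set (measurableTypeR R) -> \bar R} := mscale ann m1.
have -> : mu A = m2 A.
  apply: (@lebesgue_measure_unique R m2) => // _ [[c d]] _ <-.
  have -> : m2 `]c, d]%classic = a%:E * mu ((fun y => a * y + b)%R @^-1` `]c, d]%classic) by [].
  rewrite (_ : _ @^-1` _ = `](a^-1 * (c - b))%R, (a^-1 * (d - b))%R]%classic); last first.
    apply/seteqP; split => y /=; rewrite !in_itv /= !ler_pdivlMl ?ltr_pdivrMl// => /andP[h1 h2].
      by apply/andP; split; lra.
    by apply/andP; split; lra.
  rewrite !lebesgue_measure_itv /= !lte_fin ltr_pM2l ?invr_gt0// ltrD2r.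
  case: ifP => _; last by rewrite mule0.
  by rewrite -!EFinB -EFinM; congr EFin; field; rewrite gt_eqF.
by rewrite /m2 /mscale /= /pushforward muleA -EFinM mulVf ?gt_eqF// mul1e.
Qed.

End HalflineIntegrals.

(** * Luxemburg functionals and rearrangements *)

Section LuxemburgFunctional.
Context {R : realType}.
Local Open Scope ereal_scope.
Local Notation mu := (@lebesgue_measure R).
Implicit Types (F G : R -> R) (f : R -> R) (g : R -> \bar R).

Lemma nonincreasing_integral_ge g (x v : R) :
  (forall x y, (0 < x)%R -> (x <= y)%R -> g y <= g x) ->
  (forall x, (0 < x)%R -> 0 <= g x) -> (0 < x)%R -> (0 <= v)%R -> v%:E <= g x ->
  (v * x)%:E <= \int[mu]_(y in @halfline R) g y.
Proof.
move=> gni g0 x0 v0 vg.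
have mA : measurable (`[0%R, x]%classic : set R) by exact: measurable_itv.
have -> : (v * x)%:E = \int[mu]_(y in @halfline R) (v%:E * (\1_(`[0%R, x]%classic : set R) y)%:E).
  rewrite integral_halfline_indic//; last first.
    by move=> y; rewrite /= in_itv /= => /andP[h1 _]; exact/halflineE.
  by rewrite lebesgue_measure_itv /= lte_fin x0 oppr0 adde0 -EFinM.
apply: le_integral_halfline.
- apply: measurable_funeM; apply/measurable_EFinP.
  by apply: measurable_indic; exact: mA.
- exact: nonincreasing_measurable_halfline.
- by move=> y y0; rewrite mule_ge0// lee_fin// indicE.
- move=> y y0; rewrite indicE; case: (boolP (y \in _)) => [|_]; last first.
    by rewrite mule0 g0.
  by rewrite inE /= in_itv /= mule1 => /andP[_ yx]; rewrite (le_trans vg)// gni.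
Qed.

Lemma Gext_le G : phi_function G -> forall e e', 0 <= e -> e <= e' ->
  Gext G e <= Gext G e'.
Proof.
move=> pG [r| |] [r'| |] //=; rewrite ?leey// !lee_fin => r0 rr'.
by rewrite phi_le.
Qed.

Lemma Gext_ge0 G : phi_function G -> forall e, 0 <= e -> 0 <= Gext G e.
Proof. by move=> pG [r| |] //=; rewrite ?lee_fin// => r0; rewrite phi_ge0. Qed.

Lemma luxE_le G g (c : R) : (0 < c)%R ->
  \int[mu]_(x in @halfline R) Gext G (g x * (c^-1)%:E) <= 1 -> luxE G g <= c%:E.
Proof. by move=> c0 h; apply: ereal_inf_lbound; exists c. Qed.

Definition nonincr_pos g := (forall x y, (0 < x)%R -> (x <= y)%R -> g y <= g x) /\
  (forall x, (0 < x)%R -> 0 <= g x).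

Lemma Gext_scaled_measurable G g (c : R) : phi_function G -> nonincr_pos g -> (0 < c)%R ->
  measurable_fun (@halfline R) (fun x => Gext G (g x * (c^-1)%:E)).
Proof.
move=> pG [gni g0] c0; apply: nonincreasing_measurable_halfline => x y x0 xy.
have y0 : (0 < y)%R by exact: lt_le_trans xy.
apply: Gext_le => //; first by rewrite mule_ge0 ?g0// lee_fin invr_ge0 ltW.
by rewrite lee_wpmul2r ?gni// lee_fin invr_ge0 ltW.
Qed.

(** An admissible constant exists below [c], and admissibility passes upwards. The strict inequality
    avoids the question whether the infimum is attained. *)
Lemma luxE_lt G g (c : R) : phi_function G -> nonincr_pos g -> luxE G g < c%:E ->
  (0 < c)%R /\ \int[mu]_(x in @halfline R) Gext G (g x * (c^-1)%:E) <= 1.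
Proof.
move=> pG ng /ereal_inf_lt[_ [d [d0 dle] <-]]; rewrite lte_fin => dc.
have c0 : (0 < c)%R by exact: lt_trans dc.
split => //; apply: le_trans dle.
apply: le_integral_halfline; [exact: Gext_scaled_measurable|exact: Gext_scaled_measurable| |].
  by move=> x x0; apply: Gext_ge0 => //; rewrite mule_ge0 ?ng.2// lee_fin invr_ge0 ltW.
move=> x x0; apply: Gext_le => //; first by rewrite mule_ge0 ?ng.2// lee_fin invr_ge0 ltW.
by rewrite lee_wpmul2l ?ng.2// lee_fin lef_pV2 ?posrE// ltW.
Qed.

Lemma le_luxE G g g' : phi_function G -> nonincr_pos g -> nonincr_pos g' ->
  (forall x, (0 < x)%R -> g x <= g' x) -> luxE G g <= luxE G g'.
Proof.
move=> pG ng ng' gg'; apply: le_ereal_inf => _ [c [c0 cle] <-].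
exists c => //; split => //; apply: le_trans cle.
apply: le_integral_halfline; [exact: Gext_scaled_measurable|exact: Gext_scaled_measurable| |].
  by move=> x x0; apply: Gext_ge0 => //; rewrite mule_ge0 ?ng.2// lee_fin invr_ge0 ltW.
move=> x x0; apply: Gext_le => //; first by rewrite mule_ge0 ?ng.2// lee_fin invr_ge0 ltW.
by rewrite lee_wpmul2r ?gg'// lee_fin invr_ge0 ltW.
Qed.

(** A Chebyshev bound: the integral over [[0, x]] is at least [x] times the integrand at [x]. It
    supplies the restriction [h i <= phi_inv G x^-1] under which quasi-convexity is proved later. *)
Lemma luxE_pointwise G g (c : R) : phi_function G -> nonincr_pos g -> (0 < c)%R ->
  \int[mu]_(x in @halfline R) Gext G (g x * (c^-1)%:E) <= 1 ->
  forall x, (0 < x)%R -> g x <= (c * phi_inv G x^-1)%:E.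
Proof.
move=> pG ng c0 le1 x x0; rewrite leNgt; apply/negP => lt1.
have xV0 : (0 <= x^-1)%R by rewrite invr_ge0 ltW.
have [r r1 r2] : exists2 r : R, (phi_inv G x^-1 < r)%R & r%:E <= g x * (c^-1)%:E.
  move: lt1; case: (g x) => [s| |] //.
    rewrite lte_fin => h; exists (s / c)%R; last by rewrite -EFinM.
    by rewrite ltr_pdivlMr// mulrC.
  move=> _; exists (phi_inv G x^-1 + 1)%R; first by rewrite ltrDl.
  by rewrite gt0_mulye ?leey// lte_fin invr_gt0.
have r0 : (0 <= r)%R by rewrite (le_trans _ (ltW r1))// phi_inv_ge0.
have Gr : (x^-1 < G r)%R.
  by rewrite -[ltLHS](phi_invK pG)//; apply: (phi_lt pG) => //; exact: phi_inv_ge0.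
have [gni g0] := ng.
have : (G r * x)%:E <= 1.
  apply: le_trans le1; apply: nonincreasing_integral_ge => //.
  - move=> y z y0 yz; have z0 : (0 < z)%R by exact: lt_le_trans yz.
    apply: Gext_le => //; first by rewrite mule_ge0 ?g0// lee_fin invr_ge0 ltW.
    by rewrite lee_wpmul2r ?gni// lee_fin invr_ge0 ltW.
  - move=> y y0; apply: Gext_ge0 => //.
    by rewrite mule_ge0 ?g0// lee_fin invr_ge0 ltW.
  - exact: phi_ge0.
  - by apply: (@Gext_le G pG r%:E) => //; rewrite lee_fin.
by rewrite lee_fin leNgt -ltr_pdivrMr// div1r Gr.
Qed.

End LuxemburgFunctional.

Section Rearrangement.
Context {R : realType}.
Local Open Scope ereal_scope.
Local Notation mu := (@lebesgue_measure R).
Implicit Types (F G : R -> R) (f g : R -> R).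

Definition level f (t : R) : set R := [set y | (0 <= y)%R /\ (t <= `|f y|)%R].

Lemma measurable_level f t : measurable_fun (@halfline R) f -> measurable (level f t).
Proof.
move=> mf.
have -> : level f t = @halfline R `&` (fun y => `|f y|%R) @^-1` `[t, +oo[%classic.
  apply/seteqP; split => y; rewrite /level /= in_itv /= andbT => -[h1 h2];
    by split => //; apply/halflineE.
have mn : measurable_fun (@halfline R) (fun y => `|f y|%R) by exact: measurableT_comp.
by apply: mn; [exact: measurable_halfline|exact: measurable_itv].
Qed.

Lemma mu_halfline : mu (@halfline R) = +oo.
Proof. by rewrite /halfline lebesgue_measure_itv /= ltry addye. Qed.

Lemma drearr_ge0 f x : 0 <= drearr f x.
Proof.
apply: ereal_sup_ubound; exists 0%R => //=.
rewrite (_ : [set y | _] = @halfline R); first by rewrite mu_halfline leey.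
apply/seteqP; split => y /=; first by move=> [? _]; exact/halflineE.
by move/halflineE => y0; split.
Qed.

Lemma drearr_nonincr f x y : (x <= y)%R -> drearr f y <= drearr f x.
Proof.
move=> xy; apply: le_ereal_sup => _ [t /= ht <-]; exists t => //=.
by apply: le_trans ht; rewrite lee_fin.
Qed.

(** Thresholds [t <= 0] only contribute values below the lower bound 0. Restricting to [t > 0]
    matters for functions that vanish off their block, whose level sets are controlled only
    there. *)
Lemma le_drearr f g x :
  (forall t, (0 < t)%R -> mu (level f t) <= mu (level g t)) ->
  drearr f x <= drearr g x.
Proof.
move=> fg; apply: ge_ereal_sup => _ [t /= ht <-].
have [t0|t0] := ltP 0%R t; last first.
  by apply: le_trans (drearr_ge0 g x); rewrite lee_fin.
by apply: ereal_sup_ubound; exists t => //=; apply: le_trans ht (fg _ t0).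
Qed.

Lemma mu_level_dil f (a t : R) : measurable_fun (@halfline R) f -> (0 < a)%R ->
  mu (level (dil a f) t) = (a^-1)%:E * mu (level f t).
Proof.
move=> mf a0; rewrite -(@lebesgue_measure_affine R a 0%R)//; last exact: measurable_level.
congr (mu _); apply/seteqP; split => y; rewrite /level /dil /= addr0.
  by move=> [y0 h]; split => //; rewrite mulr_ge0// ltW.
by rewrite pmulr_rge0.
Qed.

Lemma drearr_dil f (a x : R) : measurable_fun (@halfline R) f -> (0 < a)%R ->
  drearr f (a * x) <= drearr (dil a f) x.
Proof.
move=> mf a0; apply: ge_ereal_sup => _ [t /= ht <-].
apply: ereal_sup_ubound; exists t => //=.
rewrite -[X in _ <= mu X]/(level (dil a f) t) mu_level_dil//.
by rewrite -(@lee_pmul2l _ a%:E)// muleA -!EFinM mulfV ?gt_eqF// mul1e.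
Qed.

(** The strict superlevel set is the increasing union of the levels at [r + 1/(n+1)]; none of these
    has measure above [x], by definition of the supremum in [drearr]. *)
Lemma mu_superlevel f (x r : R) : measurable_fun (@halfline R) f ->
  drearr f x <= r%:E -> mu [set y | (0 <= y)%R /\ (r < `|f y|)%R] <= x%:E.
Proof.
move=> mf hr.
pose A n := level f (r + n.+1%:R^-1).
have mA n : measurable (A n) by exact: measurable_level.
have -> : [set y | (0 <= y)%R /\ (r < `|f y|)%R] = \bigcup_n A n.
  apply/seteqP; split => y /=.
    move=> [y0 ry]; have e0 : (0 < `|f y| - r)%R by rewrite subr_gt0.
    have [n hn] := ltr_add_invr ry.
    by exists n => //; split => //; exact: ltW.
  move=> [n _ [y0 h]]; split => //; apply: lt_le_trans h.
  by rewrite ltrDl invr_gt0 ltr0n.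
have cA : mu (A n) @[n --> \oo] --> mu (\bigcup_n A n).
  apply: nondecreasing_cvg_mu => //; first exact: bigcupT_measurable.
  move=> n m nm; apply/subsetPset => y [y0 h]; split => //; apply: le_trans h.
  by rewrite lerD2l lef_pV2 ?posrE ?ltr0n// ler_nat ltnS.
rewrite -(cvg_lim _ cA)//; apply: lime_le; first by apply/cvg_ex; exists (mu (\bigcup_n A n)).
near=> n; rewrite leNgt; apply/negP => xA.
have : (r + n.+1%:R^-1)%:E <= drearr f x.
  by apply: ereal_sup_ubound; exists (r + n.+1%:R^-1)%R => //=; exact: ltW.
move/le_trans => /(_ _ hr); rewrite lee_fin leNgt => /negP; apply.
by rewrite ltrDl invr_gt0 ltr0n.
Unshelve. all: by end_near. Qed.

Definition timechange F G (x : R) : R := tilde F (phi_inv (tilde G) x).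

Lemma timechange_lt F G x y : phi_function F -> phi_function G ->
  (0 <= x)%R -> (x < y)%R -> (timechange F G x < timechange F G y)%R.
Proof.
move=> pF pG x0 xy; apply: (phi_lt (phi_tilde pF)).
  by apply: phi_inv_ge0 => //; exact: phi_tilde.
by apply: (phi_lt (phi_phi_inv (phi_tilde pG))).
Qed.

Lemma timechange_le F G x y : phi_function F -> phi_function G ->
  (0 <= x)%R -> (x <= y)%R -> (timechange F G x <= timechange F G y)%R.
Proof.
move=> pF pG x0; rewrite le_eqVlt => /predU1P[->//|xy].
exact/ltW/timechange_lt.
Qed.

Lemma timechange_gt0 F G x : phi_function F -> phi_function G ->
  (0 < x)%R -> (0 < timechange F G x)%R.
Proof.
move=> pF pG x0; apply: (phi_gt0 (phi_tilde pF)).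
exact: (phi_gt0 (phi_phi_inv (phi_tilde pG))).
Qed.

Lemma nonincr_pos_drearr F G f : phi_function F -> phi_function G ->
  nonincr_pos (drearr f \o timechange F G).
Proof.
move=> pF pG; split => [x y x0 xy|x x0]; last exact: drearr_ge0.
by apply: drearr_nonincr; apply: timechange_le => //; exact: ltW.
Qed.

Lemma OLnorm_ge0 F G f : 0 <= OLnorm F G f.
Proof.
by apply: le_ereal_inf_tmp => _ [c [c0 _] <-]; rewrite lee_fin ltW.
Qed.

Lemma le_OLnorm F G f g : phi_function F -> phi_function G ->
  (forall t, (0 < t)%R -> mu (level f t) <= mu (level g t)) ->
  OLnorm F G f <= OLnorm F G g.
Proof.
move=> pF pG fg; apply: le_luxE => //; try exact: nonincr_pos_drearr.
by move=> x x0; exact: le_drearr.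
Qed.

Lemma OLnorm_lt F G f (c : R) : phi_function F -> phi_function G ->
  OLnorm F G f < c%:E -> (0 < c)%R /\
  \int[mu]_(x in @halfline R) Gext G (drearr f (timechange F G x) * (c^-1)%:E) <= 1.
Proof.
by move=> pF pG; apply: luxE_lt => //; exact: nonincr_pos_drearr.
Qed.

Lemma OLnorm_pointwise F G f (c : R) : phi_function F -> phi_function G ->
  OLnorm F G f < c%:E -> forall x, (0 < x)%R ->
  drearr f (timechange F G x) <= (c * phi_inv G x^-1)%:E.
Proof.
move=> pF pG /OLnorm_lt-/(_ pF pG)[c0 h]; apply: luxE_pointwise => //.
exact: nonincr_pos_drearr.
Qed.

End Rearrangement.

(** * Condition (J) and quasi-convexity on decreasing functions *)

Section Convexity.
Context {R : realType}.
Implicit Types K : R -> R.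

Lemma convex_scale K (l u : R) : phi_function K -> convex_on_halfline K ->
  0 <= u -> 0 <= l <= 1 -> K (l * u) <= l * K u.
Proof.
move=> pK cK u0 l01; have := cK u 0 l u0 (lexx _) l01.
by rewrite (phi0 pK) !mulr0 !addr0.
Qed.

(** Jensen's inequality with total weight below [S]; the missing weight sits at 0, where [K]
    vanishes. [S] varies in the induction because the tail is normalised by [S - c a], and
    strictness keeps this positive. *)
Lemma convex_jensen K (I : eqType) (r : seq I) (c u : I -> R) (S : R) :
  phi_function K -> convex_on_halfline K ->
  (forall i, 0 <= c i) -> (forall i, 0 <= u i) -> \sum_(i <- r) c i < S ->
  K ((\sum_(i <- r) c i * u i) / S) <= (\sum_(i <- r) c i * K (u i)) / S.
Proof.
move=> pK cK c0 u0; elim: r S => [|a r IH] S.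
  by rewrite !big_nil !mul0r (phi0 pK).
rewrite !big_cons => hS.
have s0 : 0 <= \sum_(i <- r) c i by apply: sumr_ge0.
have ca := c0 a.
have S0 : 0 < S by lra.
have S'0 : 0 < S - c a by lra.
have {IH} := IH (S - c a) _; rewrite ltrBrDl => /(_ hS) IH.
set X := \sum_(i <- r) c i * u i in IH *; set Y := \sum_(i <- r) c i * K (u i) in IH *.
have -> : (c a * u a + X) / S = (c a / S) * u a + (1 - c a / S) * (X / (S - c a)).
  by field; rewrite !gt_eqF.
apply: le_trans (cK _ _ _ _ _ _) _ => //.
- by rewrite divr_ge0 ?(ltW S'0)// /X sumr_ge0// => i _; rewrite mulr_ge0.
- by rewrite divr_ge0 ?(ltW S0)//= ler_pdivrMr// mul1r; lra.
have h : 0 <= 1 - c a / S by rewrite subr_ge0 ler_pdivrMr// mul1r; lra.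
apply: le_trans (lerD (lexx _) (ler_wpM2l h IH)) _.
by rewrite le_eqVlt; apply/orP; left; apply/eqP; field; rewrite !gt_eqF.
Qed.

End Convexity.

(** * Scales indexed by the integers and the zones between them *)

Section Zones.
Context {R : realType}.
Variable s : int -> R.
Hypothesis s0 : forall n, 0 < s n.
Hypothesis s2 : forall n, 2 * s n <= s (n + 1).

Lemma zone_pow (n : int) (j : nat) : 2 ^+ j * s n <= s (n + j%:Z).
Proof.
elim: j => [|j IH]; first by rewrite expr0 mul1r addr0.
rewrite exprS -mulrA (le_trans (ler_wpM2l _ IH))//.
by rewrite (le_trans (s2 _))// -addrA intS (addrC 1).
Qed.

Lemma zone_sep (n m : int) : n < m -> 2 * s n <= s m.
Proof.
move=> nm; have [j ->] : exists j : nat, m = n + j.+1%:Z.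
  by exists (absz (m - n - 1)%R); lia.
apply: le_trans (zone_pow n j.+1); rewrite ler_pM2r//.
by rewrite exprS ler_peMr// exprn_ege1// ler1n.
Qed.

Lemma zone_le (n m : int) : n <= m -> s n <= s m.
Proof.
rewrite le_eqVlt => /predU1P[->//|/zone_sep]; apply: le_trans.
by rewrite ler_peMl ?ler1n// ltW.
Qed.

Lemma zone_exists (t : R) : 0 < t -> exists n : int, s n <= t < s (n + 1).
Proof.
move=> t0.
have [i hi] : exists i : nat, s (- i%:Z) <= t.
  pose i := Num.bound (s 0 / t); exists i.
  have := zone_pow (- i%:Z) i; rewrite addNr -ler_pdivlMl ?exprn_gt0// => h.
  have hb : s 0 / t < 2 ^+ i by exact: upper_nthrootP.
  apply: le_trans h _; rewrite ler_pdivrMl ?exprn_gt0//.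
  by move: hb; rewrite ltr_pdivrMr// => /ltW.
have ex : exists j : nat, t < s (j%:Z - i%:Z).
  exists (i + Num.bound (t / s 0))%N.
  rewrite PoszD addrAC subrr add0r.
  apply: lt_le_trans (zone_pow 0 _); rewrite -ltr_pdivrMr//.
  exact: upper_nthrootP.
have [[|j] hj min] := ex_minnP ex; first by move: hj; rewrite add0r ltNge hi.
exists (j%:Z - i%:Z); apply/andP; split.
  by rewrite leNgt; apply/negP => /min; rewrite ltnn.
by move: hj; rewrite intS; congr (_ < s _); lia.
Qed.

End Zones.

Section GeometricPowers.
Context {R : realType}.

Lemma zone_expz (c t : R) : 2 <= c -> 0 < t -> exists n : int, c ^ n <= t < c ^ (n + 1).
Proof.
move=> c2 t0; have c0 : 0 < c by lra.
apply: zone_exists => // n; first exact: exprz_gt0.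
by rewrite expfzDr ?gt_eqF// expr1z mulrC ler_pM2l// exprz_gt0.
Qed.

Lemma exprzSr (c : R) (n : int) : 0 < c -> c ^ (n + 1) = c * c ^ n.
Proof. by move=> c0; rewrite expfzDr ?gt_eqF// expr1z mulrC. Qed.

Lemma exprzBn (c : R) (n : int) (k : nat) : 0 < c -> c ^ (n - k%:Z) = c ^ n / c ^+ k.
Proof. by move=> c0; rewrite expfzDr ?gt_eqF// -exprnN. Qed.

End GeometricPowers.

Section ConditionJ.
Context {R : realType}.
Local Notation mu := (@lebesgue_measure R).
Variables (Hs : R -> R).
Hypothesis pHs : phi_function Hs.
Let L := phi_inv Hs.
Let pL : phi_function L := phi_phi_inv pHs.

Lemma condJ_nonincr_pos :
  nonincr_pos (fun x => (`|(phi_inv (tilde Hs) x)^-1|)%:E).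
Proof.
have p0 x : 0 < x -> 0 < phi_inv (tilde Hs) x.
  exact: (phi_gt0 (phi_phi_inv (phi_tilde pHs))).
split => [x y x0 xy|x x0]; last by rewrite lee_fin.
have y0 : 0 < y by exact: lt_le_trans xy.
rewrite lee_fin !gtr0_norm ?invr_gt0 ?p0// lef_pV2 ?posrE ?p0//.
by apply: (phi_le (phi_phi_inv (phi_tilde pHs))) => //; exact: ltW.
Qed.

(** The function in (J) is [L (1/x)]. For [x] in []1/(2 s_n), 1/s_n]] it is at least [c^n], so the
    integrand is at least [Hs (c^(n-1))] on a set of length [1/(2 s_n)]; these sets are disjoint
    once the scales double. *)
Lemma condJ_summable (c1 : R) :
  (lux Hs (fun x => ((phi_inv (tilde Hs) x)^-1)%R) < +oo)%E ->
  (forall t, 0 < t -> L (2 * t) <= c1 * L t) ->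
  exists2 c, 2 <= c & (forall n, 2 * Hs (c ^ n) <= Hs (c ^ (n + 1))) /\
    int_summable (fun n => Hs (c ^ (n - 1)) / Hs (c ^ n)) 2.
Proof.
move=> Jfin L2.
have [c' Jc'] : exists c' : R, (lux Hs (fun x => ((phi_inv (tilde Hs) x)^-1)%R) < c'%:E)%E.
  move: Jfin; case: (lux _ _) => [r| |] // _.
    by exists (r + 1); rewrite lte_fin ltrDl.
  by exists 0; rewrite ltNyr.
(* The doubling constant [c1] of [L] separates the scales by a factor 2, and [c'] makes [c]
   admissible in the Luxemburg functional of (J). *)
pose c : R := Num.max 2 (Num.max c1 c').
have c2 : 2 <= c by rewrite le_max lexx.
have cc1 : c1 <= c by rewrite /c !le_max lexx !orbT.
have cc' : c' <= c by rewrite /c !le_max lexx !orbT.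
have c0 : 0 < c by lra.
have e0 n : 0 < c ^ n by exact: exprz_gt0.
have Le n : L (Hs (c ^ n)) = c ^ n by rewrite /L phi_inv_mem// ltW.
have s0 n : 0 < Hs (c ^ n) by exact: phi_gt0.
have s2 n : 2 * Hs (c ^ n) <= Hs (c ^ (n + 1)).
  apply: (phi_leW pL); first exact: ltW.
  rewrite Le exprzSr//; apply: le_trans (L2 _ _) _ => //.
  by rewrite Le ler_wpM2r// ltW.
exists c => //; split => // l ul.
have [_ Jc] : 0 < c /\ (\int[mu]_(x in @halfline R)
   Gext Hs ((`|(phi_inv (tilde Hs) x)^-1|)%:E * (c^-1)%:E) <= 1)%E.
  apply: luxE_lt => //; first exact: condJ_nonincr_pos.
  by apply: lt_le_trans Jc' _; rewrite lee_fin.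
have : ((\sum_(n <- l) Hs (c ^ (n - 1)) * (Hs (c ^ n))^-1 / 2)%:E <= 1)%E.
  apply: le_trans Jc.
  apply: sum_le_integral_dyadic => //.
  - exact: (Gext_scaled_measurable pHs condJ_nonincr_pos).
  - by move=> y y0; apply: Gext_ge0 => //; rewrite mule_ge0 ?lee_fin// invr_ge0 ltW.
  - by move=> n _; rewrite invr_gt0.
  - by move=> n _; exact: ltW.
  - move=> n m _ _; rewrite neq_lt => /orP[] /(zone_sep s0 s2) h; apply/orP; [right|left];
      by rewrite -[leRHS]mul1r ler_pdivlMr// mulrAC ler_pdivrMr// mul1r.
  - move=> n y _ y1 y2.
    have y0 : 0 < y by apply: le_lt_trans y1; rewrite divr_ge0// invr_ge0 ltW.
    rewrite phi_inv_tilde// invrK.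
    have Ly : 0 <= phi_inv Hs y^-1 by rewrite phi_inv_ge0// invr_ge0 ltW.
    rewrite ger0_norm//= lee_fin.
    apply: phi_le => //; first exact: ltW.
    rewrite -(mulfK (lt0r_neq0 c0) (c ^ (n - 1))).
    rewrite ler_wpM2r ?invr_ge0 ?(ltW c0)//.
    rewrite mulrC -exprzSr// subrK -[leLHS]Le.
    apply: (phi_le pL); first exact: ltW.
    by rewrite -[leLHS]invrK lef_pV2 ?posrE ?invr_gt0.
rewrite lee_fin -mulr_suml ler_pdivrMr// mul1r.
by [].
Qed.

End ConditionJ.

Section ProductBound.
Context {R : realType}.
Variables (s : int -> R).
Hypothesis s0 : forall n, 0 < s n.
Hypothesis sS : int_summable (fun n => s (n - 1) / s n) 2.

Lemma ratio_prod (n : int) (m : nat) :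
  s (n - m%:Z) / s n = \prod_(i < m) (s (n - i%:Z - 1) / s (n - i%:Z)).
Proof.
elim: m => [|m IH]; first by rewrite big_ord0 subr0 mulfV// gt_eqF.
rewrite big_ord_recr /= -IH.
have -> : n - m.+1%:Z = n - m%:Z - 1 by lia.
by field; rewrite !gt_eqF.
Qed.

(* Arithmetic-geometric mean for the [m] consecutive ratios. *)
Lemma ratio_superexp (n : int) (m : nat) : (0 < m)%N ->
  s (n - m%:Z) / s n <= (2 / m%:R) ^+ m.
Proof.
move=> m0; rewrite ratio_prod.
pose E (i : 'I_m) := s (n - i%:Z - 1) / s (n - i%:Z).
have E0 i : 0 <= E i by rewrite divr_ge0 ?ltW.
have [h _] := @leif_AGM R 'I_m (mem 'I_m) E (fun i _ => E0 i).
have {h} : \prod_(i < m) E i <= ((\sum_(i < m) E i) / m%:R) ^+ m.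
  by move: h; rewrite card_ord.
move/le_trans; apply.
rewrite lerXn2r ?nnegrE ?divr_ge0 ?sumr_ge0//.
rewrite ler_pM2r ?invr_gt0 ?ltr0n//.
have := sS (l := [seq n - i%:Z | i <- iota 0 m]).
rewrite map_inj_uniq ?iota_uniq; last by move=> i j; lia.
move/(_ isT); rewrite big_map -[X in iota 0 X]subn0 -/(index_iota 0 m) big_mkord.
exact.
Qed.

End ProductBound.

Section QuasiConvexityOnDecreasing.
Context {R : realType}.
Local Notation mu := (@lebesgue_measure R).
Variables (G K Hs : R -> R) (B : R).
Hypotheses (pG : phi_function G) (pK : phi_function K) (pHs : phi_function Hs).
Hypothesis cK : convex_on_halfline K.
Hypothesis B1 : 1 <= B.
Let L := phi_inv Hs.
Let pL : phi_function L := phi_phi_inv pHs.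
Hypothesis KG : forall t, 0 <= t -> K (t / L t / B) <= G t <= K (B * (t / L t)).
Variable c : R.
Hypothesis c2 : 2 <= c.
Hypothesis s2 : forall n, 2 * Hs (c ^ n) <= Hs (c ^ (n + 1)).
Hypothesis sS : int_summable (fun n => Hs (c ^ (n - 1)) / Hs (c ^ n)) 2.

(** The left side equals [2 B^2 c (2c/m)^m]. For [m >= 4c] the power is at most [2^(-m)], and
    [2^m >= 4 B^2 c] absorbs the rest. *)
Lemma superexp_choice : exists2 m : nat, (0 < m)%N &
  2 * (B ^+ 2 * c ^+ m.+1 * (2 / m%:R) ^+ m) <= 2^-1.
Proof.
have c0 : 0 < c by move: c2; lra.
pose m := (Num.bound (4 * c) + Num.bound (4 * B ^+ 2 * c) + 1)%N.
have m0 : (0 < m)%N by rewrite /m addn1.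
exists m => //.
have mR : 0 < m%:R :> R by rewrite ltr0n.
have h1 : 4 * c <= m%:R.
  apply: le_trans (ltW (archi_boundP _)) _; first by rewrite mulr_ge0// ltW.
  by rewrite ler_nat /m; lia.
have h2 : 4 * B ^+ 2 * c <= 2 ^+ m.
  by apply/ltW/upper_nthrootP; rewrite /m addn1 leqW// leq_addl.
have h3 : (2 * c / m%:R) ^+ m <= (2^-1) ^+ m.
  rewrite lerXn2r ?nnegrE ?divr_ge0 ?mulr_ge0 ?(ltW c0) ?(ltW mR)//.
  by rewrite ler_pdivrMr//; lra.
have -> : 2 * (B ^+ 2 * c ^+ m.+1 * (2 / m%:R) ^+ m) =
    2 * B ^+ 2 * c * (2 * c / m%:R) ^+ m.
  rewrite (exprS c) -!mulrA; congr (2 * (_ * (_ * _))).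
  by rewrite -exprMn mulrCA.
have h4 : 0 <= 2 * B ^+ 2 * c by rewrite !mulr_ge0 ?exprn_ge0 ?(ltW c0)//; move: B1; lra.
apply: le_trans (ler_wpM2l h4 h3) _.
rewrite exprVn ler_pdivrMr ?exprn_gt0//.
by move: h2; set b2 := B ^+ 2; set q := 2 ^+ m; lra.
Qed.

(* [L u] is compared with [L t], where [G t = x^-1]: if they are comparable then
   [G u] is convexified by [K (_ / L t)], which acts linearly on the family;
   otherwise [u] lies at least [m.+1] scales below [t] and [G u] is absorbed by
   the summable majorant [W]. *)
Lemma quasi_convex_majorant : exists C W, [/\ 0 < C,
   measurable_fun (@halfline R) W, forall y, (0 <= W y)%E,
   (\int[mu]_(y in @halfline R) W y <= (2^-1)%:E)%E &
   forall (I : eqType) (r : seq I) (a h : I -> R) x, 0 < x ->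
     (forall i, 0 <= a i) -> (forall i, 0 <= h i <= phi_inv G x^-1) ->
     \sum_(i <- r) a i <= 1 ->
     ((G ((\sum_(i <- r) a i * h i) / C))%:E <=
       W x + (2^-1 * \sum_(i <- r) a i * G (h i))%:E)%E].
Proof.
have c0 : 0 < c by move: c2; lra.
have B0 : 0 < B by move: B1; lra.
have [m m0 hm] := superexp_choice.
pose s n := Hs (c ^ n).
have e0 n : 0 < c ^ n by exact: exprz_gt0.
have s0 n : 0 < s n by exact: phi_gt0.
have Ls n : L (s n) = c ^ n by rewrite /L phi_inv_mem// ltW.
(* Of the [k] consecutive ratios between [s (n - k)] and [s n], [m] give the superexponential factor
   and the last one, [s (n - 1) / s n], is kept for summability. Below, [K (y n)] is the lower bound
   for [G (s n)] and [u n] the upper bound for [G (s (n - k))] given by [KG]. *)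
pose k := m.+1.
pose y n := s n / c ^ n / B.
have y0 n : 0 < y n by rewrite !divr_gt0.
pose u n := K (B * (s (n - k%:Z) / c ^ (n - k%:Z))).
have u0 n : 0 <= u n by rewrite phi_ge0// mulr_ge0 ?divr_ge0 ?ltW.
pose X n := (K (y n))^-1.
have X0 n : 0 < X n by rewrite invr_gt0 (phi_gt0 pK).
(* The argument of [K] in [u n] is [l * y n] with [l <= 1], so convexity bounds the quotient of the
   two values of [K] by [l]. *)
have rat n : u n * X n <= B ^+ 2 * c ^+ k * (2 / m%:R) ^+ m * (s (n - 1) / s n).
  pose l := B ^+ 2 * c ^+ k * (s (n - k%:Z) / s n).
  have l0 : 0 <= l by rewrite !mulr_ge0 ?exprn_ge0 ?invr_ge0 ?(ltW c0) ?(ltW B0)// ltW.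
  have e : B * (s (n - k%:Z) / c ^ (n - k%:Z)) = l * y n.
    by rewrite /l /y exprzBn//; field; rewrite !gt_eqF// exprn_gt0.
  have ll : l <= B ^+ 2 * c ^+ k * (2 / m%:R) ^+ m * (s (n - 1) / s n).
    rewrite /l -[leRHS]mulrA ler_wpM2l ?mulr_ge0 ?exprn_ge0 ?(ltW c0) ?(ltW B0)//.
    have -> : s (n - k%:Z) / s n = s (n - 1 - m%:Z) / s (n - 1) * (s (n - 1) / s n).
      have -> : n - 1 - m%:Z = n - k%:Z by rewrite /k; lia.
      by field; rewrite !gt_eqF.
    by rewrite ler_wpM2r ?divr_ge0 ?(ltW (s0 _))//; exact: ratio_superexp.
  have l1 : l <= 1.
    have s1 : s (n - 1) / s n <= 1.
      by rewrite ler_pdivrMr// mul1r; have := s2 (n - 1); rewrite subrK -/(s _) -/(s n); have := s0 (n - 1); lra.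
    apply: le_trans ll _.
    have := ler_wpM2l _ s1 => /(_ (B ^+ 2 * c ^+ k * (2 / m%:R) ^+ m)).
    have h0 : 0 <= B ^+ 2 * c ^+ k * (2 / m%:R) ^+ m.
      by rewrite !mulr_ge0 ?exprn_ge0 ?divr_ge0 ?(ltW c0) ?(ltW B0).
    by move=> /(_ h0); move: hm; rewrite -/k; set q := _ * (_ / _) ^+ m; lra.
  apply: le_trans ll; rewrite /X ler_pdivrMr ?(phi_gt0 pK)// /u e.
  by apply: convex_scale => //; [exact: ltW|rewrite l0 l1].
have uX : int_summable (fun n => u n * X n) 2^-1.
  move=> l ul; apply: le_trans (ler_sum _ (fun n _ => rat n)) _.
  rewrite -mulr_sumr.
  have h0 : 0 <= B ^+ 2 * c ^+ k * (2 / m%:R) ^+ m.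
    by rewrite !mulr_ge0 ?exprn_ge0 ?divr_ge0 ?(ltW c0) ?(ltW B0).
  by apply: le_trans (ler_wpM2l h0 (sS ul)) _; rewrite mulrC.
have [W [mW W0 iW WX]] := step_majorant u0 X0 uX.
(* One [B] for each side of the sandwich [KG], the 2 for the total weight in Jensen's inequality,
   and [c^(k+1)] for replacing [L v] by [L t]. As [C >= 1], also [v <= t]. *)
pose C := 2 * B ^+ 2 * c ^+ k.+1.
have C1 : 1 <= C.
  have h1 : 1 <= B ^+ 2 by rewrite exprn_ege1.
  have h2 : 1 <= c ^+ k.+1 by rewrite exprn_ege1//; move: c2; lra.
  by have : 1 <= B ^+ 2 * c ^+ k.+1; [rewrite -[leLHS]mul1r ler_pM|rewrite /C -mulrA; lra].
have C0 : 0 < C by lra.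
exists C, W; split => // I r a h x x0 a0 hh ra.
have xV : 0 < x^-1 by rewrite invr_gt0.
pose t := phi_inv G x^-1.
have t0 : 0 < t by exact: (phi_gt0 (phi_phi_inv pG)).
have Gt : G t = x^-1 by rewrite /t phi_invK// ltW.
pose v := (\sum_(i <- r) a i * h i) / C.
have v0 : 0 <= v.
  rewrite divr_ge0 ?(ltW C0)// sumr_ge0// => i _; rewrite mulr_ge0//.
  by case/andP: (hh i).
have Gh0 i : 0 <= a i * G (h i) by rewrite mulr_ge0// phi_ge0//; case/andP: (hh i).
have S0 : (0 <= (2^-1 * \sum_(i <- r) a i * G (h i))%:E)%E.
  by rewrite lee_fin mulr_ge0// sumr_ge0.
rewrite -/v; move: (v0); rewrite le_eqVlt => /predU1P[<-|vp].
  by rewrite phi0// adde_ge0.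
have vt : v <= t.
  rewrite ler_pdivrMr//; apply: (@le_trans _ _ (\sum_(i <- r) a i * t)).
    by apply: ler_sum => i _; rewrite ler_wpM2l//; case/andP: (hh i).
  by rewrite -mulr_suml mulrC ler_wpM2l ?(ltW t0)// (le_trans ra).
have Lv0 : 0 < L v by exact: phi_gt0.
have Lt0 : 0 < L t by exact: phi_gt0.
have [good|bad] := leP (L t) (c ^+ k.+1 * L v).
  apply: (@le_trans _ _ (2^-1 * \sum_(i <- r) a i * G (h i))%:E); last by rewrite leeDr.
  rewrite lee_fin.
  have /andP[_ h2] := KG v0; apply: le_trans h2 _.
  pose w i := h i / L t / B.
  have w0 i : 0 <= w i by rewrite !divr_ge0 ?(ltW B0) ?(ltW Lt0)//; case/andP: (hh i).
  apply: (@le_trans _ _ (K ((\sum_(i <- r) a i * w i) / 2))).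
    apply: phi_le => //; first by rewrite mulr_ge0 ?(ltW B0)// divr_ge0// ltW.
    have -> : \sum_(i <- r) a i * w i = (\sum_(i <- r) a i * h i) / L t / B.
      by rewrite !mulr_suml; apply: eq_bigr => i _; rewrite /w !mulrA.
    have -> : (\sum_(i <- r) a i * h i) = v * C by rewrite /v divfK// gt_eqF.
    have -> : v * C / L t / B / 2 = B * (v * (c ^+ k.+1 / L t)).
      by rewrite /C; field; rewrite !gt_eqF.
    rewrite ler_pM2l// ler_pM2l// ler_pdivlMr// mulrC ler_pdivrMr//.
  apply: le_trans (convex_jensen pK cK a0 w0 _) _; first by lra.
  rewrite mulrC ler_pM2l//; apply: ler_sum => i _; rewrite ler_wpM2l//.
  have /andP[hi0 hit] := hh i.
  have /andP[h1 _] := KG hi0; apply: le_trans h1.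
  apply: phi_le => //; rewrite /w ler_pM2r ?invr_gt0//.
  move: hi0; rewrite le_eqVlt => /predU1P[<-|hi0]; first by rewrite !mul0r.
  rewrite ler_pM2l// lef_pV2 ?posrE//; last exact: phi_gt0.
  by apply: (phi_le pL) => //; exact: ltW.
apply: (@le_trans _ _ (W x)); last by rewrite leeDl.
(* From [c^(k+1) * L v < L t < c^(n+1)] follows [L v < c^(n-k)], that is [v <= s (n - k)]; the extra
   power in [k.+1] pays for the upper end of the zone. *)
have [n /andP[n1 n2]] := zone_expz c2 Lt0.
apply: (@le_trans _ _ (u n)%:E).
  rewrite lee_fin.
  have vs : v <= s (n - k%:Z).
    apply: (phi_leW pL); first exact: ltW.
    rewrite Ls exprzBn// ler_pdivlMr ?exprn_gt0// mulrC.
    rewrite -(ler_pM2l c0) mulrA -exprS -exprzSr//.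
    exact/ltW/(lt_trans bad).
  apply: le_trans (phi_le pG v0 vs) _.
  by have /andP[_] := KG (ltW (s0 (n - k%:Z))); rewrite Ls.
apply: WX => //.
rewrite /X -[leLHS]invrK lef_pV2 ?posrE ?(phi_gt0 pK)//.
rewrite -Gt; apply: (@le_trans _ _ (G (s n))).
  by have /andP[h1 _] := KG (ltW (s0 n)); move: h1; rewrite Ls.
apply: phi_le => //; first exact: ltW.
by apply: (phi_leW pL); [exact: ltW|rewrite Ls].
Qed.

End QuasiConvexityOnDecreasing.

(** * A Hardy type inequality and the sufficient condition *)

Section LayerBound.
Context {R : realType}.
Local Open Scope ereal_scope.
Local Notation mu := (@lebesgue_measure R).

Lemma measurable_superlevel (f : R -> R) (r : R) : measurable_fun (@halfline R) f ->
  measurable [set y | (0 <= y)%R /\ (r < `|f y|)%R].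
Proof.
move=> mf.
have -> : [set y | (0 <= y)%R /\ (r < `|f y|)%R] =
    @halfline R `&` (fun y => `|f y|%R) @^-1` `]r, +oo[%classic.
  apply/seteqP; split => y; rewrite /= in_itv /= andbT => -[h1 h2];
    by split => //; apply/halflineE.
have mn : measurable_fun (@halfline R) (fun y => `|f y|%R) by exact: measurableT_comp.
by apply: mn; [exact: measurable_halfline|exact: measurable_itv].
Qed.

Lemma integral_indicZ (D A : set R) (v : \bar R) : measurable D -> measurable A -> 0 <= v ->
  \int[mu]_(y in D) (v * (\1_A y)%:E) = v * lebesgue_measure (A `&` D).
Proof.
move=> mD mA v0; rewrite ge0_integralZl; first last.
- exact: v0.
- by move=> y _; rewrite lee_fin.
- by apply/measurable_EFinP; apply: measurable_indic; exact: mA.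
- exact: mD.
by rewrite integral_indic; [|exact: mD|exact: mA].
Qed.

(** Points with [|f| <= b 0] give the first term; a point whose first bound is [b k.+1] lies in the
    superlevel set of [b k], of measure at most [2^(-k) x]. *)
Lemma integral_powR_layers (f : R -> R) (b : nat -> R) (D : set R) (p x : R) :
  measurable_fun (@halfline R) f -> measurable D -> D `<=` @halfline R -> (0 < p)%R ->
  (forall k, 0 <= b k)%R ->
  (forall k, mu [set y | (0 <= y)%R /\ (b k < `|f y|)%R] <= (2^-1 ^+ k * x)%:E) ->
  \int[mu]_(y in D) (`|f y| `^ p)%:E <=
    (b 0%N `^ p)%:E * mu D + \sum_(k <oo) (b k.+1 `^ p * (2^-1 ^+ k * x))%:E.
Proof.
move=> mf mD Dh p0 b0 hS.
pose S k := [set y | (0 <= y)%R /\ (b k < `|f y|)%R].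
have mS k : measurable (S k) by exact: measurable_superlevel.
pose N := \bigcap_k S k.
have mN : measurable N by exact: bigcapT_measurable.
have muN : mu N = 0.
  apply/eqP; rewrite eq_le measure_ge0 andbT.
  have h k : mu N <= (2^-1 ^+ k * x)%:E.
    apply: le_trans (hS k); apply: (@le_measure _ _ _ mu N (S k)).
    - by rewrite inE.
    - by rewrite inE; exact: mS.
    - by move=> y /(_ k I).
  have cv : (2^-1 ^+ k * x)%:E @[k --> \oo] --> 0.
    apply: cvg_EFin; first by near=> k.
    rewrite [X in _ --> X](_ : 0 = 0 * x)%R; last by rewrite mul0r.
    apply: cvgMl; apply: cvg_expr; rewrite ger0_norm//.
    by rewrite invf_lt1// ltr1n.
  rewrite -(cvg_lim _ cv)//; apply: lime_ge; first by apply/cvg_ex; exists 0.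
  by near=> k; exact: h.
have mfp : measurable_fun D (fun y => (`|f y| `^ p)%:E).
  apply/measurable_EFinP; apply: measurable_funS Dh _; first exact: measurable_halfline.
  apply: (@measurableT_comp _ _ _ _ _ _ (fun z : R => z `^ p)%R).
    exact: measurable_powR.
  exact: measurableT_comp.
pose T k y := (b k.+1 `^ p)%:E * (\1_(S k) y)%:E.
have T0 k y : 0 <= T k y by rewrite mule_ge0 ?lee_fin ?powR_ge0.
have mT k : measurable_fun D (T k).
  apply: measurable_funeM; apply/measurable_EFinP.
  by apply: measurable_indic; exact: mS.
have mT' : measurable_fun D (fun y => \sum_(k <oo) T k y).
  by apply: ge0_emeasurable_sum => *; [exact: T0|exact: mT].
have mNy : measurable_fun D (fun y => (+oo : \bar R) * (\1_N y)%:E).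
  apply: measurable_funeM; apply/measurable_EFinP.
  by apply: measurable_indic; exact: mN.
have sT0 y : 0 <= \sum_(k <oo) T k y by apply: nneseries_ge0 => *; exact: T0.
have N0 y : 0 <= (+oo : \bar R) * (\1_N y)%:E by rewrite mule_ge0 ?lee_fin.
(* Nothing bounds [f] on [N], where it exceeds every [b k]. As [N] is null, the value [+oo] there
   makes the pointwise majorant valid everywhere at no cost. *)
apply: (@le_trans _ _ (\int[mu]_(y in D)
    ((b 0%N `^ p)%:E + (\sum_(k <oo) T k y + (+oo : \bar R) * (\1_N y)%:E)))).
  apply: ge0_le_integral; [exact: mD|by move=> y _; rewrite lee_fin powR_ge0|exact: mfp| |].
  - by apply: emeasurable_funD => //; exact: emeasurable_funD.
  move=> y Dy; have y0 : (0 <= y)%R by apply/halflineE/Dh.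
  have [Ny|nNy] := pselect (N y).
    rewrite indicE mem_set// mule1 addey ?addey ?leey//.
      by rewrite gt_eqF// (lt_le_trans _ (sT0 y))// ltNyr.
  have ex : exists k, (`|f y| <= b k)%R.
    apply: contrapT => h; apply: nNy => k _; split => //.
    by rewrite ltNge; apply/negP => h'; apply: h; exists k.
  have [[|k] hk min] := ex_minnP ex.
    apply: (@le_trans _ _ (b 0%N `^ p)%:E).
      by rewrite lee_fin ge0_ler_powR ?nnegrE// ltW.
    by rewrite leeDl// adde_ge0.
  apply: (@le_trans _ _ (T k y)).
    rewrite /T indicE mem_set ?mule1.
      by rewrite lee_fin ge0_ler_powR ?nnegrE// ltW.
    by split => //; rewrite ltNge; apply/negP => /min; rewrite ltnn.
  apply: (@le_trans _ _ (\sum_(j <oo) T j y)); last first.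
    by rewrite (@le_trans _ _ (\sum_(j <oo) T j y + (+oo : \bar R) * (\1_N y)%:E))// ?leeDl// leeDr// lee_fin powR_ge0.
  apply: (@le_trans _ _ (\sum_(0 <= j < k.+1) T j y)); last first.
    by apply: nneseries_lim_ge => *; exact: T0.
  by rewrite big_nat_recr//= leeDr// sume_ge0.
rewrite ge0_integralD//; last 3 first.
- by move=> y _; rewrite lee_fin powR_ge0.
- by move=> y _; exact: adde_ge0.
- exact: emeasurable_funD.
rewrite ge0_integralD// integral_cst// leeD2l//.
rewrite integral_indicZ// (_ : lebesgue_measure _ = 0); last first.
  apply/eqP; rewrite eq_le measure_ge0 andbT -muN.
  apply: (@le_measure _ _ _ mu _ N); [|by rewrite inE|by move=> y []].
  by rewrite inE; exact: measurableI.
rewrite mule0 adde0 integral_nneseries//.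
apply: lee_nneseries => [k _ _|k _]; first by apply: integral_ge0.
rewrite integral_indicZ ?lee_fin ?powR_ge0// EFinM lee_wpmul2l ?lee_fin ?powR_ge0//.
apply: le_trans (hS k); apply: (@le_measure _ _ _ mu _ (S k)).
- by rewrite inE; apply: measurableI => //; exact: mS.
- by rewrite inE; exact: mS.
- by move=> y [].
Unshelve. all: by end_near. Qed.

End LayerBound.

(** * The rearrangement of a p-sum *)

Section PNormRearrangement.
Context {R : realType}.
Local Open Scope ereal_scope.
Local Notation mu := (@lebesgue_measure R).
Variables (n : nat) (fs : 'I_n -> R -> R) (p : R).
Hypothesis mfs : forall i, measurable_fun (@halfline R) (fs i).
Hypothesis p0 : (0 < p)%R.

Let pnorm (y : R) : R := ((\sum_(i < n) `|fs i y| `^ p) `^ p^-1)%R.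

Lemma measurable_pnorm_summand i : measurable_fun (@halfline R) (fun y => (`|fs i y| `^ p)%R).
Proof.
apply: (@measurableT_comp _ _ _ _ _ _ (fun z : R => z `^ p)%R).
  exact: measurable_powR.
exact: measurableT_comp.
Qed.

Lemma measurable_pnorm : measurable_fun (@halfline R) pnorm.
Proof.
apply: (@measurableT_comp _ _ _ _ _ _ (fun z : R => z `^ p^-1)%R).
  exact: measurable_powR.
by apply: measurable_sum => i; exact: measurable_pnorm_summand.
Qed.

Lemma pnorm_pow y : (pnorm y `^ p = \sum_(i < n) `|fs i y| `^ p)%R.
Proof.
by rewrite /pnorm -powRrM mulVf ?gt_eqF// powRr1// sumr_ge0.
Qed.

(** A discrete Hardy inequality: [t^p] is at most the mean of the sum of the [|fs i|^p] over a part
    of the level set, and each of these means is bounded by dyadic layers of the rearrangement of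
    [fs i]. *)
Lemma level_pnorm_bound (x t : R) (b : 'I_n -> nat -> R) :
  (0 < x)%R -> (0 < t)%R -> (forall i k, 0 <= b i k)%R ->
  (forall i k, drearr (fs i) (2^-1 ^+ k * (x / 2)) <= (b i k)%:E) ->
  x%:E <= mu (level pnorm t) ->
  (t `^ p)%:E <= \sum_(i < n) ((b i 0%N `^ p)%:E + \sum_(k <oo) (b i k.+1 `^ p * 2^-1 ^+ k)%:E).
Proof.
move=> x0 t0 b0 hb xl.
(* The level set may have infinite measure. Truncation to a bounded part makes the mean meaningful,
   at the price of [x / 2] in place of [x]. *)
pose E N := level pnorm t `&` `[0%R, N%:R]%classic.
have mE N : measurable (E N).
  by apply: measurableI; [exact: measurable_level measurable_pnorm|exact: measurable_itv].
have EU : \bigcup_N E N = level pnorm t.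
  apply/seteqP; split => y; first by move=> [N _ []].
  move=> ly; exists (Num.bound y) => //; split => //=.
  have [y0 _] := ly; rewrite in_itv /= y0 /=; exact/ltW/archi_boundP.
have [N hN] : exists N, (x / 2)%:E < mu (E N).
  apply: contrapT => hno.
  have cE : mu (E N) @[N --> \oo] --> mu (\bigcup_N E N).
    apply: nondecreasing_cvg_mu => //; first exact: bigcupT_measurable.
    move=> i j ij; apply/subsetPset => y [ly yi]; split => //.
    move: yi; rewrite /= !in_itv /= => /andP[-> h] /=.
    by rewrite (le_trans h)// ler_nat.
  have : mu (level pnorm t) <= (x / 2)%:E.
    rewrite -EU -(cvg_lim _ cE)//; apply: lime_le; first by apply/cvg_ex; exists (mu (\bigcup_N E N)).
    by near=> N; rewrite leNgt; apply/negP => h; apply: hno; exists N.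
  by move/(le_trans xl); rewrite lee_fin; lra.
have Eh : E N `<=` @halfline R by move=> y [[y0 _] _]; exact/halflineE.
have [m mE' xm] : exists2 m : R, mu (E N) = m%:E & (x / 2 < m)%R.
  have h1 : mu (E N) <= N%:R%:E.
    apply: (@le_trans _ _ (mu `[0%R, N%:R]%classic)).
      apply: le_measure; [by rewrite inE; exact: mE|by rewrite inE; exact: measurable_itv|].
      by move=> y [].
    rewrite lebesgue_measure_itv /= lte_fin; case: ifP => _; last by rewrite lee_fin.
    by rewrite oppr0 adde0.
  have h2 : mu (E N) \is a fin_num.
    by rewrite ge0_fin_numE ?measure_ge0// (le_lt_trans h1)// ltry.
  exists (fine (mu (E N))); first by rewrite fineK.
  by rewrite -lte_fin fineK.
have m0 : (0 < m)%R by lra.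
have key : (t `^ p)%:E * m%:E <= \sum_(i < n) ((b i 0%N `^ p)%:E * m%:E +
    \sum_(k <oo) (b i k.+1 `^ p * (2^-1 ^+ k * (x / 2)))%:E).
  rewrite -mE' -(integral_cst mu (mE N) (t `^ p)%:E).
  apply: (@le_trans _ _ (\int[mu]_(y in E N) (\sum_(i < n) (`|fs i y| `^ p)%:E))).
    apply: ge0_le_integral; [exact: mE|by move=> y _; rewrite lee_fin powR_ge0
      |exact: measurable_cst| |].
    - apply: emeasurable_sum => i; apply/measurable_EFinP.
      exact: measurable_funS measurable_halfline Eh (measurable_pnorm_summand i).
    - move=> y [[y0 ty] _]; rewrite sumEFin lee_fin -pnorm_pow.
      rewrite ge0_ler_powR ?nnegrE ?(ltW p0) ?(ltW t0) ?powR_ge0//.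
      by move: ty; rewrite ger0_norm ?powR_ge0.
  rewrite ge0_integral_sum; last 3 first.
  - exact: mE.
  - move=> i; apply/measurable_EFinP.
    exact: measurable_funS measurable_halfline Eh (measurable_pnorm_summand i).
  - by move=> i y _; rewrite lee_fin powR_ge0.
  apply: lee_sum => i _; apply: integral_powR_layers => //.
  by move=> k; apply: mu_superlevel.
rewrite -(@lee_pmul2r _ m%:E)//; apply: le_trans key _.
rewrite ge0_sume_distrl; last first.
  by move=> i _; rewrite adde_ge0 ?lee_fin ?powR_ge0// nneseries_ge0// => k _ _; rewrite lee_fin mulr_ge0 ?powR_ge0 ?exprn_ge0.
apply: lee_sum => i _.
rewrite ge0_muleDl ?lee_fin ?powR_ge0//; last first.
  by rewrite nneseries_ge0// => k _ _; rewrite lee_fin mulr_ge0 ?powR_ge0 ?exprn_ge0.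
rewrite leeD2l// muleC -nneseriesZl//; last first.
  by move=> k _; rewrite lee_fin mulr_ge0 ?powR_ge0 ?exprn_ge0.
apply: lee_nneseries => [k _ _|k _].
  by rewrite lee_fin !mulr_ge0 ?powR_ge0 ?exprn_ge0// ltW.
rewrite -EFinM lee_fin mulrA mulrC ler_wpM2r ?mulr_ge0 ?powR_ge0 ?exprn_ge0//.
exact: ltW.
Unshelve. all: by end_near. Qed.

End PNormRearrangement.

Section ConvexityHypotheses.
Context {R : realType}.

(** The product of the two inverses is comparable to [t] and the inverse of [H] does not decrease,
    so the other factor at most doubles, up to [c^2]. *)
Lemma complementary_doubling (H Hs : R -> R) : phi_function H -> complementary H Hs ->
  exists c1, forall t, 0 < t -> phi_inv Hs (2 * t) <= c1 * phi_inv Hs t.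
Proof.
move=> pH [pHs [c [c0 hc]]]; exists (2 * c ^+ 2) => t t0.
have t20 : 0 < 2 * t by rewrite mulr_gt0.
have [h1 _] := hc _ (ltW t0); have [_ h2] := hc _ (ltW t20).
have v0 : 0 < phi_inv H t by exact: (phi_gt0 (phi_phi_inv pH)).
have vv : phi_inv H t <= phi_inv H (2 * t).
  by apply: (phi_le (phi_phi_inv pH)); [exact: ltW|lra].
have l0 : 0 < phi_inv Hs (2 * t) by exact: (phi_gt0 (phi_phi_inv pHs)).
rewrite -(ler_pM2l v0); apply: (@le_trans _ _ (c * (2 * t))).
  by apply: le_trans h2; rewrite ler_wpM2r// ltW.
move: h1; rewrite ler_pdivrMr// => h1.
have -> : phi_inv H t * (2 * c ^+ 2 * phi_inv Hs t) =
  c * (2 * (phi_inv H t * phi_inv Hs t * c)) by ring.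
by rewrite ler_pM2l// ler_pM2l.
Qed.

(** With [v = phi_inv H t], the function in [succ] takes at [v] the value [G (t^(1/p))], while
    complementarity makes [v] comparable to [t / phi_inv Hs t]. The constant [B] combines the two
    equivalence constants. *)
Lemma succ_sandwich (G H Hs : R -> R) (p : R) : phi_function G -> phi_function H -> 0 < p ->
  complementary H Hs -> succ G (phi_inv H \o @powf R p) ->
  exists K B, [/\ phi_function K, convex_on_halfline K, 1 <= B & forall t, 0 <= t ->
    K (t / phi_inv Hs t / B) <= (G \o @powf R p^-1) t <= K (B * (t / phi_inv Hs t))].
Proof.
move=> pG pH p0 [pHs [c [c0 hc]]] [K [pK [cK [d [d0 hd]]]]].
have pp := phi_powf p0.
have E v : 0 <= v -> (G \o phi_inv (phi_inv H \o @powf R p)) v = G (H v `^ p^-1).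
  move=> v0; rewrite /= phi_inv_comp//; last exact: phi_phi_inv.
  by rewrite phi_inv_phi_inv// phi_inv_powf// phi_ge0.
pose B := Num.max 1 (d * c).
have B1 : 1 <= B by rewrite le_max lexx.
have Bdc : d * c <= B by rewrite le_max lexx orbT.
have dc0 : 0 < d * c by rewrite mulr_gt0.
exists K, B; split => // t; rewrite le_eqVlt => /predU1P[<-|t0].
  by rewrite !mul0r mulr0 /= (phi0 pK) (phi0 (phi_powf _)) ?invr_gt0// (phi0 pG) lexx.
have L0 : 0 < phi_inv Hs t by exact: (phi_gt0 (phi_phi_inv pHs)).
pose v := phi_inv H t.
have v0 : 0 < v by exact: (phi_gt0 (phi_phi_inv pH)).
have Hv : H v = t by rewrite /v phi_invK// ltW.
have [h1 h2] := hc _ (ltW t0).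
have -> : (G \o @powf R p^-1) t = G (H v `^ p^-1) by rewrite Hv.
apply/andP; split.
  have vd : 0 <= v / d by rewrite divr_ge0// ltW.
  have [_ h3] := hd _ vd.
  have -> : H v = H (d * (v / d)) by rewrite mulrC divfK// gt_eqF.
  move: h3; rewrite E; last by rewrite mulr_ge0// ltW.
  apply: le_trans; apply: (phi_le pK).
    by rewrite !divr_ge0// ?ltW// (lt_le_trans _ B1).
  have B0 : 0 < B by rewrite (lt_le_trans _ B1).
  apply: (@le_trans _ _ (t / phi_inv Hs t / (d * c))).
    by rewrite ler_wpM2l ?divr_ge0 ?(ltW t0) ?(ltW L0)// lef_pV2 ?posrE.
  rewrite ler_pdivrMr// mulrA [v / d * d]divfK ?gt_eqF// ler_pdivrMr// mulrAC.
  by move: h1; rewrite ler_pdivrMr.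
have dv : 0 <= d * v by rewrite mulr_ge0// ltW.
have [h3 _] := hd _ dv; move: h3; rewrite E; last by rewrite divr_ge0// ltW.
rewrite mulrAC mulfV ?gt_eqF// mul1r => h3.
apply: le_trans h3 _; apply: (phi_le pK) => //.
apply: (@le_trans _ _ (d * c * (t / phi_inv Hs t))).
  rewrite -mulrA ler_pM2l// mulrA ler_pdivlMr//.
by rewrite ler_wpM2r// divr_ge0// ltW.
Qed.

End ConvexityHypotheses.

Section BoydBound.
Context {R : realType}.
Local Open Scope ereal_scope.
Local Notation mu := (@lebesgue_measure R).
Variables (F G : R -> R).
Hypotheses (pF : phi_function F) (pG : phi_function G).

(** Needed because [dil_norm] ranges over functions of positive norm only. If a level set had
    positive measure, the pointwise bound with a small [c] would give [t <= t / 2]. *)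
Lemma OLnorm0_level f (t : R) : measurable_fun (@halfline R) f -> OLnorm F G f = 0 ->
  (0 < t)%R -> mu (level f t) = 0.
Proof.
move=> mf f0 t0; apply/eqP; rewrite eq_le measure_ge0 andbT leNgt; apply/negP => lt0.
have [d d0 dl] : exists2 d : R, (0 < d)%R & d%:E <= mu (level f t).
  move: lt0; case: (mu _) => [r| |] //; first by rewrite lte_fin => r0; exists r.
  by move=> _; exists 1%R => //; rewrite leey.
have pw : phi_function (timechange F G).
  exact: (phi_comp (phi_tilde pF) (phi_phi_inv (phi_tilde pG))).
have [x x0 wx] := phi_surj pw (ltW d0).
have {}x0 : (0 < x)%R.
  by rewrite lt_neqAle x0 andbT; apply/eqP => e; move: d0; rewrite -wx -e (phi0 pw) ltxx.
have td : t%:E <= drearr f (timechange F G x).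
  by apply: ereal_sup_ubound; exists t => //=; rewrite wx.
have y0 : (0 < phi_inv G x^-1)%R.
  by apply: (phi_gt0 (phi_phi_inv pG)); rewrite invr_gt0.
pose c := (t / 2 / phi_inv G x^-1)%R.
have c0 : (0 < c)%R by rewrite !divr_gt0.
have h : OLnorm F G f < c%:E by rewrite f0 lte_fin.
have := le_trans td (OLnorm_pointwise pF pG h x0).
by rewrite /c divfK ?gt_eqF// lee_fin; lra.
Qed.

(** The supremum yields an exponent [q] strictly above [p]. The maximum with 1 ensures a positive
    constant, and the strict form with [e] suits the infimum in [OLnorm]. *)
Lemma boyd_dilation (p : R) : p%:E < lower_boyd F G -> exists q M : R,
  [/\ (p < q)%R, (0 < q)%R, (1 <= M)%R & forall f a e, inOL F G f ->
    (0 < a)%R -> (a < 1)%R -> (fine (OLnorm F G f) < e)%R ->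
    OLnorm F G (dil a f) < (M * a `^ (- q^-1) * e)%:E].
Proof.
move=> /ereal_sup_gt[_ [q [q0 [c hc]] <-]]; rewrite lte_fin => pq.
exists q, (Num.max 1 c)%R; split => //; first by rewrite le_max lexx.
move=> f a e [mf fy] a0 a1 fe.
set M : R := Num.max 1%R c.
have M1 : (1 <= M)%R by rewrite le_max lexx.
have cM : (c <= M)%R by rewrite le_max lexx orbT.
have ap : (0 < a `^ (- q^-1))%R by exact: powR_gt0.
have Mp : (0 < M * a `^ (- q^-1))%R by rewrite mulr_gt0// (lt_le_trans _ M1).
have ff : OLnorm F G f \is a fin_num by rewrite ge0_fin_numE// OLnorm_ge0.
have [f0|fp] := leP (OLnorm F G f) 0.
  have {}f0 : OLnorm F G f = 0 by apply/eqP; rewrite eq_le f0 OLnorm_ge0.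
  apply: (@le_lt_trans _ _ (OLnorm F G f)).
    by apply: le_OLnorm => // t t0; rewrite mu_level_dil// OLnorm0_level// mule0.
  by move: fe; rewrite f0 /= lte_fin => e0; rewrite mulr_gt0.
have fp' : (0 < fine (OLnorm F G f))%R by rewrite fine_gt0// fp -ge0_fin_numE// OLnorm_ge0.
have h : OLnorm F G (dil a f) * ((fine (OLnorm F G f))^-1)%:E <= (c * a `^ (- q^-1))%:E.
  by apply: le_trans (hc a a0 a1); apply: ereal_sup_ubound; exists f.
apply: (@le_lt_trans _ _ (M * a `^ (- q^-1) * fine (OLnorm F G f))%:E); last first.
  by rewrite lte_fin ltr_pM2l.
rewrite -(@lee_pmul2r _ ((fine (OLnorm F G f))^-1)%:E)//; last by rewrite lte_fin invr_gt0.
apply: le_trans h _.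
by rewrite -EFinM mulfK ?gt_eqF// lee_fin ler_wpM2r// ltW.
Qed.

End BoydBound.

Section PConvexSufficiency.
Context {R : realType}.
Local Notation mu := (@lebesgue_measure R).

Lemma powR_half_expn (r : R) (m : nat) : (2^-1 ^+ m) `^ (- r) = (2 `^ r) ^+ m :> R.
Proof.
elim: m => [|m IH]; first by rewrite !expr0 powR1.
rewrite !exprS powRM ?exprn_ge0// IH; congr (_ * _).
by rewrite -{1}(powR_inv1 (ler0n R 2)) -powRrM mulrNN mul1r.
Qed.

Lemma powR_expn (x r : R) (m : nat) : 0 <= x -> (x ^+ m) `^ r = (x `^ r) ^+ m.
Proof.
move=> x0; elim: m => [|m IH]; first by rewrite !expr0 powR1.
by rewrite !exprS powRM ?exprn_ge0// IH.
Qed.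

Lemma geometric_partial_le1 (r : R) N : 0 <= r ->
  \sum_(k < N) (1 - r) * r ^+ k <= 1.
Proof.
move=> r0; rewrite -mulr_sumr; have := subrX1 r N.
have : 0 <= r ^+ N by rewrite exprn_ge0.
set S := \sum_(i < N) _; move=> h1 h2.
have -> : (1 - r) * S = - ((r - 1) * S) by ring.
by rewrite -h2; lra.
Qed.

Lemma powR_lt_mono (x y r : R) : 0 < r -> 0 <= x -> x < y -> x `^ r < y `^ r.
Proof.
by move=> r0 x0 xy; apply: gt0_ltr_powR; rewrite ?nnegrE// (le_trans x0)// ltW.
Qed.

Lemma powR_le_mono (x y r : R) : 0 < r -> 0 <= x -> x <= y -> x `^ r <= y `^ r.
Proof.
move=> r0 x0 xy; apply: ge0_ler_powR; rewrite ?nnegrE//; [exact: ltW|exact: le_trans xy].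
Qed.

Lemma powR_div_bound (t c p C A S : R) : 0 < t -> 0 < c -> 0 < C -> 0 < A ->
  c `^ p = 2 * C * A -> t `^ p / 2 <= A * S -> (t / c) `^ p <= S / C.
Proof.
move=> t0 c0 C0 A0 cp tp; rewrite powRM ?invr_ge0 ?(ltW t0) ?(ltW c0)//.
have -> : c^-1 `^ p = (2 * C * A)^-1.
  by rewrite -cp -[c^-1](powR_inv1 (ltW c0)) powRAC powR_inv1// powR_ge0.
rewrite ler_pdivrMr ?mulr_gt0//.
have -> : S / C * (2 * C * A) = 2 * (A * S) by field; rewrite gt_eqF.
by lra.
Qed.

Variables (F G : R -> R) (p : R).
Hypotheses (pF : phi_function F) (pG : phi_function G) (p0 : 0 < p).
Let Gp := G \o @powf R p^-1.
Let w := timechange F G.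

Variables (C : R) (W : R -> \bar R).
Hypotheses (C0 : 0 < C) (mW : measurable_fun (@halfline R) W)
  (W0 : forall y, (0 <= W y)%E)
  (iW : (\int[mu]_(y in @halfline R) W y <= (2^-1)%:E)%E).
Hypothesis GW : forall (I : eqType) (r : seq I) (a h : I -> R) x, 0 < x ->
     (forall i, 0 <= a i) -> (forall i, 0 <= h i <= phi_inv Gp x^-1) ->
     \sum_(i <- r) a i <= 1 ->
     ((Gp ((\sum_(i <- r) a i * h i) / C))%:E <=
       W x + (2^-1 * \sum_(i <- r) a i * Gp (h i))%:E)%E.

Variables (q M : R).
Hypotheses (pq : p < q) (q0 : 0 < q) (M1 : 1 <= M).
Hypothesis boyd : forall f a e, inOL F G f -> 0 < a -> a < 1 ->
  fine (OLnorm F G f) < e -> (OLnorm F G (dil a f) < (M * a `^ (- q^-1) * e)%:E)%E.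

(** [th] is what halving the dilation factor costs in the [p]-th power of the norm; with the layer
    weight 1/2 this gives the ratio [rho], below 1 precisely because [p < q]. *)
Let th : R := (2 `^ q^-1) `^ p.
Let rho : R := th / 2.

Lemma rho_bounds : 0 < th /\ 0 < rho < 1.
Proof.
have th0 : 0 < th by rewrite !powR_gt0.
split => //; rewrite /rho divr_gt0//= ltr_pdivrMr// mul1r.
rewrite /th -powRrM; set e := q^-1 * p.
have e1 : e < 1 by rewrite /e mulrC ltr_pdivrMr// mul1r.
have e2 : 2 = 2 `^ e * 2 `^ (1 - e) :> R.
  by rewrite -powRD ?pnatr_eq0 ?implybT// addrC subrK powRr1.
rewrite [ltRHS]e2 -[ltLHS]mulr1 ltr_pM2l ?powR_gt0//.
have := @powR_lt_mono 1 2 (1 - e); rewrite powR1; apply => //.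
  by rewrite subr_gt0.
by rewrite ltr1n.
Qed.

Let M2 := 4 * C * M `^ p * th / (1 - rho).

Lemma M2_gt0 : 0 < M2.
Proof.
have [th0 /andP[r0 r1]] := rho_bounds.
rewrite /M2 divr_gt0 ?subr_gt0// !mulr_gt0// powR_gt0//.
exact: lt_le_trans M1.
Qed.

Section OneFamily.
Variables (n : nat) (fs : 'I_n -> R -> R) (T : R).
Hypothesis fsOL : forall i, inOL F G (fs i).
Hypothesis fsT : \sum_(i < n) fine (OLnorm F G (fs i)) `^ p < T.
Let S0 := \sum_(i < n) fine (OLnorm F G (fs i)) `^ p.

Let S00 : 0 <= S0.
Proof. by apply: sumr_ge0 => i _; exact: powR_ge0. Qed.

Let T0 : 0 < T.
Proof. exact: le_lt_trans fsT. Qed.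

(** The slack between [S0] and [T], shared equally, gives numbers [eta i] strictly above the norms.
    The denominator [n.+1] covers the empty family. *)
Let del := (T - S0) / n.+1%:R.

Let del0 : 0 < del.
Proof. by rewrite divr_gt0// subr_gt0. Qed.

Let eta (i : 'I_n) := (fine (OLnorm F G (fs i)) `^ p + del) `^ p^-1.

Let eta_pow i : eta i `^ p = fine (OLnorm F G (fs i)) `^ p + del.
Proof.
rewrite /eta -powRrM mulVf ?gt_eqF// powRr1// addr_ge0 ?powR_ge0//.
exact: ltW.
Qed.

Let eta_gt i : fine (OLnorm F G (fs i)) < eta i.
Proof.
have f0 : 0 <= fine (OLnorm F G (fs i)) by rewrite fine_ge0// OLnorm_ge0.
rewrite -[ltLHS]powRr1// -{1}(mulfV (lt0r_neq0 p0)) powRrM.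
by apply: powR_lt_mono; rewrite ?invr_gt0 ?powR_ge0// ltrDl.
Qed.

Let eta0 i : 0 < eta i.
Proof. by apply: le_lt_trans (eta_gt i); rewrite fine_ge0// OLnorm_ge0. Qed.

Let sum_eta : \sum_(i < n) eta i `^ p <= T.
Proof.
under eq_bigr do rewrite eta_pow.
rewrite big_split /= sumr_const card_ord -/S0.
have : del *+ n <= T - S0; last by lra.
rewrite -mulr_natr /del mulrAC ler_pdivrMr ?ltr0n//.
by rewrite ler_wpM2l ?ler_nat// subr_ge0 ltW.
Qed.

Let sc (k : nat) : R := 2^-1 ^+ k.+1.
Let z (i : 'I_n) (k : nat) := M * sc k `^ (- q^-1) * eta i.
Let D (i : 'I_n) (k : nat) := dil (sc k) (fs i).

Let sc0 k : 0 < sc k.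
Proof. by rewrite exprn_gt0// invr_gt0. Qed.

Let sc1 k : sc k < 1.
Proof. by rewrite /sc exprn_ilt1 ?invr_ge0// invf_lt1 ?ltr1n. Qed.

Let Dz i k : (OLnorm F G (D i k) < (z i k)%:E)%E.
Proof. exact: boyd. Qed.

Let z0 i k : 0 < z i k.
Proof.
have M0 : 0 < M by exact: lt_le_trans M1.
by rewrite /z; apply: mulr_gt0 => //; apply: mulr_gt0 => //; exact: powR_gt0.
Qed.

Let z_pow i k : z i k `^ p = M `^ p * th ^+ k.+1 * eta i `^ p.
Proof.
rewrite /z /sc powR_half_expn.
rewrite powRM ?mulr_ge0 ?exprn_ge0 ?powR_ge0 ?(le_trans ler01 M1)// ?ltW//.
rewrite powRM ?exprn_ge0 ?powR_ge0 ?(le_trans ler01 M1)//.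
by rewrite powR_expn ?powR_ge0.
Qed.

Let d i k (x : R) := fine (drearr (D i k) (w x)).

Let d_fin i k x : 0 < x -> drearr (D i k) (w x) = (d i k x)%:E.
Proof.
move=> x0; rewrite /d fineK// ge0_fin_numE ?drearr_ge0//.
by apply: le_lt_trans (OLnorm_pointwise pF pG (Dz i k) x0) _; rewrite ltry.
Qed.

Let d0 i k x : 0 <= d i k x.
Proof. by rewrite fine_ge0// drearr_ge0. Qed.

Let h i k x := (d i k x / z i k) `^ p.

Let phi_inv_Gp y : 0 <= y -> phi_inv Gp y = phi_inv G y `^ p.
Proof.
move=> y0; have ip : 0 < p^-1 by rewrite invr_gt0.
rewrite /Gp phi_inv_comp//; last exact: phi_powf.
by rewrite phi_inv_powf// ?invrK// phi_inv_ge0.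
Qed.

Let h_le i k x : 0 < x -> 0 <= h i k x <= phi_inv Gp x^-1.
Proof.
move=> x0; rewrite powR_ge0 /= phi_inv_Gp ?invr_ge0 ?(ltW x0)//.
apply: powR_le_mono => //; first by rewrite divr_ge0// ltW.
have := OLnorm_pointwise pF pG (Dz i k) x0.
by rewrite -/w d_fin// lee_fin ler_pdivrMr// mulrC.
Qed.

Let V i k x := Gext G (drearr (D i k) (w x) * ((z i k)^-1)%:E)%E.

Let VE i k x : 0 < x -> V i k x = (Gp (h i k x))%:E.
Proof.
move=> x0; rewrite /V d_fin//= /Gp /= /powf /h -powRrM mulfV ?gt_eqF// powRr1//.
by rewrite divr_ge0// ltW.
Qed.

Let V0 i k x : (0 <= V i k x)%E.
Proof.
by apply: Gext_ge0 => //; rewrite mule_ge0 ?drearr_ge0// lee_fin invr_ge0 ltW.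
Qed.

Let mV i k : measurable_fun (@halfline R) (V i k).
Proof. by apply: Gext_scaled_measurable => //; exact: nonincr_pos_drearr. Qed.

Let iV i k : (\int[mu]_(x in @halfline R) V i k x <= 1)%E.
Proof. by have [] := OLnorm_lt pF pG (Dz i k). Qed.

(** Proportional to [2^(-k) * z i k ^ p] and normalised to total mass at most 1; the factor split
    off is [A]. *)
Let a (i : 'I_n) (k : nat) := (1 - rho) * rho ^+ k * (eta i `^ p / T).

Let a0 i k : 0 <= a i k.
Proof.
have [_ /andP[r0 r1]] := rho_bounds.
by rewrite !mulr_ge0 ?exprn_ge0 ?subr_ge0 ?powR_ge0 ?invr_ge0 ?(ltW r0) ?(ltW r1)// ltW.
Qed.

Let sum_a N : \sum_(k < N) \sum_(i < n) a i k <= 1.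
Proof.
have [_ /andP[r0 r1]] := rho_bounds.
have -> : \sum_(k < N) \sum_(i < n) a i k =
    (\sum_(k < N) (1 - rho) * rho ^+ k) * ((\sum_(i < n) eta i `^ p) / T).
  rewrite mulr_suml; apply: eq_bigr => k _.
  by rewrite mulr_suml mulr_sumr.
rewrite -[leRHS]mul1r ler_pM//.
- by apply: sumr_ge0 => k _; rewrite mulr_ge0 ?exprn_ge0 ?subr_ge0 ?ltW.
- by apply: divr_ge0; [apply: sumr_ge0 => i _; exact: powR_ge0|exact: ltW].
- exact/geometric_partial_le1/ltW.
- by rewrite ler_pdivrMr// mul1r.
Qed.

Let A := 2 * M `^ p * th * T / (1 - rho).

Let weight i k x : 0 < x -> 2 * 2^-1 ^+ k * d i k x `^ p = A * (a i k * h i k x).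
Proof.
move=> x0; have [th0 /andP[r0 r1]] := rho_bounds.
have -> : d i k x = z i k * (d i k x / z i k) by rewrite mulrC divfK// gt_eqF.
rewrite powRM ?divr_ge0 ?d0// ?(ltW (z0 _ _))// -/(h i k x) z_pow.
rewrite /A /a /rho expr_div_n exprS exprVn.
have h1 : 2 - th != 0 by move: r1; rewrite /rho; lra.
by field; rewrite h1 /= gt_eqF// expf_neq0.
Qed.

Let c := (M2 * T) `^ p^-1.

Let c0 : 0 < c.
Proof. by rewrite powR_gt0// mulr_gt0// M2_gt0. Qed.

Let c_pow : c `^ p = M2 * T.
Proof.
rewrite /c -powRrM mulVf ?gt_eqF// powRr1// mulr_ge0 ?(ltW M2_gt0)//.
exact: ltW.
Qed.

Let RHS x := (W x + (2^-1)%:E * \sum_(k <oo) \sum_(i < n) (a i k)%:E * V i k x)%E.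

Let sum_aV0 k x : (0 <= \sum_(i < n) (a i k)%:E * V i k x)%E.
Proof. by apply: sume_ge0 => i _; rewrite mule_ge0// lee_fin. Qed.

Let RHS0 x : (0 <= RHS x)%E.
Proof.
by rewrite adde_ge0// mule_ge0// nneseries_ge0.
Qed.

(** The majorant [GW] treats finite families only, so the layer series is cut; if no partial sum
    reached [t^p / 2], the whole series would be at most [t^p / 2]. The factor 2 in the weights
    absorbs the index shift between layers and dilations. *)
Let partial_sum_large x t : 0 < x -> 0 < t ->
  ((w x)%:E <= mu (level (fun y => ((\sum_(i < n) `|fs i y| `^ p) `^ p^-1)%R) t))%E ->
  exists N, t `^ p / 2 <= \sum_(k < N) \sum_(i < n) 2 * 2^-1 ^+ k * d i k x `^ p.
Proof.
move=> x0 t0 xl; apply: contrapT => hno.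
have mfs i : measurable_fun (@halfline R) (fs i) by have [] := fsOL i.
have hb i k : (drearr (fs i) (2^-1 ^+ k * (w x / 2)) <= (d i k x)%:E)%E.
  rewrite -d_fin// (_ : 2^-1 ^+ k * (w x / 2) = sc k * w x); last by rewrite /sc exprSr; ring.
  exact: drearr_dil.
have wx0 : 0 < w x by exact: timechange_gt0.
have := level_pnorm_bound mfs p0 wx0 t0 (fun i k => d0 i k x) hb xl.
have tp0 : 0 < t `^ p by exact: powR_gt0.
suff h1 : (\sum_(i < n) ((d i 0%N x `^ p)%:E + \sum_(k <oo) (d i k.+1 x `^ p * 2^-1 ^+ k)%:E)
    <= (t `^ p / 2)%:E)%E.
  by move/le_trans => /(_ _ h1); rewrite lee_fin; lra.
rewrite big_split /=.
rewrite -nneseries_sum; last by move=> i k _; rewrite lee_fin mulr_ge0 ?powR_ge0 ?exprn_ge0.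
rewrite sumEFin -leeBrDl//.
apply: lime_le.
  apply: is_cvg_nneseries => k _ _; apply: sume_ge0 => i _.
  by rewrite lee_fin mulr_ge0 ?powR_ge0 ?exprn_ge0.
near=> N; rewrite leeBrDl//.
have -> : (\sum_(0 <= k < N) \sum_(i < n) (d i k.+1 x `^ p * 2^-1 ^+ k)%:E =
    (\sum_(k < N) \sum_(i < n) d i k.+1 x `^ p * 2^-1 ^+ k)%:E)%E.
  by rewrite big_mkord -sumEFin; apply: eq_bigr => k _; rewrite sumEFin.
rewrite -EFinD lee_fin.
apply: (@le_trans _ _ (\sum_(k < N.+1) \sum_(i < n) 2 * 2^-1 ^+ k * d i k x `^ p)); last first.
  by rewrite leNgt; apply/negP => /ltW h2; apply: hno; exists N.+1.
rewrite big_ord_recl lerD//.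
  apply: ler_sum => i _; rewrite expr0 mulr1 ler_peMl ?powR_ge0//.
  by rewrite ler1n.
apply: ler_sum => k _; apply: ler_sum => i _.
by rewrite !lift0 exprS mulrA mulfV// mul1r mulrC.
Unshelve. all: by end_near. Qed.

Let pointwise_bound x : 0 < x ->
  (Gext G (drearr (fun y => ((\sum_(i < n) `|fs i y| `^ p) `^ p^-1)%R) (w x) * (c^-1)%:E)
    <= RHS x)%E.
Proof.
move=> x0.
have [th0 /andP[r0 r1]] := rho_bounds.
have M0 : 0 < M by exact: lt_le_trans M1.
have pGp : phi_function Gp by apply: (phi_comp pG); apply: phi_powf; rewrite invr_gt0.
have A0 : 0 < A.
  by rewrite /A divr_gt0 ?subr_gt0// !mulr_gt0 ?powR_gt0.
have M2T : M2 * T = 2 * C * A.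
  by rewrite /M2 /A; field; rewrite subr_eq0 eq_sym lt_eqF.
have := RHS0 x; case E : (RHS x) => [r| |] //; last by move=> _; rewrite leey.
rewrite lee_fin => rr0.
set f := (fun y => _).
suff h1 : (drearr f (w x) <= (c * phi_inv G r)%:E)%E.
  have -> : r%:E = Gext G ((c * phi_inv G r)%:E * (c^-1)%:E)%E.
    by rewrite -EFinM mulrAC mulfV ?gt_eqF// mul1r /= phi_invK.
  apply: Gext_le => //.
    by rewrite mule_ge0 ?drearr_ge0// lee_fin invr_ge0 ltW.
  by rewrite lee_wpmul2r// lee_fin invr_ge0 ltW.
(* The thresholds below the rearrangement are tested one at a time, so the length [N] of the partial
   sum may depend on [t]. The constant [c] satisfies [c^p = 2 * C * A], with the 2 coming from
   [t^p / 2]. *)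
apply: ge_ereal_sup => _ [t /= ht <-]; rewrite lee_fin.
have ir0 : 0 <= phi_inv G r by exact: phi_inv_ge0.
have [t0|t0] := leP t 0; first by rewrite (le_trans t0)// mulr_ge0// ltW.
rewrite mulrC -ler_pdivrMr//; apply: (phi_leW pG) => //; rewrite phi_invK//.
have [N hN] := partial_sum_large x0 t0 ht.
have tc : (t / c) `^ p <= (\sum_(k < N) \sum_(i < n) a i k * h i k x) / C.
  apply: (@powR_div_bound _ _ _ _ A) => //; first by rewrite c_pow.
  apply: le_trans hN _; rewrite mulr_sumr; apply: ler_sum => k _.
  by rewrite mulr_sumr; apply: ler_sum => i _; rewrite weight.
have -> : G (t / c) = Gp ((t / c) `^ p).
  by rewrite /Gp /= /powf -powRrM mulfV ?gt_eqF// powRr1// divr_ge0// ltW.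
rewrite -lee_fin -E.
apply: (@le_trans _ _ (Gp ((\sum_(k < N) \sum_(i < n) a i k * h i k x) / C))%:E).
  by rewrite lee_fin; apply: (phi_le pGp) => //; exact: powR_ge0.
rewrite pair_bigA /=.
apply: le_trans (GW (r := index_enum _) (a := fun j : 'I_N * 'I_n => a j.2 j.1)
  (h := fun j => h j.2 j.1 x) x0 _ _ _) _ => //.
- by move=> j; exact: h_le.
- by rewrite -(pair_bigA _ (fun (k : 'I_N) (i : 'I_n) => a i k)) /=; exact: sum_a.
rewrite -(pair_bigA _ (fun (k : 'I_N) (i : 'I_n) => a i k * Gp (h i k x))) /=.
rewrite leeD2l// EFinM lee_wpmul2l//.
apply: (@le_trans _ _ (\sum_(0 <= k < N) \sum_(i < n) (a i k)%:E * V i k x)%E); last first.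
  by apply: nneseries_lim_ge => k _ _; exact: sum_aV0.
rewrite big_mkord -sumEFin; apply: lee_sum => k _.
by rewrite -sumEFin; apply: lee_sum => i _; rewrite VE.
Qed.

Let mRHS_series : measurable_fun (@halfline R)
  (fun x => \sum_(k <oo) \sum_(i < n) (a i k)%:E * V i k x)%E.
Proof.
apply: ge0_emeasurable_sum => *; first exact: sum_aV0.
by apply: emeasurable_sum => i; exact: measurable_funeM.
Qed.

Let mRHS : measurable_fun (@halfline R) RHS.
Proof. by apply: emeasurable_funD => //; exact: measurable_funeM. Qed.

Let iRHS : (\int[mu]_(x in @halfline R) RHS x <= 1)%E.
Proof.
have s0 x : (0 <= \sum_(k <oo) \sum_(i < n) (a i k)%:E * V i k x)%E.
  by apply: nneseries_ge0 => k _ _; exact: sum_aV0.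
rewrite /RHS ge0_integralD//; last 3 first.
- exact: measurable_halfline.
- by move=> x _; rewrite mule_ge0.
- exact: measurable_funeM.
have -> : (1%R%:E : \bar R) = ((2^-1)%:E + (2^-1)%:E * 1%:E)%E.
  by rewrite -EFinM -EFinD; congr EFin; lra.
apply: leeD => //.
rewrite ge0_integralZl//; last exact: measurable_halfline.
rewrite lee_wpmul2l//.
have maV k i : measurable_fun (@halfline R) (fun x => (a i k)%:E * V i k x)%E.
  exact: measurable_funeM.
rewrite integral_nneseries; first last.
- by move=> k x _; exact: sum_aV0.
- by move=> k; apply: emeasurable_sum => i; exact: maV.
- exact: measurable_halfline.
apply: lime_le.
  by apply: is_cvg_nneseries => k _ _; apply: integral_ge0 => x _; exact: sum_aV0.
near=> N.
apply: (@le_trans _ _ (\sum_(0 <= k < N) (\sum_(i < n) a i k)%:E)%E).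
  apply: lee_sum => k _.
  rewrite ge0_integral_sum; first last.
  - by move=> i x _; rewrite mule_ge0// lee_fin.
  - by move=> i; exact: maV.
  - exact: measurable_halfline.
  rewrite -sumEFin; apply: lee_sum => i _.
  rewrite ge0_integralZl; first last.
  - by rewrite lee_fin.
  - by move=> x _; exact: V0.
  - exact: mV.
  - exact: measurable_halfline.
  by rewrite -[leRHS]mule1 lee_wpmul2l ?lee_fin.
by rewrite sumEFin lee_fin big_mkord.
Unshelve. all: by end_near. Qed.

Lemma OLnorm_pnorm_le :
  (OLnorm F G (fun y => ((\sum_(i < n) `|fs i y| `^ p) `^ p^-1)%R) <= c%:E)%E.
Proof.
apply: luxE_le => //; apply: le_trans iRHS.
apply: le_integral_halfline => //.
- by apply: Gext_scaled_measurable => //; exact: nonincr_pos_drearr.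
- move=> x x0; apply: Gext_ge0 => //.
  by rewrite mule_ge0 ?drearr_ge0// lee_fin invr_ge0 ltW.
Qed.

End OneFamily.

Lemma p_convex_of_bounds : p_convex F G p.
Proof.
exists (M2 `^ p^-1) => n fs fsOL.
set S0 := \sum_(i < n) _.
have S00 : 0 <= S0 by apply: sumr_ge0 => i _; exact: powR_ge0.
have M20 := M2_gt0.
set v := OLnorm _ _ _.
have vle T : S0 < T -> (v <= ((M2 * T) `^ p^-1)%:E)%E by exact: OLnorm_pnorm_le.
have v0 : (0 <= v)%E by exact: OLnorm_ge0.
have vf : v \is a fin_num.
  by rewrite ge0_fin_numE// (le_lt_trans (vle (S0 + 1) _)) ?ltrDl// ltry.
rewrite -(fineK vf) lee_fin; set u := fine v.
have u0 : 0 <= u by rewrite fine_ge0.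
rewrite -powRM ?(ltW M20)// leNgt; apply/negP => lt1.
have h1 : M2 * S0 < u `^ p.
  have := powR_lt_mono p0 (powR_ge0 _ _) lt1.
  by rewrite -powRrM mulVf ?gt_eqF// powRr1// mulr_ge0// ltW.
(* The bound is known only for [T] strictly above [S0]; a violated inequality leaves room for such a
   [T]. *)
pose T := (u `^ p / M2 + S0) / 2.
have h2 : S0 < u `^ p / M2 by rewrite ltr_pdivlMr// mulrC.
have h3 : S0 < T by rewrite /T; lra.
have := vle _ h3; rewrite -(fineK vf) lee_fin -/u leNgt => /negP; apply.
rewrite [ltRHS](_ : u = (u `^ p) `^ p^-1); last first.
  by rewrite -powRrM mulfV ?gt_eqF// powRr1.
apply: powR_lt_mono; rewrite ?invr_gt0//.
  by rewrite mulr_ge0 ?(ltW M20)// (le_trans S00)// ltW.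
by rewrite mulrC -ltr_pdivlMr// /T; lra.
Qed.

End PConvexSufficiency.

Section PartOne.
Context {R : realType}.

Theorem p_convex_sufficient (F G : R -> R) (p : R) :
  phi_function F -> phi_function G -> 0 < p ->
  (p%:E < lower_boyd F G)%E ->
  (exists H, N_function H /\ condJ H /\ succ G (phi_inv H \o @powf R p)) ->
  p_convex F G p.
Proof.
move=> pF pG p0 pb [H [[pH _] [[Hs [cHs Jfin]] sG]]].
have pHs : phi_function Hs by case: cHs.
have pGp : phi_function (G \o @powf R p^-1).
  by apply: (phi_comp pG); apply: phi_powf; rewrite invr_gt0.
have [c1 L2] := complementary_doubling pH cHs.
have [K [B [pK cK B1 KG]]] := succ_sandwich pG pH p0 cHs sG.
have [c c2 [s2 sS]] := condJ_summable pHs Jfin L2.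
have [C [W [C0 mW W0 iW GW]]] := quasi_convex_majorant pGp pK pHs cK B1 KG c2 s2 sS.
have [q [M [pq q0 M1 boyd]]] := boyd_dilation pF pG pb.
exact: (p_convex_of_bounds pF pG p0 C0 mW W0 iW GW pq q0 M1 boyd).
Qed.

End PartOne.

(** * The Boyd index of a p-convex space *)

Section Interleaving.
Context {R : realType}.
Local Notation mu := (@lebesgue_measure R).
Variables (f : R -> R) (N : nat).
Hypothesis mf : measurable_fun (@halfline R) f.
Hypothesis N0 : (0 < N)%N.

(* The [i]-th of [N] disjoint copies of [f]: the unit block [q, q+1[ of [f] is
   moved to the block [q * N + i, q * N + i + 1[. *)
Definition block_copy (i : nat) (y : R) : R :=
  let m := Num.truncn y in
  if (m %% N == i)%N then f (y - m%:R + (m %/ N)%:R) else 0.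

Lemma truncn_block (y : R) m : 0 <= y -> m%:R <= y < m.+1%:R -> Num.truncn y = m.
Proof. by move=> y0 h; apply: truncn_def. Qed.

Lemma measurable_block_copy i : measurable_fun (@halfline R) (block_copy i).
Proof.
have -> : @halfline R = \bigcup_m `[m%:R, m.+1%:R[%classic.
  apply/seteqP; split => y.
    move/halflineE => y0; exists (Num.truncn y) => //=.
    by rewrite in_itv /= truncn_itv.
  move=> [m _] /=; rewrite in_itv /= => /andP[h _]; apply/halflineE.
  exact: le_trans h.
apply/measurable_fun_bigcup => [m|m]; first exact: measurable_itv.
have tr y : y \in `[m%:R, m.+1%:R[%classic -> Num.truncn y = m.
  by rewrite inE /= in_itv /= => h; apply: truncn_def.
have [mi|mi] := boolP (m %% N == i)%N.
  apply: (@eq_measurable_fun _ _ _ _ _ (f \o (fun y => y - m%:R + (m %/ N)%:R))).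
    by move=> y /tr; rewrite /block_copy /= => ->; rewrite mi.
  apply: (measurable_comp measurable_halfline _ mf).
    move=> _ [y /= + <-]; rewrite in_itv /= => /andP[h _]; apply/halflineE.
    by rewrite addr_ge0// subr_ge0.
  by apply: measurable_funD => //; apply: measurable_funB.
apply: (@eq_measurable_fun _ _ _ _ _ (fun _ : R => 0 : R)); last exact: measurable_cst.
by move=> y /tr; rewrite /block_copy /= => ->; rewrite (negbTE mi).
Qed.

(** The level set is cut at the integers, and each piece of the copy is a translate of a piece of
    the original. Off its blocks the copy is 0, whence [t > 0]. *)
Lemma mu_level_block_copy i t : (i < N)%N -> 0 < t ->
  mu (level (block_copy i) t) = mu (level f t).
Proof.
move=> iN t0.
pose E q := level f t `&` `[q%:R, q.+1%:R[%classic.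
pose b q : R := q%:R - (q * N + i)%:R.
pose A q := (fun y => 1 * y + b q) @^-1` (E q).
have mE q : measurable (E q).
  by apply: measurableI; [exact: measurable_level|exact: measurable_itv].
have mA q : measurable (A q).
  have h : measurable_fun [set: R] (fun y : R => 1 * y + b q).
    by apply: measurable_funD => //; exact: mulrl_measurable.
  by rewrite -[A q]setTI; exact: h.
have muA q : mu (A q) = mu (E q).
  by rewrite /A lebesgue_measure_affine// invr1 mul1e.
have Atr q y : A q y -> 0 <= y /\ Num.truncn y = (q * N + i)%N.
  move=> [_] /=; rewrite in_itv /= mul1r /b => /andP[h1 h2].
  have h3 : (q * N + i)%:R <= y < (q * N + i).+1%:R.
    by move: h1 h2; rewrite -!natr1; set u := (q * N + i)%:R; lra.
  have y0 : 0 <= y by case/andP: h3 => h3 _; apply: le_trans h3.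
  by split => //; apply: truncn_block.
have Etr q y : E q y -> Num.truncn y = q.
  by move=> [[y0 _]] /=; rewrite in_itv /= => h; exact: truncn_block.
have -> : level f t = \bigcup_q E q.
  apply/seteqP; split => y; last by move=> [q _ []].
  move=> ly; have [y0 _] := ly; exists (Num.truncn y) => //; split => //=.
  by rewrite in_itv /= truncn_itv.
have -> : level (block_copy i) t = \bigcup_q A q.
  apply/seteqP; split => y.
    move=> [y0]; rewrite /block_copy; set m := Num.truncn y.
    case: ifPn => [/eqP mi|_]; last by rewrite normr0 leNgt t0.
    move=> tf; exists (m %/ N)%N => //.
    have me : (m %/ N * N + i = m)%N by rewrite -mi -divn_eq.
    have /andP[h1 h2] := truncn_itv y0.
    have ye : 1 * y + b (m %/ N)%N = y - m%:R + (m %/ N)%:R by rewrite /b me; ring.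
    rewrite /A /E /= ye; split.
      by split => //; rewrite addr_ge0// subr_ge0.
    rewrite in_itv /= -natr1; move: h1 h2; rewrite -/m -natr1.
    by set u := (m %/ N)%:R; set v := m%:R; lra.
  move=> [q _ Aq]; have [y0 ty] := Atr _ _ Aq; split => //.
  rewrite /block_copy ty modnMDl modn_small// eqxx divnMDl// divn_small// addn0.
  have -> : y - (q * N + i)%:R + q%:R = 1 * y + b q by rewrite /b; ring.
  by have [[_ ?] _] := Aq.
rewrite !measure_semi_bigcup//; try exact: bigcupT_measurable.
- by apply: eq_eseriesr => q _; exact: muA.
- apply/trivIsetP => q q' _ _ /eqP qq'; rewrite -subset0 => y [/Etr h1 /Etr h2].
  by apply: qq'; rewrite -h1 -h2.
- apply/trivIsetP => q q' _ _ /eqP qq'; rewrite -subset0 => y [/Atr[_ h1] /Atr[_ h2]].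
  by apply: qq'; move: h1; rewrite h2 => /addIn/eqP; rewrite eqn_pmul2r// => /eqP.
Qed.

Lemma mu_level_copies_ge (p t : R) : 0 < p -> 0 < t ->
  (N%:R%:E * mu (level f t) <=
   mu (level (fun y => ((\sum_(i < N) `|block_copy i y| `^ p) `^ p^-1)%R) t))%E.
Proof.
move=> p0 t0.
have e : (N%:R%:E * mu (level f t) = \sum_(i < N) mu (level (block_copy i) t))%E.
  under eq_bigr do rewrite mu_level_block_copy//.
  by rewrite sumr_const card_ord mule_natl.
rewrite e -measure_bigsetU_ord//; last 2 first.
- by move=> i; apply: measurable_level; exact: measurable_block_copy.
- apply/trivIsetP => i j _ _ /eqP ij; rewrite -subset0 => y [[y0 h1] [_ h2]].
  apply: ij; apply: val_inj => /=.
  move: h1 h2; rewrite /block_copy; case: ifPn => [/eqP <-|_]; last by rewrite normr0 leNgt t0.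
  by move=> _; case: ifPn => [/eqP <-//|_]; rewrite normr0 leNgt t0.
apply: le_measure; rewrite ?inE.
- by apply: bigsetU_measurable => i _; apply: measurable_level; exact: measurable_block_copy.
- by apply: measurable_level; apply: measurable_pnorm => i; exact: measurable_block_copy.
rewrite -(bigcup_mkord N (fun i => level (block_copy i) t)) => y [i /= iN [y0 h]].
split => //; rewrite ger0_norm ?powR_ge0//; apply: le_trans h _.
rewrite [leLHS](_ : _ = (`|block_copy i y| `^ p) `^ p^-1); last first.
  by rewrite -powRrM mulfV ?gt_eqF// powRr1.
apply: powR_le_mono; rewrite ?invr_gt0 ?powR_ge0//.
by rewrite (bigD1 (Ordinal iN))//= lerDl sumr_ge0// => j _; exact: powR_ge0.
Qed.

End Interleaving.

Section BoydIndexBound.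
Context {R : realType}.
Local Notation mu := (@lebesgue_measure R).

(** About [1/a] disjoint copies of [f] have a p-sum whose level sets are at least as large as those
    of [dil a f], and p-convexity bounds its norm by [C N^(1/p)] times that of [f]. The choice
    [N <= 2/a] yields the factor [2^(1/p)]. *)
Theorem p_convex_boyd (F G : R -> R) (p : R) :
  phi_function F -> phi_function G -> 0 < p -> p_convex F G p ->
  (p%:E <= lower_boyd F G)%E.
Proof.
move=> pF pG p0 [C hC]; apply: ereal_sup_ubound; exists p => //; split => //.
exists (`|C| * 2 `^ p^-1) => a a0 a1.
apply: ge_ereal_sup => _ [f [[mf fy] fp] <-].
have ff : OLnorm F G f \is a fin_num by rewrite ge0_fin_numE// OLnorm_ge0.
have fp' : 0 < fine (OLnorm F G f) by rewrite fine_gt0// fp.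
have aV1 : 1 < a^-1 by rewrite invf_gt1.
have [N [N0 N2 N3]] : exists N : nat, [/\ (0 < N)%N, a^-1 < N%:R & N%:R <= 2 * a^-1].
  exists (Num.truncn a^-1).+1.
  have /andP[N1 N2] := truncn_itv (ltW (lt_trans ltr01 aV1)).
  by split => //; rewrite -natr1; lra.
have cpn i : (i < N)%N -> (OLnorm F G (block_copy f N i) <= OLnorm F G f)%E.
  by move=> iN; apply: le_OLnorm => // t t0; rewrite mu_level_block_copy.
have cpOL (i : 'I_N) : inOL F G (block_copy f N i).
  by split; [exact: measurable_block_copy|exact: le_lt_trans (cpn _ (ltn_ord i)) fy].
have := hC N (fun i => block_copy f N i) cpOL; set g := (fun x => _ `^ _) => hg.
have dg : (OLnorm F G (dil a f) <= OLnorm F G g)%E.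
  apply: le_OLnorm => // t t0; rewrite mu_level_dil//.
  apply: le_trans (mu_level_copies_ge mf N0 p0 t0).
  by rewrite lee_wpmul2r ?measure_ge0// lee_fin ltW.
rewrite -lee_pdivlMr ?invr_gt0// invrK.
apply: le_trans dg _; apply: le_trans hg _; rewrite -EFinM lee_fin.
set S := \sum_(i < N) _.
have S0 : 0 <= S by apply: sumr_ge0 => i _; exact: powR_ge0.
have SN : S <= 2 * a^-1 * fine (OLnorm F G f) `^ p.
  apply: (@le_trans _ _ (N%:R * fine (OLnorm F G f) `^ p)); last by rewrite ler_wpM2r ?powR_ge0.
  have -> : N%:R * fine (OLnorm F G f) `^ p = \sum_(i < N) fine (OLnorm F G f) `^ p.
    by rewrite sumr_const card_ord mulr_natl.
  apply: ler_sum => i _; apply: powR_le_mono; first exact: p0.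
    exact: (fine_ge0 (OLnorm_ge0 F G (block_copy f N i))).
  apply: (fine_le _ ff (cpn _ (ltn_ord i))).
  by rewrite (ge0_fin_numE (OLnorm_ge0 F G (block_copy f N i))); exact: (cpOL i).2.
apply: (@le_trans _ _ (`|C| * S `^ p^-1)); first by rewrite ler_wpM2r ?powR_ge0// ler_norm.
rewrite -!mulrA ler_wpM2l//.
have := powR_le_mono (_ : 0 < p^-1) S0 SN; rewrite invr_gt0 => /(_ p0).
move/le_trans; apply.
rewrite powRM ?mulr_ge0 ?powR_ge0 ?invr_ge0 ?(ltW a0)//.
rewrite powRM ?invr_ge0 ?(ltW a0)// -mulrA ler_wpM2l ?powR_ge0//.
rewrite -[a^-1](powR_inv1 (ltW a0)) -powRrM mulN1r ler_wpM2l ?powR_ge0//.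
by rewrite -powRrM mulfV ?gt_eqF// powRr1// ltW.
Qed.

End BoydIndexBound.

(** * The scales of G forced by p-convexity *)

Section StepFunctionTest.
Context {R : realType}.
Local Notation mu := (@lebesgue_measure R).
Variables (F G : R -> R) (p : R).
Hypotheses (pF : phi_function F) (pG : phi_function G) (p0 : 0 < p).
Let Gp := G \o @powf R p^-1.
Let w := timechange F G.

Definition stepf (b m y : R) : R := b * \1_(`]-oo, m]%classic : set R) y.

Lemma measurable_stepf b m : measurable_fun (@halfline R) (stepf b m).
Proof.
apply: measurable_funM; first exact: measurable_cst.
by apply: measurable_indic; exact: measurable_itv.
Qed.

Lemma stepfE b m y : stepf b m y = if y <= m then b else 0.
Proof.
rewrite /stepf indicE.
have -> : (y \in (`]-oo, m]%classic : set R)) = (y <= m).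
  by apply/idP/idP; rewrite inE /= in_itv.
by case: ifP; rewrite ?mulr1 ?mulr0.
Qed.

Lemma mu_itv0 (m : R) : 0 < m -> mu `[0, m]%classic = m%:E.
Proof. by move=> m0; rewrite lebesgue_measure_itv /= lte_fin m0 oppr0 adde0. Qed.

Lemma drearr_stepf b m x : 0 <= b -> 0 < m -> 0 < x ->
  (drearr (stepf b m) x <= (if x <= m then b else 0)%:E)%E.
Proof.
move=> b0 m0 x0; apply: ge_ereal_sup => _ [t /= ht <-]; rewrite lee_fin.
have [t0|t0] := leP t 0; first by rewrite (le_trans t0)//; case: ifP.
have tb : t <= b.
  rewrite leNgt; apply/negP => bt; move: ht.
  have -> : [set y | 0 <= y /\ t <= `|stepf b m y|] = set0.
    rewrite -subset0 => y [y0]; rewrite stepfE; case: ifP => _.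
      by rewrite ger0_norm// leNgt bt.
    by rewrite normr0 leNgt t0.
  by rewrite measure0 lee_fin leNgt x0.
case: ifPn => //; rewrite -ltNge => mx; move: ht.
rewrite leNgt => /negP; case.
apply: (@le_lt_trans _ _ (mu `[0, m]%classic)); last by rewrite mu_itv0// lte_fin.
apply: le_measure; rewrite ?inE.
- exact: (measurable_level _ (measurable_stepf b m)).
- exact: measurable_itv.
move=> y [y0]; rewrite stepfE; case: ifP => [ym _|_]; last by rewrite normr0 leNgt t0.
by rewrite /= in_itv /= y0 ym.
Qed.

(** The time change turns the step into one of height [th * t] on [[0, 1 / G t]], with Luxemburg
    integral at most 1. Strictness in [th < c] keeps [c] positive when [th = 0]. *)
Lemma OLnorm_stepf (th t c : R) : 0 <= th -> 0 < t -> th < c ->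
  (OLnorm F G (stepf (th * t) (w (G t)^-1)) <= c%:E)%E.
Proof.
move=> th0 t0 thc; have c0 : 0 < c by exact: le_lt_trans thc.
have Gt0 : 0 < G t by exact: (phi_gt0 pG).
have x0 : 0 < (G t)^-1 by rewrite invr_gt0.
have b0 : 0 <= th * t by rewrite mulr_ge0// ltW.
have m0 : 0 < w (G t)^-1 by exact: timechange_gt0.
apply: luxE_le => //.
have mA : measurable (`[0, (G t)^-1]%classic : set R) by exact: measurable_itv.
apply: (@le_trans _ _ (\int[mu]_(y in @halfline R)
    ((G t)%:E * (\1_(`[0%R, ((G t)^-1)%R]%classic : set R) y)%:E))%E); last first.
  rewrite integral_halfline_indic//; last 2 first.
    exact: ltW.
    by move=> y /=; rewrite in_itv /= => /andP[h _]; exact/halflineE.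
  by rewrite mu_itv0// -EFinM mulfV// gt_eqF.
apply: le_integral_halfline.
- by apply: Gext_scaled_measurable => //; exact: nonincr_pos_drearr.
- apply: measurable_funeM; apply/measurable_EFinP.
  by apply: measurable_indic; exact: mA.
- move=> x xp; apply: Gext_ge0 => //.
  by rewrite mule_ge0 ?drearr_ge0// lee_fin invr_ge0 ltW.
move=> x xp.
have wx0 : 0 < w x by exact: timechange_gt0.
apply: (@le_trans _ _ (Gext G ((if w x <= w (G t)^-1 then th * t else 0) / c)%:E)).
  apply: Gext_le => //; first by rewrite mule_ge0 ?drearr_ge0// lee_fin invr_ge0 ltW.
  by rewrite EFinM lee_wpmul2r ?lee_fin ?invr_ge0 ?(ltW c0)//; exact: drearr_stepf.
rewrite /= indicE; case: ifP => wle.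
  have xle : x <= (G t)^-1.
    rewrite leNgt; apply/negP => lt1; move: wle.
    by rewrite leNgt timechange_lt// ltW.
  rewrite mem_set /=; last by rewrite in_itv /= xle ltW.
  rewrite mule1 lee_fin; apply: (phi_le pG); first by rewrite divr_ge0// ltW.
  by rewrite ler_pdivrMr// mulrC ler_wpM2l// ltW.
by rewrite mul0r (phi0 pG) mule_ge0// lee_fin ltW.
Qed.

(** The functions are steps of height [th^(1/p) * tau^(1/p)] supported up to the time change of
    [1 / Gp tau]. Their p-sum dominates each of them, so its Luxemburg integral is at least the sum
    over the disjoint intervals given by the separation; halving these intervals produces the bound
    2. *)
Lemma p_convex_test : p_convex F G p -> exists2 C, 1 <= C &
  forall N (P : pred 'I_N) (th tau : 'I_N -> R),
  (forall j, P j -> 0 <= th j) -> (forall j, P j -> 0 < tau j) ->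
  (forall i j, P i -> P j -> i != j ->
     (2 * Gp (tau i) <= Gp (tau j)) || (2 * Gp (tau j) <= Gp (tau i))) ->
  \sum_(j | P j) th j <= 1 ->
  \sum_(j | P j) Gp (th j * tau j / C) / Gp (tau j) <= 2.
Proof.
move=> [C hC].
(* The 2 bounds the sum of the [p]-th powers of the norms, slack included; adding 1 makes the final
   norm strictly smaller than [C1]. *)
pose C1 := `|C| * 2 `^ p^-1 + 1.
have C11 : 1 <= C1 by rewrite lerDr mulr_ge0 ?powR_ge0.
have C10 : 0 < C1 by exact: lt_le_trans C11.
have ip0 : 0 < p^-1 by rewrite invr_gt0.
exists (C1 `^ p).
  by have := powR_le_mono p0 ler01 C11; rewrite powR1.
move=> N P th0 tau0 h1 h2 sep sum1.
(* Outside [P] the step has height 0, so p-convexity can be applied to the whole family. *)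
pose th j := if P j then th0 j else 0.
pose tau j := if P j then tau0 j else 1.
have thp j : 0 <= th j by rewrite /th; case: ifP => // /h1.
have taup j : 0 < tau j by rewrite /tau; case: ifP => // /h2.
pose t j := tau j `^ p^-1.
have tp j : 0 < t j by exact: powR_gt0.
pose a j := th j `^ p^-1.
have ap j : 0 <= a j by exact: powR_ge0.
pose x j := (G (t j))^-1.
have Gt j : 0 < G (t j) by exact: (phi_gt0 pG).
have xp j : 0 < x j by rewrite invr_gt0.
pose fs j := stepf (a j * t j) (w (x j)).
pose c j := (th j + N.+1%:R^-1) `^ p^-1.
have ac j : a j < c j.
  by apply: powR_lt_mono => //; rewrite ltrDl invr_gt0 ltr0n.
have nfs j : (OLnorm F G (fs j) <= (c j)%:E)%E by exact: OLnorm_stepf.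
have fsOL j : inOL F G (fs j).
  split; first exact: measurable_stepf.
  by apply: le_lt_trans (nfs j) _; rewrite ltry.
have := hC N fs fsOL; set g := (fun y => _ `^ _) => hg.
have Sle : \sum_(j < N) fine (OLnorm F G (fs j)) `^ p <= 2.
  apply: (@le_trans _ _ (\sum_(j < N) (th j + N.+1%:R^-1))).
    apply: ler_sum => j _.
    have e0 : 0 <= th j + N.+1%:R^-1 by rewrite addr_ge0// invr_ge0.
    have -> : th j + N.+1%:R^-1 = c j `^ p.
      by rewrite /c -powRrM mulVf ?gt_eqF// powRr1.
    apply: powR_le_mono => //; first exact: (fine_ge0 (OLnorm_ge0 _ _ _)).
    have ffn : OLnorm F G (fs j) \is a fin_num.
      by rewrite (ge0_fin_numE (OLnorm_ge0 _ _ _)); exact: (fsOL j).2.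
    by rewrite -lee_fin fineK.
  rewrite big_split /= sumr_const card_ord.
  have -> : \sum_(j < N) th j = \sum_(j | P j) th0 j by rewrite [RHS]big_mkcond.
  have : N.+1%:R^-1 *+ N <= 1 :> R.
    rewrite -(mulr_natr (N.+1%:R^-1)) mulrC ler_pdivrMr ?ltr0n// mul1r ler_nat.
    exact: leqnSn.
  by move=> h; apply: (lerD sum1 h).
have gC : (OLnorm F G g < C1%:E)%E.
  apply: le_lt_trans hg _; rewrite lte_fin /C1 ltr_pwDr//.
  apply: (@le_trans _ _ (`|C| * (\sum_(j < N) fine (OLnorm F G (fs j)) `^ p) `^ p^-1)).
    by rewrite ler_wpM2r ?powR_ge0// ler_norm.
  rewrite ler_wpM2l//; apply: powR_le_mono => //.
  by apply: sumr_ge0 => j _; exact: powR_ge0.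
have [_ ig] := OLnorm_lt pF pG gC.
have key : ((\sum_(j <- [seq j <- index_enum 'I_N | P j]) G (a j * t j / C1) * x j / 2)%:E <= 1)%E.
  apply: le_trans ig.
  apply: sum_le_integral_dyadic.
  - by rewrite filter_uniq// index_enum_uniq.
  - by apply: Gext_scaled_measurable => //; exact: nonincr_pos_drearr.
  - move=> y y0; apply: Gext_ge0 => //.
    by rewrite mule_ge0 ?drearr_ge0// lee_fin invr_ge0 ltW.
  - by move=> j _; exact: xp.
  - move=> j _; apply: (phi_ge0 pG).
    by apply: divr_ge0; [apply: mulr_ge0 => //; exact: ltW|exact: ltW].
  - move=> i j; rewrite !mem_filter => /andP[Pi _] /andP[Pj _] ij.
    have := sep i j Pi Pj ij.
    have -> : Gp (tau0 i) = G (t i) by rewrite /Gp /= /powf /t /tau Pi.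
    have -> : Gp (tau0 j) = G (t j) by rewrite /Gp /= /powf /t /tau Pj.
    rewrite orbC /x => /orP[] h; apply/orP; [left|right];
      by rewrite -[leRHS]mul1r ler_pdivlMr// mulrAC ler_pdivrMr// mul1r.
  - move=> j y _ y1 y2.
    have y0 : 0 < y by apply: le_lt_trans y1; rewrite divr_ge0// ltW.
    have bj : 0 <= a j * t j by rewrite mulr_ge0// ltW.
    have wy : 0 < w (x j) by exact: timechange_gt0.
    apply: (@le_trans _ _ (Gext G (a j * t j / C1)%:E)) => //.
    apply: Gext_le => //; first by rewrite lee_fin divr_ge0// ltW.
    rewrite EFinM lee_wpmul2r ?lee_fin ?invr_ge0 ?(ltW C10)//.
    apply: ereal_sup_ubound; exists (a j * t j) => //=.
    apply: (@le_trans _ _ (w (x j))%:E).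
      by rewrite lee_fin; apply: timechange_le => //; exact: ltW.
    rewrite -(mu_itv0 wy); apply: le_measure; rewrite ?inE.
    + exact: measurable_itv.
    + apply: (measurable_level (f := g)); apply: measurable_pnorm => i.
      exact: measurable_stepf.
    move=> u /=; rewrite in_itv /= => /andP[u0 uw]; split => //.
    rewrite ger0_norm ?powR_ge0//.
    rewrite [leLHS](_ : _ = (`|fs j u| `^ p) `^ p^-1); last first.
      by rewrite -powRrM mulfV ?gt_eqF// powRr1// /fs stepfE uw ger0_norm.
    apply: powR_le_mono; rewrite ?powR_ge0//.
    by rewrite (bigD1 j)//= lerDl sumr_ge0// => i _; exact: powR_ge0.
move: key; rewrite lee_fin -mulr_suml ler_pdivrMr// mul1r.
rewrite big_filter; apply: le_trans; rewrite le_eqVlt; apply/orP; left; apply/eqP.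
apply: eq_bigr => j Pj.
have -> : Gp (tau0 j) = G (t j) by rewrite /Gp /= /powf /t /tau Pj.
congr (_ / _).
rewrite /Gp /= /powf; congr (G _).
have -> : th0 j = th j by rewrite /th Pj.
have -> : tau0 j = tau j by rewrite /tau Pj.
rewrite powRM ?mulr_ge0 ?invr_ge0 ?powR_ge0 ?(ltW (taup j))//.
rewrite powRM ?(ltW (taup j))//; congr (_ * _).
rewrite -[(C1 `^ p)^-1](powR_inv1 (powR_ge0 _ _)) -!powRrM.
by rewrite mulN1r mulrN mulfV ?gt_eqF// powR_inv1// ltW.
Qed.

End StepFunctionTest.

(** * The test inequality, doubling, and dyadic chains *)

Section TestInequality.
Context {R : realType}.
Implicit Types G g : R -> R.

(* The inequality obtained by applying p-convexity to step functions whose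
   levels [G (tau j)] are separated by a factor 2. *)
Definition scale_test G (C : R) : Prop :=
  forall N (P : pred 'I_N) (th tau : 'I_N -> R),
  (forall j, P j -> 0 <= th j) -> (forall j, P j -> 0 < tau j) ->
  (forall i j, P i -> P j -> i != j ->
     (2 * G (tau i) <= G (tau j)) || (2 * G (tau j) <= G (tau i))) ->
  \sum_(j | P j) th j <= 1 ->
  \sum_(j | P j) G (th j * tau j / C) / G (tau j) <= 2.

Lemma separated_seq (u : nat -> R) : (forall n, 0 <= u n) -> (forall n, 2 * u n <= u n.+1) ->
  forall n m, (n < m)%N -> 2 * u n <= u m.
Proof.
move=> u0 u2 n; elim=> // m IH; rewrite ltnS leq_eqVlt => /predU1P[<-|/IH h]; first exact: u2.
by apply: le_trans h _; have := u2 m; have := u0 m; lra.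
Qed.

Lemma separated_seq_down (u : nat -> R) : (forall n, 0 <= u n) -> (forall n, 2 * u n.+1 <= u n) ->
  forall n m, (n < m)%N -> 2 * u m <= u n.
Proof.
move=> u0 u2 n; elim=> // m IH; rewrite ltnS leq_eqVlt => /predU1P[<-|/IH h]; first exact: u2.
by have := u2 m; have := u0 m.+1; lra.
Qed.

Section Doubling.
Variables (G : R -> R) (C : R).
Hypotheses (pG : phi_function G) (C1 : 1 <= C) (tG : scale_test G C).
(** With five points [M0 * u] of weight 1/5, the argument of [G] in the test is exactly [u]. Each
    bad point contributes more than 1/2, so five separated ones exceed the bound 2. *)
Let M0 : R := 5 * C.
Let bad (t : R) := 0 < t /\ G (M0 * t) < 2 * G t.

Let M00 : 0 < M0.
Proof. by rewrite /M0; move: C1; lra. Qed.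

Let no_bad_seq (u : nat -> R) : (forall n, bad (u n)) ->
  (forall n m, (n < m)%N -> 2 * G (M0 * u n) <= G (M0 * u m)) \/
  (forall n m, (n < m)%N -> 2 * G (M0 * u m) <= G (M0 * u n)) -> False.
Proof.
move=> bu sep.
have Cp : 0 < C by move: C1; lra.
have up n : 0 < u n by have [] := bu n.
have Gp n : 0 < G (M0 * u n) by apply: (phi_gt0 pG); rewrite mulr_gt0.
have h5 : \sum_(j < 5) (5^-1 : R) <= 1.
  by rewrite sumr_const card_ord -(mulr_natr 5^-1) mulVf.
have : \sum_(j < 5) G (5^-1 * (M0 * u j) / C) / G (M0 * u j) <= 2.
  apply: (tG (P := xpredT)) => //.
    by move=> j _; rewrite mulr_gt0.
  move=> i j _ _; rewrite neq_ltn => /orP[] ij.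
    by case: sep => /(_ _ _ ij) ->; rewrite ?orbT.
  by case: sep => /(_ _ _ ij) ->; rewrite ?orbT.
have h2 : \sum_(j < 5) (2^-1 : R) <= \sum_(j < 5) G (5^-1 * (M0 * u j) / C) / G (M0 * u j).
  apply: ler_sum => j _.
  have -> : 5^-1 * (M0 * u j) / C = u j by rewrite /M0; field; rewrite gt_eqF.
  by rewrite ler_pdivlMr//; have [_] := bu j; lra.
move=> h3; have := le_trans h2 h3.
by rewrite sumr_const card_ord -(mulr_natr 2^-1); lra.
Qed.

Let bad_bounded_above : exists b, forall t, bad t -> t <= b.
Proof.
apply: contrapT => hno.
have nxt z : exists t, bad t /\ z < t.
  apply: contrapT => h; apply: hno; exists z => t bt.
  by rewrite leNgt; apply/negP => zt; apply: h; exists t.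
have [nx hnx] := choice nxt.
pose up v := nx (phi_inv G (2 * G (M0 * v)) / M0).
pose u n := iter n up (nx 0).
have bu n : bad (u n) by case: n => [|n]; rewrite /u ?iterS; exact: (hnx _).1.
have u0 n : 0 < u n by have [] := bu n.
apply: (no_bad_seq bu); left; apply: separated_seq => n.
  by apply/ltW/(phi_gt0 pG); rewrite mulr_gt0.
have h0 : 0 <= 2 * G (M0 * u n).
  by rewrite mulr_ge0// (phi_ge0 pG)// mulr_ge0// ltW.
rewrite -[leLHS](phi_invK pG h0); apply: (phi_le pG); first exact: phi_inv_ge0.
have := (hnx (phi_inv G (2 * G (M0 * u n)) / M0)).2; rewrite -/(up (u n)) -/(u n.+1).
by rewrite ltr_pdivrMr// (mulrC (u n.+1)) => /ltW.
Qed.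

Let bad_bounded_below : exists2 a, 0 < a & forall t, bad t -> a <= t.
Proof.
apply: contrapT => hno.
have nxt z : exists t, 0 < z -> bad t /\ t < z.
  have [z0|z0] := ltP 0 z; last by exists 0.
  apply: contrapT => h; apply: hno; exists z => // t bt.
  by rewrite leNgt; apply/negP => zt; apply: h; exists t.
have [nx hnx] := choice nxt.
pose dn v := nx (phi_inv G (G (M0 * v) / 2) / M0).
pose u n := iter n dn (nx 1).
have z0 v : 0 < v -> 0 < phi_inv G (G (M0 * v) / 2) / M0.
  move=> v0; rewrite divr_gt0//; apply: (phi_gt0 (phi_phi_inv pG)).
  by rewrite divr_gt0// (phi_gt0 pG)// mulr_gt0.
have bu n : bad (u n).
  elim: n => [|n [un0 _]]; first exact: (hnx 1 ltr01).1.
  by rewrite /u iterS; apply: (hnx _ _).1; exact: z0.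
have u0 n : 0 < u n by have [] := bu n.
apply: (no_bad_seq bu); right; apply: (@separated_seq_down (fun n => G (M0 * u n))) => n.
  by apply/ltW/(phi_gt0 pG); rewrite mulr_gt0.
have h0 : 0 <= G (M0 * u n) / 2.
  by rewrite divr_ge0// (phi_ge0 pG)// mulr_ge0// ltW.
rewrite mulrC -ler_pdivlMr// -[leRHS](phi_invK pG h0); apply: (phi_le pG).
  by rewrite mulr_ge0// ltW.
have := (hnx _ (z0 _ (u0 n))).2; rewrite -/(dn (u n)) -/(u n.+1).
by rewrite ltr_pdivlMr// (mulrC (u n.+1)) => /ltW.
Qed.

(** Bad points near 0 or infinity would yield a separated sequence, so they lie in a compact
    interval [[a, b]]. There a larger factor reaches from any bad point past [b], where [M0]
    works. *)
Lemma scale_test_doubling : exists2 M, 1 <= M & forall t, 0 < t -> 2 * G t <= G (M * t).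
Proof.
have [b hb] := bad_bounded_above; have [a a0 ha] := bad_bounded_below.
pose M := M0 * (1 + (`|b| + 1) / a).
have k0 : 0 <= (`|b| + 1) / a by rewrite divr_ge0 ?ltW// addr_ge0.
have M0M : M0 <= M by rewrite /M ler_peMr ?(ltW M00)// lerDl.
exists M; first by apply: le_trans M0M; rewrite /M0; move: C1; lra.
have good t : 0 < t -> ~ bad t -> 2 * G t <= G (M0 * t).
  by move=> t0 nb; rewrite leNgt; apply/negP => h; apply: nb.
move=> t t0; have [bt|nb] := pselect (bad t); last first.
  apply: le_trans (good _ t0 nb) _; apply: (phi_le pG).
    by rewrite mulr_ge0// ltW.
  by rewrite ler_wpM2r// ltW.
pose t' := `|b| + 1.
have t'0 : 0 < t' by rewrite /t' ltr_pwDr.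
have nb : ~ bad t'.
  by move/hb; have := ler_norm b; rewrite /t'; lra.
apply: (@le_trans _ _ (2 * G t')).
  rewrite ler_pM2l//; apply: (phi_le pG); first exact: ltW.
  by have := hb _ bt; have := ler_norm b; rewrite /t'; lra.
apply: le_trans (good _ t'0 nb) _; apply: (phi_le pG).
  by rewrite mulr_ge0// ltW.
rewrite /M -[leRHS]mulrA ler_pM2l// mulrDl mul1r.
apply: (@le_trans _ _ (t' / a * t)); last by rewrite lerDr ltW.
by rewrite mulrAC ler_pdivlMr// ler_pM2l//; exact: ha.
Qed.

End Doubling.

(* The test inequality restricted to dyadic chains; in this form it is stable
   under [tilde], which exchanges large and small scales. *)
Definition chain_test g (C : R) : Prop :=
  forall N (P : pred 'I_N) (i j : nat -> nat),
  (forall n, (i n < j n <= i n.+1)%N) ->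
  (forall n : 'I_N, P n -> 2 * g (2 ^+ i n) <= g (2 ^+ j n)) ->
  \sum_(n < N | P n) C * (2 ^+ i n / 2 ^+ j n) <= 1 ->
  \sum_(n < N | P n) g (2 ^+ i n) / g (2 ^+ j n) <= 2.

Lemma chain_le (i j : nat -> nat) : (forall n, (i n < j n <= i n.+1)%N) ->
  forall n m, (n < m)%N -> (j n <= i m)%N.
Proof.
move=> ij n; elim=> // m IH; rewrite ltnS leq_eqVlt => /predU1P[<-|/IH h].
  by have /andP[] := ij n.
by apply: leq_trans h _; have /andP[/ltnW h1 h2] := ij m; exact: leq_trans h2.
Qed.

(** Take [tau = 2^j] and [th = C 2^i / 2^j], so that [th * tau / C = 2^i]. The separation of
    [G (2^j)] along the chain follows from the doubling within each pair. *)
Lemma scale_test_chain G C : phi_function G -> 1 <= C -> scale_test G C -> chain_test G C.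
Proof.
move=> pG C1 tG N P i j ij PG sum1.
have Cp : 0 < C by lra.
have e2 k : 0 < 2 ^+ k :> R by rewrite exprn_gt0.
have G2 k : 0 < G (2 ^+ k) by exact: (phi_gt0 pG).
have := tG N P (fun n => C * (2 ^+ i n / 2 ^+ j n)) (fun n => 2 ^+ j n) _ _ _ sum1.
have -> : \sum_(n < N | P n) G (C * (2 ^+ i n / 2 ^+ j n) * 2 ^+ j n / C) / G (2 ^+ j n) =
    \sum_(n < N | P n) G (2 ^+ i n) / G (2 ^+ j n).
  apply: eq_bigr => n _; congr (G _ / _).
  by field; rewrite !gt_eqF.
apply.
- by move=> n _; rewrite mulr_ge0 ?divr_ge0// ltW.
- by [].
move=> n m Pn Pm.
have sep (k l : 'I_N) : P l -> (k < l)%N -> 2 * G (2 ^+ j k) <= G (2 ^+ j l).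
  move=> Pl kl; apply: le_trans (PG _ Pl); rewrite ler_pM2l//.
  apply: (phi_le pG); first exact: ltW.
  by rewrite ler_weXn2l ?ler1n// chain_le.
by rewrite neq_ltn => /orP[] kl; rewrite (sep _ _ _ kl)// ?orbT.
Qed.

(** The same test with [tau = 2^(-i)], so that the argument becomes [2^(-j)]; the quotients of [G]
    at these points are those of [tilde G] at [2^i] and [2^j]. *)
Lemma scale_test_chain_tilde G C : phi_function G -> 1 <= C -> scale_test G C ->
  chain_test (tilde G) C.
Proof.
move=> pG C1 tG N P i j ij PG sum1.
have Cp : 0 < C by lra.
have e2 k : 0 < 2 ^+ k :> R by rewrite exprn_gt0.
have eV k : 0 < (2 ^+ k)^-1 :> R by rewrite invr_gt0.
have G2 k : 0 < G (2 ^+ k)^-1 by exact: (phi_gt0 pG).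
have tE k : tilde G (2 ^+ k) = (G (2 ^+ k)^-1)^-1 by rewrite tilde_gt0E.
have := tG N P (fun n => C * (2 ^+ i n / 2 ^+ j n)) (fun n => (2 ^+ i n)^-1) _ _ _ sum1.
have -> : \sum_(n < N | P n) G (C * (2 ^+ i n / 2 ^+ j n) * (2 ^+ i n)^-1 / C) / G (2 ^+ i n)^-1 =
    \sum_(n < N | P n) tilde G (2 ^+ i n) / tilde G (2 ^+ j n).
  apply: eq_bigr => n _; rewrite !tE invrK mulrC; congr (_ * G _).
  by field; rewrite !gt_eqF.
apply.
- by move=> n _; rewrite mulr_ge0 ?divr_ge0// ltW.
- by [].
move=> n m Pn Pm.
have sep (k l : 'I_N) : P k -> (k < l)%N -> 2 * G (2 ^+ i l)^-1 <= G (2 ^+ i k)^-1.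
  move=> Pk kl; apply: (@le_trans _ _ (2 * G (2 ^+ j k)^-1)).
    rewrite ler_pM2l//; apply: (phi_le pG); first exact: ltW.
    by rewrite lef_pV2 ?posrE// ler_weXn2l ?ler1n// chain_le.
  by have := PG _ Pk; rewrite !tE -[leRHS]mul1r ler_pdivlMr// mulrAC ler_pdivrMr// mul1r.
by rewrite neq_ltn => /orP[] kl; rewrite (sep _ _ _ kl)// ?orbT.
Qed.

Lemma doubling_tilde G (M : R) : phi_function G -> 1 <= M ->
  (forall t, 0 < t -> 2 * G t <= G (M * t)) ->
  forall t, 0 < t -> 2 * tilde G t <= tilde G (M * t).
Proof.
move=> pG M1 hM t t0; have M0 : 0 < M by lra.
have Mt : 0 < M * t by rewrite mulr_gt0.
rewrite !tilde_gt0E//.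
have h : 0 < (M * t)^-1 by rewrite invr_gt0.
have := hM _ h; have -> : M * (M * t)^-1 = t^-1 by field; rewrite !gt_eqF.
have G1 : 0 < G (M * t)^-1 by exact: (phi_gt0 pG).
have G2 : 0 < G t^-1 by apply: (phi_gt0 pG); rewrite invr_gt0.
by move=> h'; rewrite -[leRHS]mul1r ler_pdivlMr// mulrAC ler_pdivrMr// mul1r.
Qed.

End TestInequality.

(** * Greedy selection of scales *)

Section GreedyScales.
Context {R : realType}.
Variables (g : R -> R) (C M : R).
Hypotheses (pg : phi_function g) (C1 : 1 <= C) (M1 : 1 <= M).
Hypothesis hM : forall t, 0 < t -> 2 * g t <= g (M * t).
Hypothesis cg : chain_test g C.

Let B : R := Num.max M (3 * C).
Let e (i : nat) : R := g (2 ^+ i) / 2 ^+ i.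

Let BM : M <= B. Proof. by rewrite le_max lexx. Qed.
Let BC : 3 * C <= B. Proof. by rewrite le_max lexx orbT. Qed.
Let B3 : 3 <= B. Proof. by apply: le_trans BC; move: C1; lra. Qed.
Let B0 : 0 < B. Proof. by move: B3; lra. Qed.
Let e2 k : 0 < 2 ^+ k :> R. Proof. by rewrite exprn_gt0. Qed.
Let g2 k : 0 < g (2 ^+ k). Proof. exact: (phi_gt0 pg). Qed.
Let e0 k : 0 < e k. Proof. by rewrite divr_gt0. Qed.

(** As [g] does not decrease, a drop of [g t / t] by a factor [B] forces [2^j >= B 2^i]; since
    [B >= M], doubling then separates the values of [g]. *)
Let bad_ratio i j : (i < j)%N -> B * e j < e i ->
  2 ^+ i / 2 ^+ j <= B^-1 /\ 2 * g (2 ^+ i) <= g (2 ^+ j).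
Proof.
move=> ij; rewrite /e ltr_pdivlMr// mulrA mulrAC ltr_pdivrMr// => h.
have gij : g (2 ^+ i) <= g (2 ^+ j).
  by apply: (phi_le pg); [exact: ltW|rewrite ler_weXn2l ?ler1n// ltnW].
have h1 : B * 2 ^+ i <= 2 ^+ j.
  rewrite leNgt; apply/negP => h2.
  have : g (2 ^+ i) * 2 ^+ j <= g (2 ^+ j) * (B * 2 ^+ i).
    by apply: ler_pM => //; exact: ltW.
  by rewrite leNgt mulrCA mulrA h.
split; first by rewrite ler_pdivrMr// mulrC ler_pdivlMr// mulrC.
apply: le_trans (hM (e2 i)) _; apply: (phi_le pg); first by rewrite mulr_ge0 ?ltW//; move: M1; lra.
by apply: le_trans h1; rewrite ler_pM2r.
Qed.

(** The least end point [j] of an admissible pair; minimality excludes large drops strictly before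
    it. The alternative [2 i < j] makes such a [j] exist even where there are no drops, and its
    ratios are summable anyway. *)
Let greedy_step q : exists ij : nat * nat, [/\ (q <= ij.1)%N, (ij.1 < ij.2)%N,
  (B * e ij.2 < e ij.1) \/ (2 * ij.1 < ij.2)%N &
  forall i k, (q <= i)%N -> (i <= k)%N -> (k < ij.2)%N -> e i <= B * e k].
Proof.
pose P j := `[< exists i, [/\ (q <= i)%N, (i < j)%N & (B * e j < e i) \/ (2 * i < j)%N] >].
have ex : exists j, P j.
  exists (2 * q).+1; apply/asboolP; exists q; split => //; last by right.
  by rewrite ltnS leq_pmull.
have [j /asboolP[i [h1 h2 h3]] min] := ex_minnP ex.
exists (i, j); split => //= a k qa; rewrite leq_eqVlt => /predU1P[<-|ak] kj.
  by rewrite ler_peMl ?(ltW (e0 _))//; move: B3; lra.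
rewrite leNgt; apply/negP => h.
have : (j <= k)%N by apply: min; apply/asboolP; exists a; split => //; left.
by rewrite leqNgt kj.
Qed.

Let dyadic_location (s : R) : 1 <= s -> exists i : nat, 2 ^+ i <= s < 2 ^+ i.+1.
Proof.
move=> s1; have ex : exists k : nat, s < 2 ^+ k.
  by exists (Num.bound s); exact: upper_nthrootP.
have [[|i] h min] := ex_minnP ex; first by move: h; rewrite expr0; lra.
exists i; rewrite h andbT leNgt; apply/negP => /min.
by rewrite ltnn.
Qed.

Lemma greedy_scales (c : R) : 8 * B <= c -> exists (t : nat -> R) (A S : R),
  [/\ (2 * c <= t 0%N /\ forall n, 2 * c * t n <= t n.+1),
      (forall N, \sum_(n < N) t n / t n.+1 <= S),
      (forall s u, 1 <= s -> s <= u -> u <= t 0%N -> g s / s <= A * (g u / u)) &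
      (forall n s u, t n <= s -> s <= u -> u <= t n.+1 -> g s / s <= c * (g u / u))].
Proof.
move=> Bc; have c0 : 0 < c by move: B3 Bc; lra.
have [f hf] := choice greedy_step.
pose q n := iter n (fun k => (f k).2) 0%N.
pose i n := (f (q n)).1.
have qS n : q n.+1 = (f (q n)).2 by [].
have iq n : (q n <= i n)%N by have [] := hf (q n).
have ij n : (i n < q n.+1)%N by have [] := hf (q n).
have qlt n : (q n < q n.+1)%N by exact: leq_ltn_trans (ij n).
have qn n : (n <= q n)%N by elim: n => // n IH; exact: leq_ltn_trans (qlt n).
have ch n : (i n < q n.+1 <= i n.+1)%N by rewrite ij iq.
pose sg n : R := 2 ^+ i n / 2 ^+ q n.+1.
have sg0 n : 0 <= sg n by rewrite divr_ge0// ltW.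
pose P n := B * e (q n.+1) < e (i n).
(* Bootstrap: one more term of size at most [1/B] keeps the sum below [3/B <= 1/C], so the test
   applies. Each quotient of [g] exceeds [B] times its ratio, hence the test returns the bound
   [2/B]. *)
have bad_sum N : \sum_(n < N | P n) sg n <= 2 / B.
  elim: N => [|N IH]; first by rewrite big_ord0 divr_ge0// ltW.
  have sum3 : \sum_(n < N.+1 | P n) sg n <= 3 / B.
    rewrite big_mkcond big_ord_recr /= -big_mkcond /=.
    have : (if P N then sg N else 0) <= B^-1.
      by case: ifP => [PN|_]; [have [] := bad_ratio (ij N) PN|rewrite invr_ge0 ltW].
    by move: IH; lra.
  have sum1 : \sum_(n < N.+1 | P n) C * sg n <= 1.
    rewrite -mulr_sumr; apply: le_trans (ler_wpM2l _ sum3) _; first by move: C1; lra.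
    by rewrite mulrA ler_pdivrMr// mul1r mulrC.
  have := cg ch (P := fun n : 'I_N.+1 => P n) (fun n Pn => (bad_ratio (ij n) Pn).2) sum1.
  have : B * (\sum_(n < N.+1 | P n) sg n) <=
      \sum_(n < N.+1 | P n) g (2 ^+ i n) / g (2 ^+ q n.+1).
    rewrite mulr_sumr; apply: ler_sum => n; rewrite /P /e /sg => Pn.
    move: Pn; rewrite ltr_pdivlMr// mulrA mulrAC ltr_pdivrMr// => Pn.
    by rewrite ler_pdivlMr// mulrA mulrAC ler_pdivrMr// mulrAC ltW.
  move=> h1 h2; rewrite ler_pdivlMr// mulrC.
  exact: le_trans h1 h2.
have sum2 N : \sum_(n < N) 2 ^+ q n / 2 ^+ q n.+1 <= 2 :> R.
  (* A pair chosen only for [2 i < j] has ratio at most [2^(-(i+1))], and [i >= q n >= n]. *)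
  apply: (@le_trans _ _ (\sum_(n < N) ((if P n then sg n else 0) + (1 - 2^-1) * 2^-1 ^+ n))).
    apply: ler_sum => n _.
    apply: (@le_trans _ _ (sg n)).
      by rewrite ler_pM2r ?invr_gt0// ler_weXn2l ?ler1n.
    have h0 : 0 <= (1 - 2^-1) * 2^-1 ^+ n :> R by rewrite mulr_ge0 ?exprn_ge0//; lra.
    case: ifPn => [_|nP]; first by rewrite lerDl.
    have [_ _ [/(negP nP)//|h] _] := hf (q n).
    rewrite add0r /sg ler_pdivrMr//.
    have -> : (1 - 2^-1) * 2^-1 ^+ n = (2 ^+ n.+1)^-1 :> R.
      by rewrite exprVn exprS; field; rewrite gt_eqF.
    rewrite mulrC ler_pdivlMr// -exprD ler_weXn2l ?ler1n//.
    rewrite -qS -/(i n) in h.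
    by have := iq n; have := qn n; move: h; lia.
  rewrite big_split /= -big_mkcond /=.
  have := geometric_partial_le1 N (_ : 0 <= 2^-1 :> R); rewrite invr_ge0 => /(_ (ler0n _ _)).
  have := bad_sum N; have : 2 / B <= 1 by rewrite ler_pdivrMr// mul1r; move: B3; lra.
  by lra.
(* Terms of a convergent series tend to 0, so the growth [2 * c] holds from some index on; dropping
   the earlier scales enlarges only the central zone. *)
have [n0 hn0] : exists n0, forall n, (n0 <= n)%N -> 2 * c * 2 ^+ q n <= 2 ^+ q n.+1.
  pose r (n : nat) : R := 2 ^+ q n / 2 ^+ q n.+1.
  have r0 n : 0 <= r n by rewrite divr_ge0// ltW.
  have cv : cvgn (series r).
    apply: nondecreasing_is_cvgn; first exact: nondecreasing_series.
    by exists 2 => _ [N _ <-]; rewrite /series /= big_mkord.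
  have := cvg_series_cvg_0 cv => /cvgrPdist_le /(_ (2 * c)^-1).
  have ci : 0 < (2 * c)^-1 by rewrite invr_gt0 mulr_gt0.
  move=> /(_ ci) [n0 _ hn0]; exists n0 => n /hn0; rewrite sub0r normrN ger0_norm//.
  rewrite /r ler_pdivrMr// mulrC ler_pdivlMr ?mulr_gt0//.
  by rewrite mulrC.
pose n1 := (n0 + Num.bound (2 * c))%N.
pose t n : R := 2 ^+ q (n1 + n)%N.
(* On [[1, t 0]] crude bounds suffice: [g s / s <= g (t 0)] and [g u / u >= g 1 / t 0]. *)
exists t, (g (t 0%N) * t 0%N / g 1), 2; split.
- split; last by move=> n; rewrite /t addnS; apply: hn0; rewrite /n1 -addnA leq_addr.
  apply/ltW/upper_nthrootP; rewrite /t addn0.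
  by apply: leq_trans (qn _); rewrite /n1 leq_addl.
- move=> N; apply: le_trans (sum2 (n1 + N)%N).
  have -> : \sum_(n < N) t n / t n.+1 =
      \sum_(n < N) 2 ^+ q (n1 + n)%N / 2 ^+ q (n1 + n).+1.
    by apply: eq_bigr => n _; rewrite /t addnS.
  rewrite big_split_ord /= lerDr.
  by apply: sumr_ge0 => n _; rewrite divr_ge0// ltW.
- move=> s u s1 su ut.
  have s0 : 0 < s by lra.
  have u0 : 0 < u by lra.
  have t0 : 0 < t 0%N by exact: e2.
  have g1 : 0 < g 1 by exact: (phi_gt0 pg).
  apply: (@le_trans _ _ (g (t 0%N))).
    rewrite ler_pdivrMr//; apply: (@le_trans _ _ (g (t 0%N) * 1)).
      by rewrite mulr1; apply: (phi_le pg); lra.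
    by rewrite ler_wpM2l// ltW// (phi_gt0 pg).
  rewrite -!mulrA ler_peMr ?(ltW (phi_gt0 pg t0))//.
  have -> : t 0%N * ((g 1)^-1 * (g u / u)) = (t 0%N / u) * (g u / g 1).
    by field; rewrite !gt_eqF.
  rewrite -[leLHS]mul1r; apply: ler_pM => //.
    by rewrite ler_pdivlMr// mul1r.
  by rewrite ler_pdivlMr// mul1r; apply: (phi_le pg) => //; lra.
- move=> n s u ts su ut.
  set m := (n1 + n)%N in ts ut; rewrite /t -/m in ts; rewrite /t addnS -/m in ut.
  have s1 : 1 <= s by apply: le_trans ts; rewrite exprn_ege1// ler1n.
  have s0 : 0 < s by lra.
  have u0 : 0 < u by lra.
  have gu0 : 0 < g u by exact: (phi_gt0 pg).
  have gsu : g s <= g u by apply: (phi_le pg) => //; exact: ltW.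
  have gu : 0 < g u / u by rewrite divr_gt0.
  (* Otherwise two dyadic points fit between [s] and [u]. Rounding costs 2 at [s] and 4 at [u], the
     greedy choice costs [B], and together this is [8 * B <= c]. *)
  have [u4|u4] := leP u (4 * s).
    apply: (@le_trans _ _ (4 * (g u / u))); last by rewrite ler_pM2r//; move: B3 Bc; lra.
    rewrite ler_pdivrMr// mulrAC mulrA ler_pdivlMr//.
    apply: (@le_trans _ _ (g u * (4 * s))); last by rewrite le_eqVlt; apply/orP; left; apply/eqP; ring.
    by apply: ler_pM => //; [exact/ltW/(phi_gt0 pg)|exact: ltW].
  have [a /andP[a1 a2]] := dyadic_location s1.
  have u1 : 1 <= u by lra.
  have [b /andP[b1 b2]] := dyadic_location u1.
  have ma : (q m <= a)%N.
    by rewrite -ltnS -(@ltr_eXn2l R 2) ?ltr1n//; exact: le_lt_trans a2.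
  have bm : (b <= q m.+1)%N.
    by rewrite -(@ler_eXn2l R 2) ?ltr1n//; exact: le_trans ut.
  have ab : (a.+1 < b)%N.
    rewrite -ltnS -(@ltr_eXn2l R 2) ?ltr1n//; apply: le_lt_trans b2.
    by rewrite 2!exprS mulrA; apply: le_trans (ltW u4); rewrite -natrM ler_pM2l.
  have bp : b = b.-1.+1 by rewrite prednK// (leq_ltn_trans _ ab).
  have key : e a.+1 <= B * e b.-1.
    have [_ _ _ h] := hf (q m); apply: h.
    - exact: leq_trans ma _.
    - by rewrite -ltnS -bp.
    - by rewrite -qS -bp.
  apply: (@le_trans _ _ (2 * e a.+1)).
    rewrite /e exprS ler_pdivrMr//.
    have -> : 2 * (g (2 * 2 ^+ a) / (2 * 2 ^+ a)) * s = g (2 * 2 ^+ a) * (s / 2 ^+ a).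
      by field; rewrite gt_eqF.
    rewrite -[leLHS]mulr1; apply: ler_pM => //.
    - exact/ltW/(phi_gt0 pg).
    - by apply: (phi_le pg); [exact: ltW|rewrite -exprS; exact: ltW].
    - by rewrite ler_pdivlMr// mul1r.
  apply: (@le_trans _ _ (2 * (B * e b.-1))); first by rewrite ler_pM2l.
  apply: (@le_trans _ _ (2 * (B * (4 * (g u / u))))); last first.
    have -> : 2 * (B * (4 * (g u / u))) = (8 * B) * (g u / u) by ring.
    by rewrite ler_pM2r.
  rewrite ler_pM2l// ler_pM2l// /e ler_pdivrMr//.
  have -> : 4 * (g u / u) * 2 ^+ b.-1 = g u * (4 * 2 ^+ b.-1 / u) by ring.
  rewrite -[leLHS]mulr1; apply: ler_pM => //.
  + exact/ltW/(phi_gt0 pg).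
  + apply: (phi_le pg); first exact: ltW.
    by apply: le_trans b1; rewrite ler_weXn2l ?ler1n// leq_pred.
  + rewrite ler_pdivlMr// mul1r; apply: le_trans (ltW b2) _.
    by rewrite [in leLHS]bp 2!exprS mulrA -natrM.
Qed.

End GreedyScales.

(** * Construction of H from the scales *)

Section PhiFromQuasiConcavity.
Context {R : realType}.

(** Monotonicity of [f x / x] makes [f] locally Lipschitz away from 0; at 0 continuity comes from
    the small values. *)
Lemma quasi_concave_phi (f : R -> R) : f 0 = 0 ->
  (forall x y, 0 <= x -> x < y -> f x < f y) ->
  (forall x y, 0 < x -> x < y -> f y <= y / x * f x) ->
  (forall e, 0 < e -> exists2 x, 0 < x & f x < e) ->
  (forall A, exists2 x, 0 <= x & A <= f x) -> phi_function f.
Proof.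
move=> f0 fi fq fs fl; apply: phi_of_cont => //.
have fle x y : 0 <= x -> x <= y -> f x <= f y.
  by move=> x0; rewrite le_eqVlt => /predU1P[->//|xy]; exact/ltW/fi.
move=> x e; rewrite le_eqVlt => /predU1P[<-|x0] e0.
  have [d d0 fd] := fs _ e0; exists d => // y y0.
  rewrite sub0r normrN ger0_norm// f0 sub0r normrN => yd.
  have fy : 0 <= f y by rewrite -f0 fle.
  by rewrite ger0_norm//; apply: le_lt_trans fd; apply: fle => //; exact: ltW.
have fx0 : 0 < f x by rewrite -f0 fi.
have d0 : 0 < Num.min (x / 2) (e * x / (2 * f x)).
  by rewrite lt_min !divr_gt0// ?mulr_gt0.
exists (Num.min (x / 2) (e * x / (2 * f x))) => // y y0.
rewrite lt_min => /andP[h1 h2].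
have lip : `|f x - f y| * x <= 2 * f x * `|x - y|.
  have [xy|yx|->] := ltgtP x y; last by rewrite !subrr !normr0 mul0r mulr0.
    rewrite distrC (distrC x) !gtr0_norm ?subr_gt0//; last by rewrite fi// ltW.
    have := fq _ _ x0 xy; rewrite mulrAC ler_pdivlMr// => h.
    have : 0 <= f x * (y - x) by rewrite mulr_ge0 ?subr_ge0 ?ltW.
    by move: h; lra.
  move: h1; rewrite !gtr0_norm ?subr_gt0//; last by rewrite fi.
  move=> h1; have yp : 0 < y by lra.
  have := fq _ _ yp yx; rewrite mulrAC ler_pdivlMr// => h.
  have fyx : f y <= f x by apply: fle => //; exact: ltW.
  have fy0 : 0 <= f y by rewrite -f0 fle.
  have : 0 <= (f x - f y) * (2 * y - x).
    by apply: mulr_ge0; [rewrite subr_ge0|lra].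
  have : 0 <= (f x - f y) * (x - y) by apply: mulr_ge0; rewrite subr_ge0// ltW.
  by move: h; lra.
rewrite -(ltr_pM2r x0); apply: le_lt_trans lip _.
by move: h2; rewrite ltr_pdivlMr ?mulr_gt0// mulrC.
Qed.

End PhiFromQuasiConcavity.

Section ConvexMajorant.
Context {R : realType}.

(** [K] is a supremum of the convex functions [k u / u * max (v - u) 0]. The choice [u = v / 2]
    gives [k (v / 2)] from below, and the hypothesis gives [A * k v] from above. *)
Lemma quasi_convex_equiv (k : R -> R) (A : R) : phi_function k -> 1 <= A ->
  (forall u v, 0 < u -> u <= v -> k u / u <= A * (k v / v)) ->
  exists K, [/\ phi_function K, convex_on_halfline K & phi_equiv k K].
Proof.
move=> pk A1 kq.
pose T u v : R := k u / u * Num.max (v - u) 0.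
pose E v := [set T u v | u in [set u | 0 < u]].
pose K v := sup (E v).
have ku0 u : 0 < u -> 0 < k u / u by move=> u0; rewrite divr_gt0// (phi_gt0 pk).
have T0 u v : 0 < u -> 0 <= T u v.
  by move=> u0; rewrite mulr_ge0 ?(ltW (ku0 _ u0))// le_max lexx orbT.
have Tub v : 0 <= v -> ubound (E v) (A * k v).
  move=> v0 _ [u u0 <-].
  have Ak : 0 <= A * k v by rewrite mulr_ge0 ?(phi_ge0 pk)//; lra.
  have [uv|vu] := ltP u v; last by rewrite /T max_r ?mulr0// subr_le0.
  have vp : 0 < v by exact: lt_trans uv.
  rewrite /T max_l ?subr_ge0 ?(ltW uv)//.
  apply: (@le_trans _ _ (k u / u * v)).
    by rewrite ler_pM2l ?ku0// gerBl ltW.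
  apply: (@le_trans _ _ (A * (k v / v) * v)); last by rewrite -mulrA divfK// gt_eqF.
  by rewrite ler_pM2r//; apply: kq => //; exact: ltW.
have E0 v : E v !=set0 by exists (T 1 v); exists 1 => //=.
have Kle v x : 0 <= v -> (forall u, 0 < u -> T u v <= x) -> K v <= x.
  by move=> v0 h; apply: ge_sup => // _ [u u0 <-]; exact: h.
have Kge v u : 0 <= v -> 0 < u -> T u v <= K v.
  move=> v0 u0; apply: ub_le_sup; last by exists u.
  by exists (A * k v); exact: Tub.
have KA v : 0 <= v -> K v <= A * k v by move=> v0; apply: ge_sup => //; exact: Tub.
have Kge0 v : 0 <= v -> 0 <= K v.
  by move=> v0; apply: le_trans (T0 1 v ltr01) _; exact: Kge.
have K0 : K 0 = 0.
  by apply/eqP; rewrite eq_le Kge0// andbT (le_trans (KA _ _))// (phi0 pk) mulr0.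
have Khalf v : 0 < v -> k (v / 2) <= K v.
  move=> v0; have v20 : 0 < v / 2 by rewrite divr_gt0.
  apply: le_trans (Kge v _ (ltW v0) v20).
  have e : v - v / 2 = v / 2 by lra.
  by rewrite /T e max_l ?(ltW v20)// divfK// gt_eqF.
have Kp v : 0 < v -> 0 < K v.
  by move=> v0; apply: lt_le_trans (Khalf _ v0); rewrite (phi_gt0 pk)// divr_gt0.
have cK : convex_on_halfline K.
  move=> x y l x0 y0 /andP[l0 l1]; apply: Kle.
    by rewrite addr_ge0// mulr_ge0// subr_ge0.
  move=> u u0; have [h1 h2] := (Kge x u x0 u0, Kge y u y0 u0).
  apply: (@le_trans _ _ (l * T u x + (1 - l) * T u y)); last first.
    by rewrite lerD// ler_wpM2l// subr_ge0.
  rewrite /T.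
  have -> : l * (k u / u * Num.max (x - u) 0) + (1 - l) * (k u / u * Num.max (y - u) 0)
     = k u / u * (l * Num.max (x - u) 0 + (1 - l) * Num.max (y - u) 0) by ring.
  rewrite ler_pM2l ?ku0// ge_max; apply/andP; split.
    have h3 : l * (x - u) <= l * Num.max (x - u) 0 by rewrite ler_wpM2l// le_max lexx.
    have h4 : (1 - l) * (y - u) <= (1 - l) * Num.max (y - u) 0.
      by rewrite ler_wpM2l ?subr_ge0// le_max lexx.
    apply: le_trans (lerD h3 h4).
    by rewrite le_eqVlt; apply/orP; left; apply/eqP; ring.
  by rewrite addr_ge0// mulr_ge0 ?subr_ge0// le_max lexx orbT.
have Kscale x y : 0 <= x -> x < y -> K x <= x / y * K y.
  move=> x0 xy; have y0 : 0 < y by exact: le_lt_trans xy.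
  have := cK y 0 (x / y) (ltW y0) (lexx _).
  rewrite K0 !mulr0 !addr0 divfK ?gt_eqF//; apply.
  by rewrite divr_ge0 ?(ltW y0)//= ler_pdivrMr// mul1r ltW.
have Ki x y : 0 <= x -> x < y -> K x < K y.
  move=> x0 xy; have y0 : 0 < y by exact: le_lt_trans xy.
  apply: le_lt_trans (Kscale _ _ x0 xy) _.
  by rewrite gtr_pMl ?Kp// ltr_pdivrMr// mul1r.
have Klip x y X : 0 <= x -> x < y -> y <= X -> x + 1 <= X -> K y - K x <= (y - x) * K X.
  move=> x0 xy yX xX.
  pose l := (y - x) / (X - x).
  have Xx : 0 < X - x by lra.
  have l0 : 0 <= l by rewrite divr_ge0//; lra.
  have l1 : l <= 1 by rewrite ler_pdivrMr// mul1r; lra.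
  have X0 : 0 <= X by lra.
  have := cK X x l X0 x0; rewrite l0 l1 => /(_ isT).
  have -> : l * X + (1 - l) * x = y by rewrite /l; field; rewrite gt_eqF.
  have h1 : 0 <= l * K x by rewrite mulr_ge0// Kge0.
  have h2 : l * K X <= (y - x) * K X.
    rewrite ler_wpM2r ?Kge0// /l ler_pdivrMr// ler_peMr; lra.
  by move: h1 h2; lra.
have pK : phi_function K.
  apply: phi_of_cont => //; last first.
    move=> a; have [x x0 ax] := phi_large pk a.
    have [x00|xp] := eqVneq x 0.
      by exists 0 => //; rewrite K0; move: ax; rewrite x00 (phi0 pk).
    exists (2 * x); first by rewrite mulr_ge0.
    have xp' : 0 < x by rewrite lt_neqAle eq_sym xp.
    apply: le_trans ax _; have := Khalf (2 * x); rewrite mulrC mulfK//; apply.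
    by rewrite mulr_gt0.
  move=> x e x0 e0.
  have KX : 0 <= K (x + 2) by rewrite Kge0//; lra.
  have KX1 : 0 < K (x + 2) + 1 by lra.
  exists (Num.min 1 (e / (K (x + 2) + 1))); first by rewrite lt_min ltr01 divr_gt0.
  move=> y y0; rewrite lt_min ltr_pdivlMr// => /andP[h1 h2].
  have : `|K x - K y| <= `|x - y| * K (x + 2).
    have [xy|yx|->] := ltgtP x y; last by rewrite !subrr !normr0 mul0r.
      rewrite distrC (distrC x) !gtr0_norm ?subr_gt0//; last exact: Ki.
      by move: h1; rewrite distrC gtr0_norm ?subr_gt0// => h1; apply: Klip => //; lra.
    rewrite !gtr0_norm ?subr_gt0//; last exact: Ki.
    by apply: Klip => //; lra.
  have : `|x - y| * K (x + 2) <= `|x - y| * (K (x + 2) + 1).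
    by rewrite ler_wpM2l// lerDl.
  by lra.
exists K; split => //.
pose c := Num.max 2 (A ^+ 2).
have c2 : 2 <= c by rewrite le_max lexx.
have cA : A ^+ 2 <= c by rewrite le_max lexx orbT.
exists c; split; first by lra.
move=> t; rewrite le_eqVlt => /predU1P[<-|t0].
  by rewrite mul0r mulr0 (phi0 pk) K0.
split.
  apply: le_trans (Khalf _ t0); apply: (phi_le pk); first by rewrite divr_ge0 ?ltW//; lra.
  by rewrite ler_pM2l// lef_pV2 ?posrE//; lra.
apply: le_trans (KA _ (ltW t0)) _.
(* A second use of the hypothesis, at [t] and [A^2 t], moves the outer factor into the argument:
   [A * k t <= k (A^2 t)]. *)
apply: (@le_trans _ _ (k (A ^+ 2 * t))); last first.
  apply: (phi_le pk); first by rewrite mulr_ge0 ?exprn_ge0 ?(ltW t0)//; lra.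
  by rewrite ler_pM2r.
have A21 : 1 <= A ^+ 2 by rewrite exprn_ege1.
have tA : t <= A ^+ 2 * t by rewrite ler_peMl// ltW.
have := kq _ _ t0 tA; rewrite ler_pdivrMr//.
have A0 : 0 < A by lra.
have -> : A * (k (A ^+ 2 * t) / (A ^+ 2 * t)) * t = k (A ^+ 2 * t) / A.
  by field; rewrite !gt_eqF.
by rewrite ler_pdivlMr// mulrC.
Qed.

End ConvexMajorant.

Section ScaleFunction.
Context {R : realType}.
Local Notation mu := (@lebesgue_measure R).
Variables (s : int -> R) (c S : R).
Hypotheses (s0 : forall n, 0 < s n) (c2 : 2 <= c)
  (sc : forall n, 2 * c * s n <= s (n + 1))
  (sS : int_summable (fun n => s (n - 1) / s n) S).

Let c0 : 0 < c. Proof. by move: c2; lra. Qed.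
Let e0 n : 0 < c ^ n. Proof. exact: exprz_gt0. Qed.

Let s2 n : 2 * s n <= s (n + 1).
Proof.
apply: le_trans (sc n); rewrite ler_pM2r//.
by rewrite ler_peMr//; move: c2; lra.
Qed.

Let a n := s n / c ^ n.
Let a0 n : 0 < a n. Proof. by rewrite divr_gt0. Qed.
Let a2 n : 2 * a n <= a (n + 1).
Proof.
rewrite /a exprzSr// ler_pdivlMr ?mulr_gt0//.
have -> : 2 * (s n / c ^ n) * (c * c ^ n) = 2 * c * s n by field; rewrite gt_eqF.
exact: sc.
Qed.

(** An infimum of affine functions with constants [c^n] and slopes [c^n / s n]; since [s] grows by
    at least [2 * c], the constants increase while the slopes halve. *)
Definition scale_fun (t : R) : R := inf [set c ^ n * (1 + t / s n) | n in [set: int]].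
Local Notation L := scale_fun.

Let term_ge0 n t : 0 <= t -> 0 <= c ^ n * (1 + t / s n).
Proof. by move=> t0; rewrite mulr_ge0 ?(ltW (e0 _))// addr_ge0// divr_ge0// ltW. Qed.

Let L_le n t : 0 <= t -> L t <= c ^ n * (1 + t / s n).
Proof.
move=> t0; apply: ge_inf; last by exists n.
by exists 0 => _ [m _ <-]; exact: term_ge0.
Qed.

Let L_ge t v : (forall n, v <= c ^ n * (1 + t / s n)) -> v <= L t.
Proof.
move=> h; apply: lb_le_inf; first by exists (c ^ (0 : int) * (1 + t / s 0)); exists 0.
by move=> _ [n _ <-].
Qed.

Let L_ge0 t : 0 <= t -> 0 <= L t.
Proof. by move=> t0; apply: L_ge => n; exact: term_ge0. Qed.

(** Terms with [m >= n] are bounded below by their constants, earlier ones by their larger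
    slopes. *)
Lemma scale_fun_lower n t : s n <= t -> c ^ n <= L t.
Proof.
move=> nt; have t0 : 0 < t by exact: lt_le_trans nt.
apply: L_ge => m; rewrite mulrDr mulr1.
have [nm|/ltW mn] := leP n m.
  have h : c ^ n <= c ^ m by apply: ler_weXz2l => //; move: c2; lra.
  by apply: le_trans h _; rewrite lerDl mulr_ge0 ?divr_ge0 ?ltW.
apply: (@le_trans _ _ (c ^ m * (t / s m))); last by rewrite lerDr ltW.
have := zone_le a0 a2 mn; rewrite /a ler_pdivrMr// mulrAC ler_pdivlMr// => h.
rewrite mulrA ler_pdivlMr// mulrC; apply: le_trans h _.
by rewrite mulrC ler_pM2l.
Qed.

Lemma scale_fun_upper n t : 0 <= t -> t <= s n -> L t <= 2 * c ^ n.
Proof.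
move=> t0 tn; apply: le_trans (L_le n t0) _; rewrite mulrC ler_pM2r//.
have : t / s n <= 1 by rewrite ler_pdivrMr// mul1r.
by lra.
Qed.

Let L_mono x y : 0 <= x -> x <= y -> L x <= L y.
Proof.
move=> x0 xy; apply: L_ge => n; apply: le_trans (L_le n x0) _.
by rewrite ler_pM2l// lerD2l ler_pM2r// invr_gt0.
Qed.

Let L_quot x y : 0 < x -> x <= y -> L y <= y / x * L x.
Proof.
move=> x0 xy; have y0 : 0 < y by exact: lt_le_trans xy.
have q0 : 0 < y / x by rewrite divr_gt0.
rewrite -ler_pdivrMl//; apply: L_ge => n; rewrite ler_pdivrMl//.
apply: le_trans (L_le n (ltW y0)) _.
rewrite mulrCA ler_pM2l// mulrDr mulr1 lerD//.
  by rewrite ler_pdivlMr// mul1r.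
by rewrite mulrA divfK// gt_eqF.
Qed.

Let L_0 : L 0 = 0.
Proof.
apply/eqP; rewrite eq_le L_ge0// andbT leNgt; apply/negP => L0.
have h : 0 < L 0 / 2 by rewrite divr_gt0.
have [n /andP[hn _]] := zone_expz c2 h.
have := L_le n (lexx 0); rewrite mul0r addr0 mulr1.
by move: hn; lra.
Qed.

(** An infimum of strictly increasing functions need not be strictly increasing. Here the terms
    beyond [n1] exceed [L y + 1], and the others have slope at least [b]. *)
Let L_lt x y : 0 <= x -> x < y -> L x < L y.
Proof.
move=> x0 xy; have y0 : 0 < y by exact: le_lt_trans xy.
have h : 0 < L y + 1 by rewrite ltr_pwDr// L_ge0// ltW.
have [n' /andP[_ hn]] := zone_expz c2 h.
pose n1 := n' + 1.
pose b := (a n1)^-1.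
have b0 : 0 < b by rewrite invr_gt0.
pose d := Num.min 1 (b * (y - x)).
have d0 : 0 < d by rewrite lt_min ltr01 mulr_gt0// subr_gt0.
apply: (@lt_le_trans _ _ (L x + d)); first by rewrite ltrDl.
apply: L_ge => n.
have [nn|/ltW nn] := leP n1 n.
  have h1 : c ^ n1 <= c ^ n by apply: ler_weXz2l => //; move: c2; lra.
  have h2 : c ^ n <= c ^ n * (1 + y / s n).
    by rewrite ler_peMr ?(ltW (e0 _))// lerDl divr_ge0// ltW.
  have h3 : L x <= L y by apply: L_mono => //; exact: ltW.
  have h4 : d <= 1 by rewrite ge_min lexx.
  by move: hn; rewrite -/n1; lra.
have h1 := L_le n x0.
have h2 : d <= b * (y - x) by rewrite ge_min lexx orbT.
have h3 : b * (y - x) <= (a n)^-1 * (y - x).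
  by rewrite ler_pM2r ?subr_gt0// /b lef_pV2 ?posrE//; exact: zone_le.
have -> : c ^ n * (1 + y / s n) = c ^ n * (1 + x / s n) + (a n)^-1 * (y - x).
  by rewrite /a; field; rewrite !gt_eqF.
by lra.
Qed.

(** Dual to the preceding argument: terms up to [n0] stay above [l + 1], and the others gain at
    least [c^n0 * (1/x - 1/y)]. *)
Let L_quot_lt x y : 0 < x -> x < y -> L y / y < L x / x.
Proof.
move=> x0 xy; have y0 : 0 < y by exact: lt_trans xy.
pose l := L y / y.
have l0 : 0 <= l by rewrite divr_ge0 ?L_ge0 ?ltW.
have h : 0 < (l + 1)^-1 by rewrite invr_gt0; lra.
have [n0 /andP[hn0 _]] := zone_exists a0 a2 h.
have xy0 : 0 < x^-1 - y^-1 by rewrite subr_gt0 ltf_pV2.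
pose d := Num.min 1 (c ^ n0 * (x^-1 - y^-1)).
have d0 : 0 < d by rewrite lt_min ltr01 mulr_gt0.
apply: (@lt_le_trans _ _ (l + d)); first by rewrite ltrDl.
rewrite ler_pdivlMr//; apply: L_ge => n; rewrite -ler_pdivlMr//.
have -> : c ^ n * (1 + x / s n) / x = c ^ n * x^-1 + (a n)^-1.
  by rewrite /a; field; rewrite !gt_eqF.
have [nn|/ltW nn] := leP n n0.
  have h1 : l + 1 <= (a n)^-1.
    rewrite -[leLHS]invrK lef_pV2 ?posrE//.
    by apply: le_trans hn0; exact: zone_le.
  have h2 : 0 <= c ^ n * x^-1 by rewrite mulr_ge0 ?invr_ge0 ?ltW.
  have h4 : d <= 1 by rewrite ge_min lexx.
  by lra.
have h1 : l <= c ^ n * y^-1 + (a n)^-1.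
  rewrite /l ler_pdivrMr//; apply: le_trans (L_le n (ltW y0)) _.
  by rewrite le_eqVlt; apply/orP; left; apply/eqP; rewrite /a; field; rewrite !gt_eqF.
have h2 : d <= c ^ n0 * (x^-1 - y^-1) by rewrite ge_min lexx orbT.
have h3 : c ^ n0 * (x^-1 - y^-1) <= c ^ n * (x^-1 - y^-1).
  by rewrite ler_pM2r//; apply: ler_weXz2l => //; move: c2; lra.
by move: h3; rewrite (mulrBr (c ^ n)); lra.
Qed.

Lemma phi_scale_fun : phi_function L.
Proof.
apply: quasi_concave_phi => //.
- by move=> x y x0 /ltW; exact: L_quot.
- move=> e e1; have h : 0 < e / 4 by rewrite divr_gt0.
  have [n /andP[hn _]] := zone_expz c2 h; exists (s n) => //.
  by have := scale_fun_upper (ltW (s0 n)) (lexx _); move: hn; lra.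
- move=> A; have h : 0 < `|A| + 1 by rewrite ltr_pwDr.
  have [n /andP[_ hn]] := zone_expz c2 h; exists (s (n + 1)); first exact: ltW.
  apply: le_trans (scale_fun_lower (lexx _)).
  by have := ler_norm A; lra.
Qed.

Let L_gt0 t : 0 < t -> 0 < L t.
Proof. exact: (phi_gt0 phi_scale_fun). Qed.

Definition scale_quot (t : R) : R := t / L t.
Local Notation J := scale_quot.

Lemma phi_scale_quot : phi_function J.
Proof.
have J0 : J 0 = 0 by rewrite /J mul0r.
have Jp x : 0 < x -> 0 < J x by move=> x0; rewrite /J divr_gt0// L_gt0.
apply: quasi_concave_phi => //.
- move=> x y; rewrite le_eqVlt => /predU1P[<-|x0] xy; first by rewrite J0 Jp.
  have y0 : 0 < y by exact: lt_trans xy.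
  rewrite -ltf_pV2 ?posrE ?Jp// /J !invf_div.
  exact: L_quot_lt.
- move=> x y x0 xy; have y0 : 0 < y by exact: lt_trans xy.
  rewrite /J mulrA divfK ?gt_eqF// ler_pM2l// lef_pV2 ?posrE ?L_gt0//.
  by apply: L_mono; exact: ltW.
- move=> e e1; have h : 0 < e / 2 by rewrite divr_gt0.
  have [n /andP[hn _]] := zone_exists a0 a2 h; exists (s n) => //.
  apply: (@le_lt_trans _ _ (a n)); last by move: hn; lra.
  by rewrite /J /a ler_pM2l// lef_pV2 ?posrE ?L_gt0//; exact: scale_fun_lower.
- move=> A; have h : 0 < 2 * (`|A| + 1) by rewrite mulr_gt0// ltr_pwDr.
  have [n /andP[_ hn]] := zone_exists a0 a2 h; exists (s (n + 1)); first exact: ltW.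
  apply: (@le_trans _ _ (a (n + 1) / 2)); first by have := ler_norm A; lra.
  rewrite /J /a -mulrA ler_pM2l// -invfM lef_pV2 ?posrE ?L_gt0 ?mulr_gt0//.
  by rewrite mulrC; apply: scale_fun_upper => //; exact: ltW.
Qed.

Definition scale_H : R -> R := phi_inv J.
Local Notation H := scale_H.
Definition scale_Hs : R -> R := phi_inv L.
Local Notation Hs := scale_Hs.

Lemma phi_scale_H : phi_function H.
Proof. exact: phi_phi_inv phi_scale_quot. Qed.

Lemma phi_scale_Hs : phi_function Hs.
Proof. exact: phi_phi_inv phi_scale_fun. Qed.

(** Since [H] inverts [t / L t], its quotient is [L] along [H]; hence [H] itself can serve as [F0]
    in [N_function]. *)
Let H_quot x : 0 < x -> H x / x = (L \o H) x.
Proof.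
move=> x0; have Hx : 0 < H x by exact: (phi_gt0 phi_scale_H).
have -> : H x / x = H x / J (H x) by rewrite /H (phi_invK phi_scale_quot)// ltW.
by rewrite /J /= invf_div mulrCA mulfV ?mulr1// gt_eqF.
Qed.

Lemma scale_H_N_function : N_function H.
Proof.
have pLH := phi_comp phi_scale_fun phi_scale_H.
split; first exact: phi_scale_H.
exists H; split; first exact: phi_scale_H; split.
  exists 1; split => // t t0; rewrite divr1 mul1r lexx.
  by split.
split.
  move=> x y; rewrite !in_itv /= !andbT => x0 y0 xy.
  by rewrite !H_quot//; apply: (phi_lt pLH) => //; exact: ltW.
split.
  apply/cvgryPge => A; have [x x0 Ax] := phi_large pLH A.
  exists x; split; [exact: num_real|move=> y /= xy].
  have y0 : 0 < y by exact: le_lt_trans xy.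
  rewrite H_quot//; apply: le_trans Ax _.
  by apply: (phi_le pLH) => //; exact: ltW.
apply/cvgrPdist_lt => e e1.
have d0 : 0 < phi_inv (L \o H) e by exact: (phi_gt0 (phi_phi_inv pLH)).
near=> t.
have t0 : 0 < t by near: t; exact: nbhs_right_gt.
have td : t < phi_inv (L \o H) e by near: t; exact: nbhs_right_lt.
rewrite sub0r normrN H_quot// ger0_norm; last exact/ltW/(phi_gt0 pLH).
rewrite -[ltRHS](phi_invK pLH (ltW e1)).
by apply: (phi_lt pLH) => //; exact: ltW.
Unshelve. all: by end_near. Qed.

Lemma scale_complementary : complementary H Hs.
Proof.
split; first exact: phi_scale_Hs.
exists 1; split => // t; rewrite divr1 mul1r => t0.
rewrite /H /Hs (phi_inv_phi_inv phi_scale_quot)// (phi_inv_phi_inv phi_scale_fun)//.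
move: t0; rewrite le_eqVlt => /predU1P[<-|t0]; first by rewrite /J !mul0r lexx.
by rewrite /J divfK ?gt_eqF ?L_gt0// lexx.
Qed.

Lemma scale_condJ : condJ H.
Proof.
exists Hs; split; first exact: scale_complementary.
have pHs := phi_scale_Hs.
pose S1 := Num.max 1 S.
have S11 : 1 <= S1 by rewrite le_max lexx.
have SS1 : S <= S1 by rewrite le_max lexx orbT.
have S10 : 0 < S1 by lra.
have [W [mW W0 iW WX]] : exists W : R -> \bar R, [/\ measurable_fun (@halfline R) W,
    forall y, (0 <= W y)%E,
    (\int[mu]_(y in @halfline R) W y <= 1%:E)%E &
    forall n y, (0 < y)%R -> (y <= (s n)^-1)%R -> ((s (n - 1) / S1)%:E <= W y)%E].
  apply: (@step_majorant R (fun n => s (n - 1) / S1) (fun n => (s n)^-1)).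
  - by move=> n; rewrite divr_ge0 ?ltW.
  - by move=> n; rewrite invr_gt0.
  move=> l ul.
  have -> : \sum_(n <- l) s (n - 1) / S1 * (s n)^-1 = (\sum_(n <- l) s (n - 1) / s n) / S1.
    by rewrite mulr_suml; apply: eq_bigr => n _; rewrite mulrAC.
  by rewrite ler_pdivrMr// mul1r (le_trans (sS ul)).
(* In zone [n] of [1/x], [L (1/x) <= 2 c^(n+1)], so dividing by [2 c^2] gives at most
   [L (s (n - 1))]. Quasi-concavity moves [S1] inside [L], and [Hs] then returns [s (n - 1) / S1],
   the step height of [W]. *)
pose k := 2 * c ^+ 2 * S1.
have k0 : 0 < k by rewrite !mulr_gt0 ?exprn_gt0.
apply: (@le_lt_trans _ _ k%:E); last by rewrite ltry.
apply: luxE_le => //; apply: le_trans iW.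
apply: le_integral_halfline => //.
- exact: (Gext_scaled_measurable pHs (condJ_nonincr_pos pHs)).
- by move=> x x0; apply: Gext_ge0 => //; rewrite mule_ge0 ?lee_fin// invr_ge0 ltW.
move=> x x0.
have xV : 0 < x^-1 by rewrite invr_gt0.
have [n /andP[n1 n2]] := zone_exists s0 s2 xV.
apply: (@le_trans _ _ (s (n - 1) / S1)%:E); last first.
  by apply: WX => //; rewrite -[leLHS]invrK lef_pV2 ?posrE.
rewrite (phi_inv_tilde pHs x0) invrK.
rewrite {2}/Hs (phi_inv_phi_inv phi_scale_fun) ?(ltW xV)//.
rewrite ger0_norm ?L_ge0 ?(ltW xV)//= lee_fin.
have y0 : 0 < s (n - 1) / S1 by rewrite divr_gt0.
rewrite -[leRHS](phi_inv_mem phi_scale_fun (ltW y0)).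
apply: (phi_le pHs); first by rewrite divr_ge0 ?L_ge0 ?ltW.
have h1 : L x^-1 <= 2 * (c * c ^ n) by rewrite -exprzSr//; apply: scale_fun_upper; exact: ltW.
have h2 : c ^ (n - 1) <= L (s (n - 1)) by exact: scale_fun_lower.
have ys : s (n - 1) / S1 <= s (n - 1) by rewrite ler_pdivrMr// ler_peMr// ltW.
have := L_quot y0 ys.
have -> : s (n - 1) / (s (n - 1) / S1) = S1 by field; rewrite !gt_eqF.
move=> h3.
have h4 : c ^ n = c * c ^ (n - 1) by rewrite -exprzSr// subrK.
rewrite ler_pdivrMr// /k.
have h5 : 2 * c ^+ 2 * c ^ (n - 1) <= 2 * c ^+ 2 * (S1 * L (s (n - 1) / S1)).
  by rewrite ler_pM2l ?mulr_gt0 ?exprn_gt0// (le_trans h2).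
apply: le_trans h1 _; rewrite h4.
apply: (@le_trans _ _ (2 * c ^+ 2 * c ^ (n - 1))).
  by rewrite le_eqVlt; apply/orP; left; apply/eqP; ring.
apply: le_trans h5 _.
by rewrite le_eqVlt; apply/orP; left; apply/eqP; ring.
Qed.

End ScaleFunction.

(** * Gluing the scales at infinity and at 0 *)

Section TwoSidedScales.
Context {R : realType}.

Lemma sum_sub_uniq (I : eqType) (v : I -> R) (l w : seq I) :
  uniq l -> uniq w -> {subset l <= w} -> (forall n, 0 <= v n) ->
  \sum_(n <- l) v n <= \sum_(n <- w) v n.
Proof.
move=> ul uw lw v0.
have pl : perm_eq l [seq n <- w | n \in l].
  apply: uniq_perm => //; first exact: filter_uniq.
  by move=> n; rewrite mem_filter; case: (boolP (n \in l)) => //= /lw ->.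
rewrite (perm_big _ pl) /= big_filter big_mkcond /=.
by apply: ler_sum => n _; case: ifP.
Qed.

Lemma int_summable_halves (v : int -> R) (S1 S2 : R) : (forall n, 0 <= v n) ->
  (forall N, \sum_(k < N) v (Posz k) <= S1) -> (forall N, \sum_(k < N) v (Negz k) <= S2) ->
  int_summable v (S1 + S2).
Proof.
move=> v0 h1 h2 l ul.
pose N := (\max_(n <- l) absz n).+1.
pose w := [seq Posz k | k <- iota 0 N] ++ [seq Negz k | k <- iota 0 N].
have uw : uniq w.
  rewrite cat_uniq !map_inj_uniq ?iota_uniq ?andbT; try by move=> ? ? [].
  by apply/hasPn => _ /mapP[k _ ->]; apply/negP => /mapP[].
have lw : {subset l <= w}.
  move=> n nl; have : (absz n < N)%N.
    by rewrite ltnS; apply: leq_bigmax_seq nl isT.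
  rewrite mem_cat; case: n nl => k _ kN; apply/orP; [left|right]; apply/mapP; exists k => //.
    by rewrite mem_iota.
  by rewrite mem_iota add0n; apply: leq_trans kN.
apply: le_trans (sum_sub_uniq ul uw lw v0) _.
rewrite big_cat !big_map /= lerD//.
  by have := h1 N; rewrite -(big_mkord xpredT (fun k => v (Posz k))) /index_iota subn0.
by have := h2 N; rewrite -(big_mkord xpredT (fun k => v (Negz k))) /index_iota subn0.
Qed.

(** Inversion of the argument reverses the order and inverts the quotient, so an inequality between
    quotients of [tilde G] at large scales becomes the same inequality for [G] at small ones. *)
Lemma tilde_quot (G : R -> R) (x : R) : 0 < x -> tilde G x^-1 / x^-1 = (G x / x)^-1.
Proof. by move=> x0; rewrite tilde_gt0E ?invr_gt0// invrK invf_div mulrC. Qed.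

Section Glue.
Variables (G : R -> R) (c : R) (tp tm : nat -> R) (Ap Am Sp Sm : R).
Hypotheses (pG : phi_function G) (c2 : 2 <= c).
Hypotheses (tp0 : 2 * c <= tp 0%N) (tpS : forall n, 2 * c * tp n <= tp n.+1)
  (tm0 : 2 * c <= tm 0%N) (tmS : forall n, 2 * c * tm n <= tm n.+1)
  (sump : forall N, \sum_(n < N) tp n / tp n.+1 <= Sp)
  (summ : forall N, \sum_(n < N) tm n / tm n.+1 <= Sm)
  (centerp : forall s u, 1 <= s -> s <= u -> u <= tp 0%N -> G s / s <= Ap * (G u / u))
  (centerm : forall s u, 1 <= s -> s <= u -> u <= tm 0%N ->
     tilde G s / s <= Am * (tilde G u / u))
  (zonep : forall n s u, tp n <= s -> s <= u -> u <= tp n.+1 -> G s / s <= c * (G u / u))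
  (zonem : forall n s u, tm n <= s -> s <= u -> u <= tm n.+1 ->
     tilde G s / s <= c * (tilde G u / u)).

(** [Negz k] is [-(k+1)], so zone -1 runs from [1 / tm 0] to [tp 0]; it contains 1 and is the only
    zone outside [zonep] and [zonem]. *)
Let s (n : int) : R := match n with Posz k => tp k | Negz k => (tm k)^-1 end.
Let e (x : R) := G x / x.

Let c0 : 0 < c. Proof. by move: c2; lra. Qed.

Let tge1 (t : nat -> R) : 2 * c <= t 0%N -> (forall n, 2 * c * t n <= t n.+1) ->
  forall n, 1 <= t n.
Proof.
move=> t0 tS; elim=> [|n IH]; first by move: c2; lra.
apply: le_trans (tS n); rewrite -[leLHS]mulr1; apply: ler_pM => //.
by move: c2; lra.
Qed.

Let tp1 n : 1 <= tp n. Proof. exact: tge1. Qed.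
Let tm1 n : 1 <= tm n. Proof. exact: tge1. Qed.

Let s0 n : 0 < s n.
Proof.
case: n => k /=; first by have := tp1 k; lra.
by rewrite invr_gt0; have := tm1 k; lra.
Qed.

Let e0 x : 0 < x -> 0 < e x.
Proof. by move=> x0; rewrite divr_gt0// (phi_gt0 pG). Qed.

Let tm_pos k : 0 < tm k. Proof. by have := tm1 k; lra. Qed.

Let NegzS k : Negz k.+1 + 1 = Negz k. Proof. by lia. Qed.

Let sc n : 2 * c * s n <= s (n + 1).
Proof.
case: n => [k|[|k]].
- by rewrite [_ + 1](_ : _ = Posz k.+1) //=; lia.
- rewrite [_ + 1](_ : _ = Posz 0%N) //=.
  apply: (@le_trans _ _ 1); last exact: tp1.
  by rewrite ler_pdivrMr// mul1r.
- by rewrite NegzS /= ler_pdivrMr// [leRHS]mulrC ler_pdivlMr.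
Qed.

Let s2 n : 2 * s n <= s (n + 1).
Proof.
apply: le_trans (sc n); rewrite ler_pM2r//.
by rewrite ler_peMr//; move: c2; lra.
Qed.

Let sS : int_summable (fun n => s (n - 1) / s n) ((1 + Sp) + Sm).
Proof.
apply: int_summable_halves.
- by move=> n; rewrite divr_ge0 ?ltW.
- case=> [|N].
    rewrite big_ord0; have := sump 0; rewrite big_ord0; lra.
  rewrite big_ord_recl lerD//.
    rewrite (_ : Posz _ - 1 = Negz 0%N) //= ler_pdivrMr ?mul1r; last by have := tp1 0%N; lra.
    by apply: le_trans (tp1 0%N); rewrite invf_le1.
  apply: le_trans (sump N); apply: ler_sum => k _.
  rewrite lift0 (_ : Posz k.+1 - 1 = Posz k) //=; lia.
- move=> N; apply: le_trans (summ N); apply: ler_sum => k _.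
  rewrite (_ : Negz k - 1 = Negz k.+1) /=; last by lia.
  by rewrite invrK mulrC.
Qed.

Let A : R := Num.max c (Num.max 1 Ap * Num.max 1 Am).
Let Ap1 : 1 <= Num.max 1 Ap. Proof. by rewrite le_max lexx. Qed.
Let Am1 : 1 <= Num.max 1 Am. Proof. by rewrite le_max lexx. Qed.
Let Ac : c <= A. Proof. by rewrite le_max lexx. Qed.
Let A1 : 1 <= A. Proof. by move: Ac c2; lra. Qed.

Let e_tilde x y : 0 < x -> x <= y -> forall B, 0 < B ->
  tilde G y^-1 / y^-1 <= B * (tilde G x^-1 / x^-1) -> e x <= B * e y.
Proof.
move=> x0 xy B B0; have y0 : 0 < y by exact: lt_le_trans xy.
rewrite !tilde_quot// -/(e x) -/(e y) ler_pdivlMr ?e0//.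
by rewrite mulrC ler_pdivrMr ?e0.
Qed.

Let center x y : s (-1) <= x -> x <= y -> y <= s 0 -> e x <= A * e y.
Proof.
move=> h1 h2 h3; have x0 : 0 < x by exact: lt_le_trans h1.
have y0 : 0 < y by exact: lt_le_trans h2.
have ex := e0 x0; have ey := e0 y0.
have up u v : 1 <= u -> u <= v -> v <= s 0 -> e u <= Num.max 1 Ap * e v.
  move=> u1 uv vs; apply: le_trans (centerp u1 uv vs) _.
  have v0 : 0 < v by lra.
  by rewrite ler_pM2r ?e0// le_max lexx orbT.
have down u v : s (-1) <= u -> u <= v -> v <= 1 -> e u <= Num.max 1 Am * e v.
  move=> us uv v1; have u0 : 0 < u by exact: lt_le_trans us.
  have v0 : 0 < v by exact: lt_le_trans uv.
  apply: e_tilde => //; first by move: Am1; lra.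
  have h4 : 1 <= v^-1 by rewrite invf_ge1.
  have h5 : v^-1 <= u^-1 by rewrite lef_pV2.
  have h6 : u^-1 <= tm 0%N by rewrite -[leRHS]invrK lef_pV2 ?posrE// invr_gt0.
  apply: le_trans (centerm h4 h5 h6) _.
  rewrite ler_wpM2r ?le_max ?lexx ?orbT//.
  by rewrite tilde_quot// invr_ge0 ltW// e0.
apply: (@le_trans _ _ (Num.max 1 Ap * Num.max 1 Am * e y)); last first.
  by rewrite ler_pM2r// le_max lexx orbT.
have [y1|y1] := leP y 1.
  apply: le_trans (down _ _ h1 h2 y1) _.
  by rewrite ler_pM2r// ler_peMl//; move: Am1; lra.
have [x1|x1] := leP 1 x.
  apply: le_trans (up _ _ x1 h2 h3) _.
  by rewrite ler_pM2r// ler_peMr//; move: Ap1; lra.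
apply: le_trans (down _ _ h1 (ltW x1) (lexx _)) _.
rewrite [Num.max 1 Ap * _]mulrC -mulrA ler_wpM2l//; first by move: Am1; lra.
by apply: up => //; exact: ltW.
Qed.

Let zone_step n x y : n != -1 -> s n <= x -> x <= y -> y <= s (n + 1) -> e x <= c * e y.
Proof.
case: n => [k|[|k]] // _.
  rewrite [_ + 1](_ : _ = Posz k.+1) /=; last by lia.
  exact: zonep.
rewrite NegzS => h1 h2 h3; have x0 : 0 < x by exact: lt_le_trans (s0 (Negz k.+1)) h1.
have y0 : 0 < y by exact: lt_le_trans h2.
apply: e_tilde => //; apply: (zonem (n := k)).
- by rewrite -[leLHS]invrK lef_pV2 ?posrE// invr_gt0.
- by rewrite lef_pV2.
- by rewrite -[leRHS]invrK lef_pV2 ?posrE// invr_gt0.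
Qed.

Let zone_any n x y : s n <= x -> x <= y -> y <= s (n + 1) -> e x <= A * e y.
Proof.
move=> h1 h2 h3; have x0 : 0 < x by exact: lt_le_trans h1.
have y0 : 0 < y by exact: lt_le_trans h2.
have [n1|n1] := eqVneq n (-1).
  by move: h1 h3; rewrite n1 => h1 h3; exact: center.
by apply: le_trans (zone_step n1 h1 h2 h3) _; rewrite ler_pM2r// e0.
Qed.

(* Only the crossing of the central zone costs the factor [A]. *)
Let E n := e (s n) * c ^ n.

Let E_mono n m : n <= m -> E n <= A * E m.
Proof.
move=> nm; have cz k : 0 < c ^ k by exact: exprz_gt0.
have Ep k : 0 < E k by rewrite mulr_gt0 ?e0.
(* The factor [A] on the nonnegative side absorbs the crossing of zone -1, so [Eh] is monotone step
   by step and the length of the chain costs nothing. *)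
pose Eh k := if k < 0 then E k else A * E k.
have step k : Eh k <= Eh (k + 1).
  have sk : s k <= s (k + 1) by have := s2 k; have := s0 k; lra.
  have [k1|k1] := eqVneq k (-1).
    rewrite k1 /Eh /= /E mulrA; apply: ler_pM.
    - exact/ltW/e0.
    - exact/ltW/cz.
    - apply: center => //; first by move: sk; rewrite k1.
    - by apply: ler_weXz2l => //; move: c2; lra.
  have h : E k <= E (k + 1).
    rewrite /E exprzSr// mulrA ler_pM2r// mulrC.
    by apply: (zone_step k1).
  rewrite /Eh (_ : (k + 1 < 0) = (k < 0)); last by move: k1; lia.
  by case: ifP => // _; rewrite ler_pM2l//; move: A1; lra.
have [j mE] : exists j : nat, m = n + j%:Z by exists (absz (m - n)%R); lia.
have chain : Eh n <= Eh m.
  rewrite {}mE {nm m}; elim: j => [|j IH]; first by rewrite addr0.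
  apply: le_trans IH _; apply: le_trans (step _) _.
  by rewrite -addrA (_ : j%:Z + 1 = j.+1%:Z)//; lia.
have Em k : 0 <= E k by exact: ltW.
apply: le_trans (le_trans _ chain) _; rewrite /Eh; case: ifP => _ //;
  by rewrite ler_peMl.
Qed.

(** One factor [A] from [x] to the end of its zone, one for the chain [E], and one from the start of
    the last zone to [y]. *)
Let zone_pair n m x y : s n <= x < s (n + 1) -> s m <= y < s (m + 1) -> x <= y ->
  e x * c ^ n <= A ^+ 3 * (e y * c ^ m).
Proof.
move=> /andP[n1 n2] /andP[m1 m2] xy.
have cz k : 0 < c ^ k by exact: exprz_gt0.
have x0 : 0 < x by exact: lt_le_trans n1.
have y0 : 0 < y by exact: lt_le_trans xy.
have A0 : 0 < A by move: A1; lra.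
have ey := e0 y0.
have nm : n <= m.
  rewrite leNgt; apply/negP => mn; have : m + 1 <= n by rewrite lezD1.
  by move/(zone_le s0 s2) => h; move: (lt_le_trans m2 (le_trans h n1)); rewrite ltNge xy.
move: nm; rewrite le_eqVlt => /predU1P[nm|nm].
  rewrite -nm mulrA ler_pM2r//.
  apply: (@le_trans _ _ (A * e y)).
    by apply: (zone_any n1 xy); rewrite nm; exact: ltW.
  by rewrite ler_pM2r// exprS ler_peMr ?(ltW A0)// exprn_ege1.
have n1m : n + 1 <= m by rewrite lezD1.
have h1 : e x <= A * e (s (n + 1)) by apply: (zone_any n1 (ltW n2)).
have h2 : e (s m) <= A * e y by apply: (zone_any (lexx _) m1 (ltW m2)).
have h3 := E_mono n1m.
have cn : c ^ n <= c ^ (n + 1) by apply: ler_weXz2l; [move: c2; lra|rewrite lerDl].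
apply: (@le_trans _ _ (A * E (n + 1))).
  rewrite /E mulrA; apply: ler_pM => //; [exact/ltW/e0|exact: ltW].
apply: (@le_trans _ _ (A * (A * E m))); first by rewrite ler_pM2l.
have -> : A ^+ 3 * (e y * c ^ m) = A * (A * (A * e y * c ^ m)) by ring.
by rewrite !ler_pM2l// /E ler_pM2r.
Qed.

(** The quotient of [G \o H] at [z] is [e (H z) * L (H z)], and [L] lies between [c^n] and
    [2 c^(n+1)] on zone [n]. So [zone_pair] is quasi-monotonicity of this quotient, which yields a
    convex equivalent. *)
Lemma glued_scales : exists H, N_function H /\ condJ H /\
  exists K, [/\ phi_function K, convex_on_halfline K & phi_equiv (G \o H) K].
Proof.
have pL := phi_scale_fun s0 c2 sc.
have pJ := phi_scale_quot s0 c2 sc.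
have pH := phi_scale_H s0 c2 sc.
exists (scale_H s c); split; first exact: (scale_H_N_function s0 c2 sc).
split; first exact: (scale_condJ s0 c2 sc sS).
have A0 : 0 < A by move: A1; lra.
have cz k : 0 < c ^ k by exact: exprz_gt0.
apply: (@quasi_convex_equiv R _ (2 * c * A ^+ 3)); first exact: phi_comp.
  have h : 1 <= A ^+ 3 by rewrite exprn_ege1.
  by rewrite -[leLHS]mulr1; apply: ler_pM => //; move: c2; lra.
move=> u v u0 uv; have v0 : 0 < v by exact: lt_le_trans uv.
pose x := scale_H s c u; pose y := scale_H s c v.
have x0 : 0 < x by exact: (phi_gt0 pH).
have y0 : 0 < y by exact: (phi_gt0 pH).
have xy : x <= y by apply: (phi_le pH) => //; exact: ltW.
have quot z : 0 < z -> (G \o scale_H s c) z / z =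
    e (scale_H s c z) * scale_fun s c (scale_H s c z).
  move=> z0; have Hz : 0 < scale_H s c z by exact: (phi_gt0 pH).
  rewrite /= /e.
  have {2}-> : z = scale_quot s c (scale_H s c z) by rewrite (phi_invK pJ)// ltW.
  by rewrite /scale_quot invf_div mulrA [RHS]mulrAC.
rewrite !quot// -/x -/y.
have [n hn] := zone_exists s0 s2 x0; have [m hm] := zone_exists s0 s2 y0.
have key := zone_pair hn hm xy.
have /andP[n1 n2] := hn; have /andP[m1 m2] := hm.
have Lx : scale_fun s c x <= 2 * (c * c ^ n).
  by rewrite -exprzSr//; apply: (scale_fun_upper s0 c2); exact: ltW.
have Ly : c ^ m <= scale_fun s c y by exact: (scale_fun_lower s0 c2 sc).
apply: (@le_trans _ _ (e x * (2 * (c * c ^ n)))); first by rewrite ler_pM2l// e0.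
have -> : e x * (2 * (c * c ^ n)) = 2 * c * (e x * c ^ n) by ring.
apply: (@le_trans _ _ (2 * c * (A ^+ 3 * (e y * c ^ m)))).
  by rewrite ler_pM2l// mulr_gt0.
rewrite mulrA ler_pM2l ?mulr_gt0 ?exprn_gt0//.
by rewrite ler_pM2l// e0.
Qed.

End Glue.
End TwoSidedScales.

Section PartTwo.
Context {R : realType}.

Theorem p_convex_necessary (F G : R -> R) (p : R) :
  phi_function F -> phi_function G -> 0 < p -> p_convex F G p ->
  exists H, N_function H /\ condJ H /\ succ G (phi_inv H \o @powf R p).
Proof.
move=> pF pG p0 cvx.
have ip0 : 0 < p^-1 by rewrite invr_gt0.
have pGp : phi_function (G \o @powf R p^-1) := phi_comp pG (phi_powf ip0).
have [C C1 test] := p_convex_test pF pG p0 cvx.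
have [M M1 hM] := scale_test_doubling pGp C1 test.
have chp := scale_test_chain pGp C1 test.
have chm := scale_test_chain_tilde pGp C1 test.
(* The same [c] serves [G] and its [tilde], so that both runs can be glued to a single sequence of
   scales. *)
pose c : R := 8 * Num.max M (3 * C).
have c2 : 2 <= c by have : M <= Num.max M (3 * C); [rewrite le_max lexx|rewrite /c; lra].
have [tp [Ap [Sp [[tp0 tpS] sump centerp zonep]]]] := greedy_scales pGp C1 M1 hM chp (lexx c).
have [tm [Am [Sm [[tm0 tmS] summ centerm zonem]]]] :=
  greedy_scales (phi_tilde pGp) C1 M1 (doubling_tilde pGp M1 hM) chm (lexx c).
have [H [nH [jH [K [pK cK [d [d0 eK]]]]]]] := glued_scales pGp c2 tp0 tpS tm0 tmS
  sump summ centerp centerm zonep zonem.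
exists H; split => //; split => //; exists K; split => //; split => //.
have pH : phi_function H by case: nH.
exists d; split => // t t0.
have E v : 0 <= v -> (G \o phi_inv (phi_inv H \o @powf R p)) v =
    ((G \o @powf R p^-1) \o H) v.
  move=> v0; rewrite /= phi_inv_comp//; [|exact: phi_phi_inv|exact: phi_powf].
  by rewrite phi_inv_phi_inv// phi_inv_powf// (phi_ge0 pH).
rewrite !E; first exact: eK.
  by rewrite mulr_ge0// ltW.
by rewrite divr_ge0// ltW.
Qed.

End PartTwo.

Theorem theorem5p3 (R : realType) (F G : R -> R) (p : R) :
  phi_function F -> phi_function G -> 0 < p ->
  ((p%:E < lower_boyd F G)%E ->
     (exists H : R -> R, N_function H /\ condJ H /\ succ G (phi_inv H \o powf p)) ->
     p_convex F G p)
  /\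
  (p_convex F G p ->
     (p%:E <= lower_boyd F G)%E /\
     exists H : R -> R, N_function H /\ condJ H /\ succ G (phi_inv H \o powf p)).
Proof.
move=> pF pG p0; split; first exact: p_convex_sufficient.
by move=> cvx; split; [exact: p_convex_boyd|exact: p_convex_necessary cvx].
Qed.
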